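(* Let $\mathbb T=\mathbb R/\mathbb Z$ and $\kappa>0$. Let $\rho\in L^1(\mathbb R)$ be an even function, $\rho\ge0$, with $\int_{\mathbb R}\rho(z)\,dz=1$ and $m_4:=\int_{\mathbb R}z^4\rho(z)\,dz<\infty$; put $m_2:=\int_{\mathbb R}z^2\rho(z)\,dz$. Let $\mathbf A=\kappa\,\partial_{xx}$ on $L^2(\mathbb T)$ with domain $\mathcal D(\mathbf A)=H^2(\mathbb T)$, and for $\varepsilon>0$ let $$(\mathbf A_\varepsilon u)(x)=\frac{2\kappa}{m_2\varepsilon^2}\int_{\mathbb T}\rho_\varepsilon(x-y)\big(u(y)-u(x)\big)\,dy,$$ where $\rho_\varepsilon$ is the periodization on $\mathbb T$ of $z\mapsto\varepsilon^{-1}\rho(z/\varepsilon)$. Then, with $X=H^4(\mathbb T)$, there exist a dense subspace $\mathcal D_0\subset X$ which is a core for $\mathbf A$ and a function $r(\varepsilon)=\mathcal O(\varepsilon^2)$ as $\varepsilon\to0$ such that: (1) for every $\varepsilon>0$, $\mathbf A_\varepsilon$ generates a $C_0$-semigroup $(S_\varepsilon(t))_{t\ge0}$ on $L^2(\mathbb T)$ with $\|S_\varepsilon(t)\|_{\mathcal L(L^2(\mathbb T))}\le Me^{\omega t}$ for all $t\ge0$, where $M=1$ and $\omega=0$; (2) $\|\mathbf A_\varepsilon\varphi-\mathbf A\varphi\|_{L^2(\mathbb T)}\le r(\varepsilon)\,\|\varphi\|_{H^4(\mathbb T)}$ for all $\varphi\in\mathcal D_0$.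
   Context: The periodization of an integrable function $h$ on $\mathbb R$ is the function $\sum_{n\in\mathbb Z}h(\cdot+n)$ on $\mathbb T$. A core for $\mathbf A$ is a subspace of $\mathcal D(\mathbf A)$ dense in $\mathcal D(\mathbf A)$ for the graph norm $\|\varphi\|_{L^2}+\|\mathbf A\varphi\|_{L^2}$. Functions are real-valued. *)

(* Defs.v *)
From HB Require Import structures.
From mathcomp Require Import all_boot all_order all_algebra.
From mathcomp Require Import all_classical all_reals all_analysis.
From mathcomp Require Import measurable_realfun.

Set Implicit Arguments.
Unset Strict Implicit.
Unset Printing Implicit Defensive.

Import Order.TTheory GRing.Theory Num.Theory.
Import numFieldNormedType.Exports.

Local Open Scope classical_set_scope.
Local Open Scope ring_scope.

(* The library provides the vector space [LfunType mu _] of functions with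
   finite Lp-norm, but no normed structure on its quotient by almost everywhere
   equality. [L2 mu] is that quotient for p = 2, as a normed module. *)
Section L2_space.
Context d (T : measurableType d) (R : realType).
Variable mu : {measure set T -> \bar R}.

Local Notation LF := (LfunType mu (lee1n 2)).

Definition L2_eqv (f g : LF) : bool := `[< f = g %[ae mu] >].

Let L2_eqv_refl : reflexive L2_eqv.
Proof. by move=> f; apply/asboolP; apply: ae_eq_refl. Qed.

Let L2_eqv_sym : symmetric L2_eqv.
Proof. by move=> f g; apply/idP/idP => /asboolP h; apply/asboolP/ae_eq_sym. Qed.

Let L2_eqv_trans : transitive L2_eqv.
Proof.
by move=> f g h /asboolP gf /asboolP fh; apply/asboolP/(ae_eq_trans gf fh).
Qed.

Canonical L2_eqv_rel := EquivRel L2_eqv L2_eqv_refl L2_eqv_sym L2_eqv_trans.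

Local Open Scope quotient_scope.

Definition L2 : Type := {eq_quot L2_eqv}.
HB.instance Definition _ := Choice.on L2.
HB.instance Definition _ := EqQuotient.on L2.

Definition L2_to_Lfun (u : L2) : LF := repr u.
Definition L2_to_fun (u : L2) : T -> R := L2_to_Lfun u.
Coercion L2_to_fun : L2 >-> Funclass.

(* The class of [f] if [f] is square-integrable, and 0 otherwise. *)
Definition to_L2 (f : T -> R) : L2 := \pi_L2 (insubd (0 : LF) f).

Lemma L2_piP (f g : LF) : \pi_L2 f = \pi_L2 g <-> f = g %[ae mu].
Proof.
by split=> [/eqP|fg]; [|apply/eqP]; rewrite eqmodE => //; [move/asboolP|exact/asboolP].
Qed.

Lemma L2_reprP (f : LF) : L2_to_Lfun (\pi_L2 f) = f %[ae mu].
Proof. by apply/L2_piP; rewrite /L2_to_Lfun reprK. Qed.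

Definition L2_add (u v : L2) : L2 := \pi_L2 (L2_to_Lfun u + L2_to_Lfun v).
Definition L2_opp (u : L2) : L2 := \pi_L2 (- L2_to_Lfun u).
Definition L2_scale (a : R) (u : L2) : L2 := \pi_L2 (a *: L2_to_Lfun u).
Definition L2_norm (u : L2) : R := fine ('N[mu]_2%:E [EFin \o u])%E.

Let piD (f g : LF) : L2_add (\pi_L2 f) (\pi_L2 g) = \pi_L2 (f + g).
Proof.
apply/L2_piP; apply: filterS2 (L2_reprP f) (L2_reprP g) => x fx gx _ /=.
by congr (_ + _); [exact: fx|exact: gx].
Qed.

Let piN (f : LF) : L2_opp (\pi_L2 f) = \pi_L2 (- f).
Proof.
apply/L2_piP; apply: filterS (L2_reprP f) => x fx _ /=.
by congr (- _); exact: fx.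
Qed.

Let piZ a (f : LF) : L2_scale a (\pi_L2 f) = \pi_L2 (a *: f).
Proof.
apply/L2_piP; apply: filterS (L2_reprP f) => x fx _ /=.
by congr (_ * _); exact: fx.
Qed.

Let piE (u : L2) : exists f : LF, u = \pi_L2 f.
Proof. by exists (repr u); rewrite reprK. Qed.

Let L2_addA : associative L2_add.
Proof.
move=> u v w; have [f ->] := piE u; have [g ->] := piE v; have [h ->] := piE w.
by rewrite !piD addrA.
Qed.

Let L2_addC : commutative L2_add.
Proof.
by move=> u v; have [f ->] := piE u; have [g ->] := piE v; rewrite !piD addrC.
Qed.

Let L2_add0 : left_id (\pi_L2 0) L2_add.
Proof. by move=> u; have [f ->] := piE u; rewrite piD add0r. Qed.

Let L2_addN : left_inverse (\pi_L2 0) L2_opp L2_add.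
Proof. by move=> u; have [f ->] := piE u; rewrite piN piD addNr. Qed.

HB.instance Definition _ :=
  GRing.isZmodule.Build L2 L2_addA L2_addC L2_add0 L2_addN.

Let L2_scaleA a b (u : L2) : L2_scale a (L2_scale b u) = L2_scale (a * b) u.
Proof. by have [f ->] := piE u; rewrite !piZ scalerA. Qed.

Let L2_scale1 : left_id 1 L2_scale.
Proof. by move=> u; have [f ->] := piE u; rewrite !piZ scale1r. Qed.

Let L2_scaleDr : right_distributive L2_scale +%R.
Proof.
move=> a u v; have [f ->] := piE u; have [g ->] := piE v.
by rewrite [X in L2_scale _ X]piD !piZ [RHS]piD scalerDr.
Qed.

Let L2_scaleDl (u : L2) : {morph L2_scale^~ u : a b / a + b}.
Proof.
by move=> a b; have [f ->] := piE u; rewrite /= !piZ [RHS]piD scalerDl.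
Qed.

HB.instance Definition _ := GRing.Zmodule_isLmodule.Build R L2
  L2_scaleA L2_scale1 L2_scaleDr L2_scaleDl.

Let norm_pi (f : LF) : L2_norm (\pi_L2 f) = fine ('N[mu]_2%:E [EFin \o f])%E.
Proof.
congr fine; rewrite unlock; congr (_ `^ _)%E; apply: ae_eq_integral => //.
- apply: (@measurableT_comp _ _ _ _ _ _ (fun y : \bar R => y `^ 2)%E).
    exact: measurable_poweR.
  by apply: measurableT_comp => //; exact/measurable_EFinP.
- apply: (@measurableT_comp _ _ _ _ _ _ (fun y : \bar R => y `^ 2)%E).
    exact: measurable_poweR.
  by apply: measurableT_comp => //; exact/measurable_EFinP.
- apply: filterS (L2_reprP f) => x fx _ /=.
  by congr (`|_%:E| `^ _)%E; exact: fx.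
Qed.

Let L2_ler_normD (u v : L2) : L2_norm (u + v) <= L2_norm u + L2_norm v.
Proof.
have [f ->] := piE u; have [g ->] := piE v.
rewrite [X in L2_norm X]piD !norm_pi; exact: ler_LnormD.
Qed.

Let L2_normZ a (u : L2) : L2_norm (a *: u) = `|a| * L2_norm u.
Proof.
have [f ->] := piE u; rewrite [X in L2_norm X]piZ !norm_pi.
by have := LnormZ f a => /= ->; rewrite -finite_norm_fine.
Qed.

Let L2_norm_eq0 (u : L2) : L2_norm u = 0 -> u = 0.
Proof.
have [f ->] := piE u; rewrite norm_pi => /fine_Lnormr_eq0 f0.
exact/L2_piP.
Qed.

HB.instance Definition _ :=
  Lmodule_isNormed.Build R L2 L2_ler_normD L2_normZ L2_norm_eq0.

End L2_space.

Section subspaces.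
Context (R : realType) (V : normedModType R).

Definition is_subspace (D : set V) : Prop :=
  D 0 /\ forall (a : R) u v, D u -> D v -> D (a *: u + v).

(* [D] is dense in [X] for the norm [N], which need not be that of [V]. *)
Definition dense_for (N : V -> R) (D X : set V) : Prop :=
  D `<=` X /\
  forall u, X u -> forall e : R, 0 < e -> exists2 phi, D phi & N (u - phi) < e.

End subspaces.

Section unbounded_operators.
Context (R : realType) (V : normedModType R).

(* The values of [action] outside of [domain] are irrelevant. *)
Record operator := Operator { domain : set V; action :> V -> V }.

Definition graph_norm (A : operator) (u : V) : R := `|u| + `|A u|.

Definition is_core (A : operator) (D : set V) : Prop :=
  is_subspace D /\ dense_for (graph_norm A) D (domain A).

End unbounded_operators.

Section semigroups.
Context (R : realType) (V : normedModType R).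
Local Open Scope ereal_scope.

Definition opnorm (T : V -> V) : \bar R :=
  ereal_sup [set `|T u|%:E | u in [set u : V | (`|u| <= 1)%R]].

Local Open Scope ring_scope.

(* The values at negative times are irrelevant. *)
Definition C0_semigroup (S : R -> V -> V) : Prop :=
  [/\ forall t : R, 0 <= t -> linear (S t) /\ (opnorm (S t) < +oo)%E,
      forall u : V, S 0 u = u,
      forall (s t : R) u, 0 <= s -> 0 <= t -> S (s + t) u = S s (S t u) &
      forall u : V, S t u @[t --> 0^'+] --> u].

Definition generates (A : operator V) (S : R -> V -> V) : Prop :=
  let quotient u (h : R) : V := h^-1 *: (S h u - u) in
  domain A = [set u | exists v : V, quotient u h @[h --> 0^'+] --> v] /\
  forall u, domain A u -> quotient u h @[h --> 0^'+] --> A u.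

Definition semigroup_bound (S : R -> V -> V) (M omega : R) : Prop :=
  forall t : R, 0 <= t -> (opnorm (S t) <= (M * expR (omega * t))%:E)%E.

End semigroups.

Section circle.
Variable R : realType.

(* The circle R/Z is represented by its fundamental domain [0, 1[: a function on
   the circle is a function on R considered up to equality almost everywhere in
   [0, 1[. The group structure only appears through 1-periodic functions, namely
   test functions and periodizations. *)
Definition circle_measure : {measure set (measurableTypeR R) -> \bar R} :=
  mrestr (@lebesgue_measure R) (measurable_itv `[0, 1[).

End circle.

Notation L2T R := (L2 (circle_measure R)).

Section operators_on_the_circle.
Variable R : realType.

Definition periodic_smooth (phi : R -> R) : Prop :=
  (forall x, phi (x + 1) = phi x) /\
  (forall k x, derivable (derive1n k phi) x 1).

Definition is_weak_derivative (k : nat) (u v : L2T R) : Prop :=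
  forall phi, periodic_smooth phi ->
    \int[circle_measure R]_x (u x * derive1n k phi x) =
    (-1) ^+ k * \int[circle_measure R]_x (v x * phi x).

Definition Sobolev (k : nat) : set (L2T R) :=
  [set u | forall j, (j <= k)%N -> exists v, is_weak_derivative j u v].

(* Meaningful for [u] in [Sobolev k]; weak derivatives are unique in [L2T R]. *)
Definition weak_derivative (k : nat) (u : L2T R) : L2T R :=
  xget 0 [set v | is_weak_derivative k u v].

Definition Sobolev_norm (k : nat) (u : L2T R) : R :=
  Num.sqrt (\sum_(j < k.+1) `|weak_derivative j u| ^+ 2).

Definition diffusion (kappa : R) : operator (L2T R) :=
  Operator (Sobolev 2) (fun u => kappa *: weak_derivative 2 u).

(* The sum over Z converges absolutely at almost every [x] when [h] is
   integrable; each of the two sums below has nonnegative terms. *)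
Definition periodization (h : R -> R) (x : R) : R :=
  fine (\esum_(n in [set: int]) (h^\+ (x + n%:~R))%:E) -
  fine (\esum_(n in [set: int]) (h^\- (x + n%:~R))%:E).

Definition second_moment (rho : R -> R) : R :=
  \int[@lebesgue_measure R]_z (z ^+ 2 * rho z).

Definition scaled_kernel (rho : R -> R) (eps z : R) : R :=
  eps^-1 * rho (z / eps).

Definition nonlocal_fun (kappa : R) (rho : R -> R) (eps : R) (u : L2T R)
    (x : R) : R :=
  2 * kappa / (second_moment rho * eps ^+ 2) *
  \int[circle_measure R]_y
    (periodization (scaled_kernel rho eps) (x - y) * (u y - u x)).

(* The maximal domain, on which [to_L2] is really the class of its argument. *)
Definition nonlocal (kappa : R) (rho : R -> R) (eps : R) : operator (L2T R) :=
  Operator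
    [set u | nonlocal_fun kappa rho eps u \in Lfun (circle_measure R) 2%:E]
    (fun u => to_L2 (circle_measure R) (nonlocal_fun kappa rho eps u)).

End operators_on_the_circle.

(* Main.v *)
(* Convolution by a probability density is a contraction P of L^2(T), by
   Jensen's inequality and Tonelli's theorem, and the nonlocal operator is
   c (P - 1) with c = 2 kappa / (m2 eps^2) > 0. It therefore generates the
   contraction semigroup exp(- c t) sum_n (c t)^n / n! P^n.

   D0 is the space of trigonometric polynomials. They approximate
   indicators of intervals by bounded pointwise convergence, hence are dense in L^2.
   Fourier truncation is the best L^2 approximation among trigonometric
   polynomials of bounded frequency and commutes with weak derivatives, so that
   D0 is dense in every H^k, and in H^2 for the graph norm.

   As rho is even, the k-th mode is an eigenvector of A_eps - A for the
   eigenvalue c (E cos(2 pi k eps Z) - 1) + kappa (2 pi k)^2, where Z has density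
   rho. The bound 0 <= cos t - 1 + t^2 / 2 <= t^4 / 24 makes it at most
   kappa m4 / (12 m2) eps^2 (2 pi k)^4 in absolute value, and orthogonality of the
   modes turns this into the estimate with the L^2 norm of the fourth derivative. *)

Require Import Defs.
From mathcomp Require Import all_boot all_order all_algebra.
From mathcomp Require Import all_classical all_reals all_analysis.
From mathcomp Require Import measurable_realfun.
From mathcomp Require Import ring lra.

Set Implicit Arguments.
Unset Strict Implicit.
Unset Printing Implicit Defensive.

Import Order.TTheory GRing.Theory Num.Theory.
Import numFieldNormedType.Exports.

Local Open Scope classical_set_scope.
Local Open Scope ring_scope.

(** Exceptional null sets shape the analytic half. The density is nonnegative only almost
    everywhere, its periodized sum is finite only for almost every y, and a convolution integral
    converges only for almost every x. Identities are therefore proved for nonnegative functions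
    with values in the extended reals, where Tonelli's theorem and the unfolding of the circle into
    the line raise no convergence question, and real-valued statements are read off where these
    values are finite.

    Functions being real, the modes are cosines with arbitrary phase. Their derivatives and products
    are again combinations of such modes, while convolution by an even kernel and derivatives of
    even order multiply a mode by a factor depending on its frequency alone.

    The normalization 2 / (m2 eps^2) makes the second-order term of the cosine transform cancel A
    exactly. Evenness removes the odd orders, so the first term left is the fourth: hence both H^4
    and the rate eps^2. *)

Section almost_everywhere_lemmas.
Context d (T : measurableType d) (R : realType) (mu : {measure set T -> \bar R}).

Lemma ae_imp (P Q : T -> Prop) : {ae mu, forall x, P x} ->
  (forall x, P x -> Q x) -> {ae mu, forall x, Q x}.
Proof. by move=> aeP PQ; apply: filterS aeP. Qed.

Lemma ae_imp2 (P Q S : T -> Prop) : {ae mu, forall x, P x} -> {ae mu, forall x, Q x} ->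
  (forall x, P x -> Q x -> S x) -> {ae mu, forall x, S x}.
Proof. by move=> aeP aeQ PQ; apply: filterS2 aeP aeQ. Qed.

Lemma ae_imp3 (P Q S U : T -> Prop) : {ae mu, forall x, P x} -> {ae mu, forall x, Q x} ->
  {ae mu, forall x, S x} ->
  (forall x, P x -> Q x -> S x -> U x) -> {ae mu, forall x, U x}.
Proof. by move=> aeP aeQ aeS PQ; apply: filterS3 aeP aeQ aeS. Qed.

End almost_everywhere_lemmas.

(** Turns sums over the integers into series over the naturals, for which integrals and sums can be
    exchanged. *)
Definition nat_to_int (k : nat) : int := if odd k then Negz k./2 else Posz k./2.

Lemma nat_to_int_bij : set_bij [set: nat] [set: int] nat_to_int.
Proof.
split => //.
- move=> i j _ _; rewrite /nat_to_int.
  by case oi: (odd i); case oj: (odd j) => // -[ij];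
    rewrite -[i]odd_double_half -[j]odd_double_half oi oj ij.
- move=> [n|n] _; [exists n.*2|exists n.*2.+1] => //; rewrite /nat_to_int /=.
    by rewrite odd_double doubleK.
  by rewrite odd_double /= uphalf_double.
Qed.

(** * Affine changes of variable for Lebesgue measure *)

Section lebesgue_affine.
Variable R : realType.
Notation mu := (@lebesgue_measure R).
Lemma preimage_affine_itvoc (a b c d : R) : (a != 0)%R ->
  (fun x => (a * x + b)%R) @^-1` `]c, d] =
  if (0 < a)%R then `](c - b) / a, (d - b) / a]%classic
  else `[(d - b) / a, (c - b) / a[%classic.
Proof.
case: ltgtP => // a0 _; apply/seteqP; split => x /=; rewrite !in_itv /=;
  rewrite ?ltr_pdivrMr ?ler_pdivlMr ?ltr_ndivlMr ?ler_ndivrMr //;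
  move=> /andP[h1 h2]; apply/andP; split; lra.
Qed.

Local Open Scope ereal_scope.

(** The pushforward under the affine map, scaled by [|a|], agrees with Lebesgue measure on half-open
    intervals, and these determine it. *)
Lemma lebesgue_measure_affine (a b : R) (A : set R) : (a != 0)%R -> measurable A ->
  `|a|%:E * mu ((fun x => (a * x + b)%R) @^-1` A) = mu A.
Proof.
move=> a0 mA.
have ma : measurable_fun [set: measurableTypeR R] (fun x : measurableTypeR R => (a * x + b)%R : measurableTypeR R).
  exact: measurable_funD.
pose phi (x : measurableTypeR R) : measurableTypeR R := (a * x + b)%R.
pose nu' : {measure set (measurableTypeR R) -> \bar R} := mscale (NngNum (normr_ge0 a)) (pushforward mu phi).
pose nu := nu' ma.
apply/esym.
change (mu A = nu A).
apply: (@lebesgue_measure_unique R nu) => //.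
move=> _ [[c d]] _ <-.
pose J : set R := [set` Interval (BRight c) (BRight d)].
have -> : nu J = `|a|%:E * mu ((fun x => a * x + b)%R @^-1` J) by [].
rewrite preimage_affine_itvoc //.
case: ifPn => a0'; rewrite !lebesgue_measure_itv /= !lte_fin.
  rewrite ltr_pM2r ?invr_gt0 // ltrD2r; case: ifPn => cd; last by rewrite mule0.
  by rewrite -!EFinB -EFinM gtr0_norm //; congr EFin; field.
have {}a0' : (a < 0)%R by rewrite lt_neqAle a0 leNgt.
rewrite ltr_nM2r ?invr_lt0 // ltrD2r; case: ifPn => cd; last by rewrite mule0.
by rewrite -!EFinB -EFinM ltr0_norm //; congr EFin; field.
Qed.

Lemma ge0_integral_affine (a b : R) (f : R -> \bar R) : (a != 0)%R ->
  measurable_fun setT f -> (forall x, 0 <= f x) ->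
  `|a|%:E * \int[mu]_x f (a * x + b)%R = \int[mu]_x f x.
Proof.
move=> a0 mf f0.
have ma : measurable_fun [set: measurableTypeR R] (fun x : measurableTypeR R => (a * x + b)%R : measurableTypeR R).
  exact: measurable_funD.
pose phi (x : measurableTypeR R) : measurableTypeR R := (a * x + b)%R.
pose nu' : {measure set (measurableTypeR R) -> \bar R} := mscale (NngNum (normr_ge0 a)) (pushforward mu phi).
pose nu := nu' ma.
transitivity (\int[nu]_x f x); last first.
  apply: eq_measure_integral => A mA _.
  exact: lebesgue_measure_affine.
rewrite ge0_integral_mscale //=; congr (_ * _).
by rewrite (ge0_integral_pushforward ma).
Qed.

End lebesgue_affine.

(** * The circle measure and the unfolding of the circle into the line *)

Section circle_measure_theory.
Variable R : realType.
Notation mu := (@lebesgue_measure R).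
Notation m := (@circle_measure R).
Notation I01 := (`[0%R, 1%R[%classic : set R).
Local Open Scope ereal_scope.

(** Lebesgue measure is the sum of its restrictions to [I01] and to the complement. The extension of
    [f] by zero vanishes almost everywhere for the second and equals [f] almost everywhere for the
    first. *)
Lemma ge0_integral_circle (f : R -> \bar R) : measurable_fun setT f ->
  (forall x, 0 <= f x) -> \int[m]_x f x = \int[mu]_(x in I01) f x.
Proof.
move=> mf f0.
have mI : measurable I01 by exact: measurable_itv.
pose m' := mrestr mu (measurableC mI).
have mfI : measurable_fun setT (f \_ I01).
  by apply/(measurable_restrictT _ _).1 => //; exact: measurable_funS mf.
rewrite [RHS]integral_mkcond.
transitivity (\int[measure_add m m']_x (f \_ I01) x); last first.
  apply: eq_measure_integral => A mA _.
  rewrite [LHS](measure_addE m m' A) [RHS](measureDI _ mA mI) addeC setDE.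
  by [].
rewrite ge0_integral_measure_add //; last by move=> x _; exact: erestrict_ge0.
rewrite [X in _ + X](_ : _ = 0) ?adde0; last first.
  rewrite (ae_eq_integral (cst 0)) ?integral0 //.
  exists I01; split => //.
    by rewrite /m' /= /mrestr setICr measure0.
  move=> x /= xI; apply: contrapT => xI'; apply: xI => _.
  by rewrite /= patchE; case: ifPn => //; rewrite inE.
apply: ae_eq_integral => //.
exists (~` I01); split => //; first exact: measurableC.
  by rewrite /circle_measure /= /mrestr setICl measure0.
move=> x /= xI xI'; apply: xI => _.
by rewrite patchE mem_set.
Qed.

Lemma integral_circle (f : R -> \bar R) : measurable_fun setT f ->
  \int[m]_x f x = \int[mu]_(x in I01) f x.
Proof.
move=> mf; rewrite integralE [RHS]integralE.
by rewrite !ge0_integral_circle //; [exact: measurable_funeneg|exact: measurable_funepos].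
Qed.

Lemma circle_measureT : m setT = 1.
Proof.
rewrite /circle_measure /= /mrestr setTI lebesgue_measure_itv /= lte_fin ltr01.
by rewrite -EFinB subr0.
Qed.

Lemma ae_circle (P : R -> Prop) : {ae mu, forall x, P x} -> {ae m, forall x, P x}.
Proof.
move=> [A [mA A0 PA]]; exists A; split => //.
apply/eqP; rewrite eq_le measure_ge0 andbT -[leRHS]A0.
by apply: (@le_measure _ _ _ mu); rewrite ?inE //; exact: measurableI.
Qed.

(** The integer translates of the fundamental domain tile the line. The integral over the line is
    thus the sum of the integrals over the tiles, each of which is translated back to [I01]. *)
Lemma unfold_integral (f : R -> \bar R) : measurable_fun setT f ->
  (forall x, 0 <= f x) ->
  \int[m]_x (\esum_(n in [set: int]) f (x + n%:~R)%R) = \int[mu]_x f x.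
Proof.
move=> mf f0.
have mI : measurable I01 by exact: measurable_itv.
have mfs (c : R) : measurable_fun setT (fun x : R => f (x + c)%R).
  by apply: measurableT_comp => //; exact: measurable_funD.
pose g k (x : R) := f (x + (nat_to_int k)%:~R)%R.
have esumE (x : R) : \esum_(n in [set: int]) f (x + n%:~R)%R = \sum_(k <oo) g k x.
  rewrite (reindex_esum _ _ _ _ nat_to_int_bij) nneseries_esumT // => k.
  exact: f0.
under eq_integral do rewrite esumE.
rewrite ge0_integral_circle; last 2 first.
  apply: ge0_emeasurable_sum => [k x _ _|k _]; [exact: f0|exact: mfs].
  by move=> x; apply: nneseries_ge0 => k _ _; exact: f0.
rewrite integral_nneseries; [|exact: mI| |]; last 2 first.
  by move=> k; apply: measurable_funTS; exact: mfs.
  by move=> k x _; exact: f0.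
pose z k : R := (nat_to_int k)%:~R%R.
pose F k : set R := `[z k, (z k + 1)%R[%classic.
have FT : \bigcup_k F k = setT.
  apply/seteqP; split => // x _.
  have [_ _ sj] := nat_to_int_bij.
  have [k _ kx] := sj (Num.floor x) I; exists k => //.
  rewrite /F /z /= kx in_itv /= ge_floor /=.
  by have := floorD1_gt x; rewrite intrD.
rewrite -[in RHS]FT ge0_integral_bigcup //.
- apply: eq_eseriesr => k _.
  rewrite integral_mkcond [RHS]integral_mkcond.
  rewrite -(@ge0_integral_affine _ 1%R (z k) (f \_ (F k))) //.
  + rewrite normr1 mul1e; apply: eq_integral => x _.
    rewrite /patch /g mul1r.
    suff -> : (x \in I01) = ((x + z k)%R \in F k) by [].
    apply/idP/idP; rewrite !inE /F /= !in_itv /= => /andP[h1 h2]; apply/andP; split; lra.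
  + by apply/(measurable_restrictT _ _).1; [exact: measurable_itv|exact: measurable_funTS].
  + by move=> x; exact: erestrict_ge0.
- by move=> k; exact: measurable_itv.
- by rewrite FT.
- move=> i j _ _ [x []]; rewrite /F /= !in_itv /= => /andP[h1 h2] /andP[h3 h4].
  have [_ inj _] := nat_to_int_bij.
  apply: inj; rewrite ?inE //.
  have h5 : (z i < z j + 1)%R by lra.
  have h6 : (z j < z i + 1)%R by lra.
  move: h5 h6; rewrite /z -!intrD1 !ltr_int !ltzD1 => h5 h6.
  by apply/eqP; rewrite eq_le h5 h6.
Qed.

End circle_measure_theory.

(** * Square-integrable functions, their classes and the inner product *)

Section L2_calculus.
Context d (T : measurableType d) (R : realType).
Variable mu : {measure set T -> \bar R}.
Local Open Scope ring_scope.
Notation Lf := (Lfun mu 2%:E).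

Lemma Lfun2P (f : T -> R) : f \in Lf <->
  measurable_fun setT f /\ (\int[mu]_x ((f x ^+ 2)%:E) < +oo)%E.
Proof.
split => [h|[mf fi]].
  split; first by move: h; rewrite inE => /andP[]; rewrite inE.
  exact: (integrable_lty measurableT (Lfun2_integrable_sqr h)).
rewrite inE; apply/andP; split; rewrite inE //= /finite_norm unlock.
apply: poweR_lty; apply: le_lt_trans fi.
rewrite le_eqVlt; apply/orP; left; apply/eqP; apply: eq_integral => x _ /=.
by rewrite powR_mulrn // real_normK ?num_real.
Qed.

Lemma Lfun2_measurable (f : T -> R) : f \in Lf -> measurable_fun setT f.
Proof. by move=> /Lfun2P[]. Qed.

Lemma Lfun2_mul (f g : T -> R) : f \in Lf -> g \in Lf ->
  mu.-integrable setT (EFin \o (fun x => f x * g x)).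
Proof. by move=> hf hg; exact/Lfun1_integrable/Lfun2_mul_Lfun1. Qed.

Lemma Lfun2D (f g : T -> R) : f \in Lf -> g \in Lf -> (fun x => f x + g x) \in Lf.
Proof. by move=> hf hg; have [_ h] := Lfun_addr_closed mu (lee1n 2); exact: h. Qed.

Lemma Lfun2Z a (f : T -> R) : f \in Lf -> (fun x => a * f x) \in Lf.
Proof.
move=> hf; have := @Lfun_scale _ _ _ mu f a 2 _ hf.
rewrite (_ : (fun x => a * f x) = a \o* f); last by apply/funext => x /=; rewrite mulrC.
by apply; rewrite ler1n.
Qed.

Lemma Lfun2B (f g : T -> R) : f \in Lf -> g \in Lf -> (fun x => f x - g x) \in Lf.
Proof.
move=> hf hg; rewrite (_ : (fun x => _) = (fun x => f x + (-1) * g x)).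
  by apply: Lfun2D => //; exact: Lfun2Z.
by apply/funext => x; rewrite mulN1r.
Qed.

Lemma Lfun2_le (f g : T -> R) : measurable_fun setT f -> g \in Lf ->
  {ae mu, forall x, `|f x| <= g x} -> f \in Lf.
Proof.
move=> mf /Lfun2P[mg gi] fg; apply/Lfun2P; split => //.
apply: le_lt_trans gi; apply: ae_ge0_le_integral => //.
- by move=> x _; rewrite lee_fin sqr_ge0.
- by apply/measurable_EFinP; exact: measurable_funX.
- by move=> x _; rewrite lee_fin sqr_ge0.
- by apply/measurable_EFinP; exact: measurable_funX.
apply: filterS fg => x fg _; rewrite lee_fin -[f x ^+ 2]real_normK ?num_real //.
by rewrite ler_sqr ?nnegrE // (le_trans _ fg).
Qed.

Lemma Lfun2_ae (f g : T -> R) : measurable_fun setT f -> g \in Lf ->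
  {ae mu, forall x, f x = g x} -> f \in Lf.
Proof.
move=> mf /Lfun2P[mg gi] fg; apply/Lfun2P; split => //.
rewrite (@ae_eq_integral _ _ _ mu setT (EFin \o (fun x => g x ^+ 2))) //.
- by apply/measurable_EFinP; exact: measurable_funX.
- by apply/measurable_EFinP; exact: measurable_funX.
- by apply: (ae_imp fg) => x -> _.
Qed.

Lemma L2_Lfun (u : L2 mu) : (u : T -> R) \in Lf.
Proof. exact: LfunP. Qed.

Lemma L2_eqP (u v : L2 mu) : u = v <-> {ae mu, forall x, u x = v x}.
Proof.
split => [->|uv]; first exact: nearW.
rewrite -[u]reprK -[v]reprK; apply/L2_piP.
by apply: filterS uv => x h _; exact: h.
Qed.

Lemma to_L2E (f : T -> R) : f \in Lf -> {ae mu, forall x, to_L2 mu f x = f x}.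
Proof.
move=> hf; rewrite /to_L2 /L2_to_fun.
apply: filterS (L2_reprP (insubd (0 : LfunType mu (lee1n 2)) f)) => x /(_ I) ->.
by rewrite /insubd insubT /=.
Qed.

Lemma to_L2_ae (f g : T -> R) : f \in Lf -> g \in Lf ->
  {ae mu, forall x, f x = g x} -> to_L2 mu f = to_L2 mu g.
Proof.
move=> hf hg fg; apply/L2_eqP.
apply: filterS3 (to_L2E hf) (to_L2E hg) fg => x -> -> //.
Qed.

Lemma to_L2K (u : L2 mu) : to_L2 mu u = u.
Proof. exact/L2_eqP/to_L2E/L2_Lfun. Qed.

Lemma L2_addE (u v : L2 mu) : {ae mu, forall x, (u + v : L2 mu) x = u x + v x}.
Proof. by apply: filterS (L2_reprP (L2_to_Lfun u + L2_to_Lfun v)) => x /(_ I). Qed.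

Lemma L2_scaleE a (u : L2 mu) : {ae mu, forall x, (a *: u : L2 mu) x = a * u x}.
Proof. by apply: filterS (L2_reprP (a *: L2_to_Lfun u)) => x /(_ I). Qed.

Lemma to_L2D (f g : T -> R) : f \in Lf -> g \in Lf ->
  to_L2 mu (fun x => f x + g x) = to_L2 mu f + to_L2 mu g.
Proof.
move=> hf hg; apply/L2_eqP.
have h1 := L2_addE (to_L2 mu f) (to_L2 mu g).
have h2 : {ae mu, forall x, to_L2 mu f x = f x /\ to_L2 mu g x = g x}.
  by apply: filterS2 (to_L2E hf) (to_L2E hg).
by apply: filterS3 h2 (to_L2E (Lfun2D hf hg)) h1 => x [h3 h4] h5 h6; rewrite h5 h6 h3 h4.
Qed.

Lemma to_L2Z a (f : T -> R) : f \in Lf ->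
  to_L2 mu (fun x => a * f x) = a *: to_L2 mu f.
Proof.
move=> hf; apply/L2_eqP.
apply: filterS3 (to_L2E hf) (to_L2E (Lfun2Z a hf)) (L2_scaleE a (to_L2 mu f)).
by move=> x h1 -> ->; rewrite h1.
Qed.

Lemma to_L2B (f g : T -> R) : f \in Lf -> g \in Lf ->
  to_L2 mu (fun x => f x - g x) = to_L2 mu f - to_L2 mu g.
Proof.
move=> hf hg; rewrite -scaleN1r -to_L2Z // -to_L2D //; last exact: Lfun2Z.
by congr to_L2; apply/funext => x; rewrite mulN1r.
Qed.

Lemma to_L20 : to_L2 mu (fun=> 0) = 0.
Proof.
have h : (fun=> 0 : R) \in Lf.
  by rewrite (_ : (fun=> 0) = (fun x => 0 * (0 : L2 mu) x)) ?Lfun2Z ?L2_Lfun //;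
    apply/funext => x; rewrite mul0r.
by rewrite (_ : (fun=> 0) = (fun x => 0 * (0 : L2 mu) x)) ?to_L2Z ?L2_Lfun ?scale0r //;
  apply/funext => x; rewrite mul0r.
Qed.

Lemma L2_sqr_normE (u : L2 mu) : `|u| ^+ 2 = \int[mu]_x (u x ^+ 2).
Proof.
rewrite [`|u|]/(L2_norm u) /L2_norm unlock /Rintegral.
set a := (\int[mu]_x _)%E.
have -> : a = (\int[mu]_x ((u x ^+ 2)%:E))%E.
  by apply: eq_integral => x _ /=; rewrite powR_mulrn // real_normK ?num_real.
have a0 : (0 <= \int[mu]_x ((u x ^+ 2)%:E))%E.
  by apply: integral_ge0 => x _; rewrite lee_fin sqr_ge0.
have afin : (\int[mu]_x ((u x ^+ 2)%:E))%E \is a fin_num.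
  exact: (integrable_fin_num measurableT (Lfun2_integrable_sqr (L2_Lfun u))).
rewrite -(fineK afin) poweR_EFin /= -powR_mulrn ?powR_ge0 // -powRrM mulVf ?pnatr_eq0 //.
by rewrite powRr1 // fine_ge0.
Qed.

Lemma L2_sqr_norm_to_L2 (f : T -> R) : f \in Lf ->
  `|to_L2 mu f| ^+ 2 = \int[mu]_x (f x ^+ 2).
Proof.
move=> hf; rewrite L2_sqr_normE /Rintegral; congr fine.
apply: ae_eq_integral => //.
- apply/measurable_EFinP; apply: measurable_funX; exact: Lfun2_measurable (L2_Lfun _).
- apply/measurable_EFinP; apply: measurable_funX; exact: Lfun2_measurable.
- by apply: filterS (to_L2E hf) => x -> _.
Qed.

(** Defined on functions rather than on classes, so that a class, through its coercion, can be
    paired directly with a test function or a wave. *)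
Definition ip (f g : T -> R) : R := \int[mu]_x (f x * g x).

Lemma ipC f g : ip f g = ip g f.
Proof. by apply: eq_Rintegral => x _; rewrite mulrC. Qed.

Lemma ip_ae (f f' g g' : T -> R) : f \in Lf -> f' \in Lf -> g \in Lf -> g' \in Lf ->
  {ae mu, forall x, f x = f' x} -> {ae mu, forall x, g x = g' x} -> ip f g = ip f' g'.
Proof.
move=> hf hf' hg hg' ff' gg'; rewrite /ip /Rintegral; congr fine.
apply: ae_eq_integral => //.
- by apply/measurable_EFinP; apply: measurable_funM; exact: Lfun2_measurable.
- by apply/measurable_EFinP; apply: measurable_funM; exact: Lfun2_measurable.
- by apply: filterS2 ff' gg' => x -> ->.
Qed.

Lemma ipDl f g h : f \in Lf -> g \in Lf -> h \in Lf ->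
  ip (fun x => f x + g x) h = ip f h + ip g h.
Proof.
move=> hf hg hh; rewrite /ip -RintegralD //; try exact: Lfun2_mul.
by apply: eq_Rintegral => x _; rewrite mulrDl.
Qed.

Lemma ipZl a f h : f \in Lf -> h \in Lf -> ip (fun x => a * f x) h = a * ip f h.
Proof.
move=> hf hh; rewrite /ip -RintegralZl //; try exact: Lfun2_mul.
by apply: eq_Rintegral => x _; rewrite mulrA.
Qed.

Lemma ipBl f g h : f \in Lf -> g \in Lf -> h \in Lf ->
  ip (fun x => f x - g x) h = ip f h - ip g h.
Proof.
move=> hf hg hh; rewrite /ip -RintegralB //; try exact: Lfun2_mul.
by apply: eq_Rintegral => x _; rewrite mulrBl.
Qed.

Lemma ip_norm (u : L2 mu) : ip u u = `|u| ^+ 2.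
Proof. by rewrite L2_sqr_normE; apply: eq_Rintegral => x _; rewrite expr2. Qed.

Lemma cauchy_schwarz (u v : L2 mu) : `|ip u v| <= `|u| * `|v|.
Proof.
have [->|u0] := eqVneq u 0.
  rewrite (_ : ip _ _ = 0) ?normr0 ?mul0r //.
  (* The representative of the class 0 vanishes only almost everywhere, so it is exchanged for
     [0 * v x]. *)
  have hz : (fun x : T => 0 * v x) \in Lf by apply: Lfun2Z; exact: L2_Lfun.
  rewrite (@ip_ae _ (fun x => 0 * v x) _ v) ?ipZl ?mul0r ?L2_Lfun //; last exact: nearW.
  have h := L2_scaleE 0 v; apply: filterS h => x; rewrite scale0r => ->; exact: erefl.
have nu : 0 < `|u| by rewrite normr_gt0.
(* The coefficient of the projection of [v] on [u], which minimizes the norm of [v - t u]. *)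
pose t := ip u v / `|u| ^+ 2.
pose w := fun x => v x - t * u x.
have hw : w \in Lf by apply: Lfun2B; [|apply: Lfun2Z]; exact: L2_Lfun.
have : 0 <= ip w w.
  by apply: Rintegral_ge0 => x _; rewrite -expr2 sqr_ge0.
rewrite /w ipBl ?L2_Lfun ?Lfun2Z ?L2_Lfun // ipZl ?L2_Lfun //.
rewrite [ip v _]ipC [ip u _]ipC !ipBl ?L2_Lfun ?Lfun2Z ?L2_Lfun // !ipZl ?L2_Lfun //.
rewrite (ipC v u) !ip_norm => h.
have {}h : ip u v ^+ 2 <= `|u| ^+ 2 * `|v| ^+ 2.
  have : 0 <= `|u| ^+ 2 * (`|v| ^+ 2 - t * ip u v - t * (ip u v - t * `|u| ^+ 2)).
    by rewrite mulr_ge0 ?sqr_ge0.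
  suff -> : `|u| ^+ 2 * (`|v| ^+ 2 - t * ip u v - t * (ip u v - t * `|u| ^+ 2)) =
            `|u| ^+ 2 * `|v| ^+ 2 - ip u v ^+ 2 by rewrite subr_ge0.
  by rewrite /t; field; rewrite gt_eqF.
rewrite -ler_sqr ?nnegrE ?mulr_ge0 ?normr_ge0 // real_normK ?num_real //.
by rewrite exprMn.
Qed.

End L2_calculus.

(** * Dominated convergence and completeness in L^2 *)

Section L2_limits.
Context d (T : measurableType d) (R : realType).
Variable mu : {measure set T -> \bar R}.
Notation Lf := (Lfun mu 2%:E).

Lemma sqr_cvg0 (u : R^nat) : u n ^+ 2 @[n --> \oo] --> (0 : R) -> u n @[n --> \oo] --> (0 : R).
Proof.
move=> h; apply/norm_cvg0P.
have : Num.sqrt (u n ^+ 2) @[n --> \oo] --> Num.sqrt (0 : R).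
  by apply: (cvg_comp _ _ h); exact: sqrt_continuous.
by rewrite sqrtr0; under eq_fun do rewrite sqrtr_sqr.
Qed.

(** Dominated convergence is applied to the squares of the differences, which are at most (2 g)^2
    because the limit inherits the bound [g]. *)
Lemma L2_dominated_cvg (f_ : nat -> T -> R) (f g : T -> R) :
  (forall n, measurable_fun setT (f_ n)) -> measurable_fun setT f -> g \in Lf ->
  {ae mu, forall x, f_ n x @[n --> \oo] --> f x} ->
  {ae mu, forall x, forall n, `|f_ n x| <= g x} ->
  [/\ f \in Lf, forall n, f_ n \in Lf &
     to_L2 mu (f_ n) @[n --> \oo] --> to_L2 mu f].
Proof.
move=> mf_ mf hg f_f f_g.
have fg : {ae mu, forall x, `|f x| <= g x}.
  apply: filterS2 f_f f_g => x f_f f_g.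
  have h : `|f_ n x| @[n --> \oo] --> `|f x| by exact: cvg_norm.
  by rewrite -(cvg_lim _ h) //; apply: limr_le; [exact: cvgP h|exact: nearW].
have hf : f \in Lf by exact: (Lfun2_le mf hg).
have hf_ n : f_ n \in Lf.
  by apply: (Lfun2_le (mf_ n) hg); apply: filterS f_g => x; exact.
split => //.
apply/subr_cvg0/norm_cvg0P/sqr_cvg0.
have hB n : (fun x => f_ n x - f x) \in Lf by exact: Lfun2B.
under eq_fun => n do rewrite -to_L2B // L2_sqr_norm_to_L2 //.
have hg2 : (fun x => 2 * g x) \in Lf by exact: Lfun2Z.
have mh n : measurable_fun setT (fun x => ((f_ n x - f x) ^+ 2)%:E).
  by apply/measurable_EFinP; apply: measurable_funX; exact: measurable_funB.
have [//||||_ _] := @dominated_convergence _ T R mu setT measurableT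
  (fun n x => ((f_ n x - f x) ^+ 2)%:E) (fun=> 0%E) (EFin \o (fun x => (2 * g x) ^+ 2)) mh.
- apply: filterS f_f => x f_f _; apply: cvg_EFin; first exact: nearW.
  rewrite (_ : _ \o _ = fun n => (f_ n x - f x) ^+ 2) //.
  have h : f_ n x - f x @[n --> \oo] --> (0 : R) by exact/subr_cvg0.
  by have := cvgM h h; rewrite mulr0; exact.
- exact: Lfun2_integrable_sqr.
- apply: filterS2 f_g fg => x f_g fg n _.
  rewrite /= lee_fin ger0_norm ?sqr_ge0 //.
  rewrite -[X in X <= _]real_normK ?num_real //.
  have g0 : 0 <= g x by exact: le_trans fg.
  rewrite ler_sqr ?nnegrE ?mulr_ge0 // (le_trans (ler_normB _ _)) //.
  by have := f_g n; lra.
rewrite integral0 => /fine_cvgP[_].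
by apply: cvg_trans; apply: near_eq_cvg; exact: nearW.
Qed.

Lemma to_L2_sum (I : Type) (s : seq I) (f : I -> T -> R) : (forall i, f i \in Lf) ->
  (fun x => \sum_(i <- s) f i x) \in Lf /\
  to_L2 mu (fun x => \sum_(i <- s) f i x) = \sum_(i <- s) to_L2 mu (f i).
Proof.
move=> hf; elim: s => [|i s [IH1 IH2]].
  rewrite (_ : (fun x => _) = fun=> 0); last by apply/funext => x; rewrite big_nil.
  rewrite big_nil to_L20; split => //.
  rewrite (_ : (fun=> 0) = (fun x => 0 * (0 : L2 mu) x)) ?Lfun2Z ?L2_Lfun //.
  by apply/funext => x; rewrite mul0r.
rewrite (_ : (fun x => _) = fun x => f i x + \sum_(i <- s) f i x).
  by rewrite big_cons to_L2D // IH2; split => //; exact: Lfun2D.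
by apply/funext => x; rewrite big_cons.
Qed.

Lemma L2_abs (u : L2 mu) : (fun x => `|u x|) \in Lf /\ `|to_L2 mu (fun x => `|u x|)| = `|u|.
Proof.
have h : (fun x => `|u x|) \in Lf.
  apply/Lfun2P; have /Lfun2P[mu_ iu] := L2_Lfun u; split.
    exact: measurableT_comp.
  by under eq_integral do rewrite real_normK ?num_real //.
split=> //; apply/eqP; rewrite -(@eqrXn2 _ 2) //; apply/eqP.
rewrite L2_sqr_norm_to_L2 // L2_sqr_normE; apply: eq_Rintegral => x _.
by rewrite real_normK ?num_real.
Qed.

(** Completeness, in the form of the hypothesis [summable_cvg] under which the exponential of an
    operator is built below. *)
Lemma riesz_fischer (u : nat -> L2 mu) (B : R) :
  (forall n, \sum_(0 <= k < n) `|u k| <= B) ->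
  exists l : L2 mu, series u @ \oo --> l.
Proof.
move=> uB.
pose G n x := \sum_(0 <= k < n) `|u k x|.
pose S n x := \sum_(0 <= k < n) u k x.
have B0 : 0 <= B by have := uB 0%N; rewrite big_geq.
have [hG nG] : (forall n, G n \in Lf) /\ (forall n, `|to_L2 mu (G n)| <= B).
  have h n := to_L2_sum (index_iota 0 n) (fun k => (L2_abs (u k)).1).
  split => n; first exact: (h n).1.
  rewrite /G (h n).2 (le_trans (ler_norm_sum _ _ _)) //.
  by under eq_bigr do rewrite (L2_abs _).2; exact: uB.
have [hS eS] : (forall n, S n \in Lf) /\ (forall n, to_L2 mu (S n) = series u n).
  have h n := to_L2_sum (index_iota 0 n) (fun k => L2_Lfun (u k)).
  split => n; first exact: (h n).1.
  by rewrite /S (h n).2 /series /=; apply: eq_bigr => k _; rewrite to_L2K.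
have G0 n x : 0 <= G n x by exact: sumr_ge0.
have Gnd x : {homo G ^~ x : n k / (n <= k)%N >-> n <= k}.
  move=> n k nk; rewrite /G (big_cat_nat (leq0n n) nk) //= lerDl; exact: sumr_ge0.
(* These squares increase with n and have integral at most B^2, so by monotone convergence their
   limit [H] is integrable, hence finite almost everywhere. *)
pose h n x := (G n x ^+ 2)%:E.
have mh n : measurable_fun setT (h n).
  by apply/measurable_EFinP; apply: measurable_funX; exact: Lfun2_measurable.
have hnd x : {homo h ^~ x : n k / (n <= k)%N >-> (n <= k)%E}.
  by move=> n k nk; rewrite lee_fin ler_sqr ?nnegrE // Gnd.
have h0 n x : (0 <= h n x)%E by rewrite lee_fin sqr_ge0.
pose H x := ereal_sup (range (h ^~ x)).
have hH x : h ^~ x @ \oo --> H x by exact: ereal_nondecreasing_cvgn.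
have mH : measurable_fun setT H by apply: (emeasurable_fun_cvg h).
have H0 x : (0 <= H x)%E.
  by apply: (le_trans (h0 0%N x)); apply: ereal_sup_ubound; exists 0%N.
have iH : mu.-integrable setT H.
  apply/integrableP; split => //.
  under eq_integral do rewrite gee0_abs //.
  under eq_integral do rewrite -(cvg_lim _ (hH _)) //.
  rewrite monotone_convergence //.
  apply: (@le_lt_trans _ _ (B ^+ 2)%:E); last exact: ltry.
  apply: lime_le.
    apply: ereal_nondecreasing_is_cvgn => n k nk; apply: ge0_le_integral => //.
    by move=> x _; exact: hnd.
  apply: nearW => n; rewrite /h.
  have fn := integrable_fin_num measurableT (Lfun2_integrable_sqr (hG n)).
  rewrite -(fineK fn) lee_fin.
  have := L2_sqr_norm_to_L2 (hG n); rewrite /Rintegral /= => <-.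
  by rewrite ler_sqr ?nnegrE.
(* The dominating function; [fine] sets it to 0 on the null set where [H] is infinite. *)
pose g x := Num.sqrt (fine (H x)).
have mg : measurable_fun setT g.
  apply: measurableT_comp; last exact: measurableT_comp.
  by apply: continuous_measurable_fun; exact: sqrt_continuous.
have hg : g \in Lf.
  apply/Lfun2P; split => //.
  apply: (@le_lt_trans _ _ (\int[mu]_x H x)%E); last exact: integrable_lty iH.
  apply: ge0_le_integral => //.
  - by move=> x _; rewrite lee_fin sqr_ge0.
  - by apply/measurable_EFinP; exact: measurable_funX.
  move=> x _; rewrite sqr_sqrtr ?fine_ge0 //.
  by have := H0 x; case: (H x) => //= _; rewrite leey.
have aeH : {ae mu, forall x, H x \is a fin_num}.
  by apply: filterS (integrable_ae measurableT iH) => x; exact.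
have Gg : {ae mu, forall x, forall n, G n x <= g x}.
  apply: filterS aeH => x fH n.
  rewrite -(ger0_norm (G0 n x)) -sqrtr_sqr ler_wsqrtr // -lee_fin fineK //.
  by apply: ereal_sup_ubound; exists n.
have Sg : {ae mu, forall x, forall n, `|S n x| <= g x}.
  apply: filterS Gg => x Gg n; apply: le_trans (Gg n).
  exact: ler_norm_sum.
(* An upper limit is measurable whether or not the sequence converges, and it is the pointwise sum
   almost everywhere. *)
pose f x := fine (limn_esup (fun n => (S n x)%:E)).
have mf : measurable_fun setT f.
  apply: measurableT_comp => //.
  by apply: measurable_fun_limn_esup => n; apply/measurable_EFinP; exact: Lfun2_measurable.
have Sf : {ae mu, forall x, S n x @[n --> \oo] --> f x}.
  apply: filterS Gg => x Gg.
  have cS : cvgn (series (fun k => u k x)).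
    apply: normed_cvg; apply: nondecreasing_is_cvgn; first exact: Gnd.
    by exists (g x) => _ [n _ <-]; exact: Gg.
  have cS' : (S n x)%:E @[n --> \oo] --> (limn (series (fun k => u k x)))%:E.
    by apply: cvg_EFin; [exact: nearW|exact: cS].
  by rewrite /f (cvg_limn_einf_sup cS').2.
have [_ _ cv] := L2_dominated_cvg (fun n => Lfun2_measurable (hS n)) mf hg Sf Sg.
exists (to_L2 mu f); move: cv; under eq_fun do rewrite eS.
exact.
Qed.

End L2_limits.

(** * The exponential semigroup of a linear contraction *)

Section exponential_semigroup.
Context (R : realType) (V : normedModType R).
Variables (P : V -> V) (c : R).
Hypothesis summable_cvg : forall (u : V^nat) (B : R),
  (forall n, \sum_(0 <= k < n) `|u k| <= B) -> exists l : V, series u @ \oo --> l.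
Hypothesis P_linear : linear P.
Hypothesis P_contraction : forall u, `|P u| <= `|u|.
Hypothesis c_ge0 : 0 <= c.

Lemma exp_coeffD (s t : R) n :
  exp_coeff (s + t) n = \sum_(i < n.+1) exp_coeff s i * exp_coeff t (n - i)%N.
Proof.
rewrite /exp_coeff /= addrC exprDn mulr_suml; apply: eq_bigr => i _.
have n0 k : k`!%:R != 0 :> R by rewrite pnatr_eq0 -lt0n fact_gt0.
rewrite -(@bin_fact n i); last by rewrite -ltnS ltn_ord.
rewrite !natrM -mulr_natr.
have b0 : ('C(n, i))%:R != 0 :> R by rewrite pnatr_eq0 -lt0n bin_gt0 -ltnS ltn_ord.
by field; rewrite !n0 b0.
Qed.

(** Stated for any module [W]: the comparison of the operator error with the scalar error uses it
    for the iterates of [P] and again for the constant 1. *)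
Lemma exp_coeff_triangle (s t : R) (W : lmodType R) (h : nat -> W) N :
  \sum_(0 <= n < N) exp_coeff (s + t) n *: h n =
  \sum_(0 <= i < N) \sum_(0 <= j < N | (i + j < N)%N)
     (exp_coeff s i * exp_coeff t j) *: h (i + j)%N.
Proof.
pose f i n := (exp_coeff s i * exp_coeff t (n - i)%N) *: h n.
transitivity (\sum_(0 <= n < N) \sum_(0 <= i < N | (i <= n)%N) f i n).
  apply: eq_big_nat => n /andP[_ nN]; rewrite exp_coeffD scaler_suml.
  rewrite -(big_mkord xpredT (fun i => f i n)) (big_nat_widen _ _ N) //.
rewrite (exchange_big_dep_nat xpredT) //=; apply: eq_big_nat => i /andP[_ iN].
transitivity (\sum_(i <= n < N) f i n); first by rewrite (big_nat_widenl i 0).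
rewrite -{1}(add0n i) big_addn (big_nat_widen _ _ N) ?leq_subr //.
rewrite !big_mkord; apply: eq_big => [j|j _] /=; first by rewrite ltn_subRL addnC.
by rewrite /f addnK addnC.
Qed.

Let E x N := \sum_(0 <= n < N) exp_coeff x n : R.
Let F x N u := \sum_(0 <= n < N) exp_coeff x n *: iter n P u.

Lemma iterP_linear n : linear (iter n P).
Proof. by elim: n => [//|n IH] a u v; rewrite /= IH P_linear. Qed.

Lemma iterP_norm n u : `|iter n P u| <= `|u|.
Proof. by elim: n => [//|n IH]; exact: le_trans (P_contraction _) IH. Qed.

Lemma nneg_exp_coeff (x : R) n : 0 <= x -> 0 <= exp_coeff x n.
Proof. by move=> x0; rewrite /exp_coeff /= divr_ge0 // exprn_ge0. Qed.

Lemma exp_partial_sum_le (x : R) N : 0 <= x -> E x N <= expR x.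
Proof.
move=> x0; apply: nondecreasing_cvgn_le; last exact: is_cvg_series_exp_coeff.
apply: nondecreasing_series => n _ _; exact: nneg_exp_coeff.
Qed.

Lemma exp_partial_sum_cvg (x : R) : E x @ \oo --> expR x.
Proof. exact: is_cvg_series_exp_coeff. Qed.

Lemma Pexp_partial_sum_linear (x : R) N : linear (F x N).
Proof.
move=> a u v; rewrite /F scaler_sumr -big_split /=; apply: eq_bigr => n _.
by rewrite iterP_linear scalerDr !scalerA mulrC.
Qed.

Lemma Pexp_partial_sum_norm (x : R) N u : 0 <= x -> `|F x N u| <= E x N * `|u|.
Proof.
move=> x0; rewrite /F /E mulr_suml (le_trans (ler_norm_sum _ _ _)) //.
apply: ler_sum => n _; rewrite normrZ ger0_norm ?nneg_exp_coeff //.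
by rewrite ler_wpM2l ?nneg_exp_coeff // iterP_norm.
Qed.

Definition Pexp (x : R) (u : V) : V := limn (fun N => F x N u).

Lemma Pexp_cvg (x : R) u : 0 <= x -> F x N u @[N --> \oo] --> Pexp x u.
Proof.
move=> x0; apply/cvg_ex.
apply: (@summable_cvg (fun n => exp_coeff x n *: iter n P u) (expR x * `|u|)) => n.
apply: (@le_trans _ _ (E x n * `|u|)); last by rewrite ler_wpM2r // exp_partial_sum_le.
rewrite /E mulr_suml; apply: ler_sum => k _.
by rewrite normrZ ger0_norm ?nneg_exp_coeff // ler_wpM2l ?nneg_exp_coeff // iterP_norm.
Qed.

Lemma Pexp_norm (x : R) u : 0 <= x -> `|Pexp x u| <= expR x * `|u|.
Proof.
move=> x0; have h : `|F x N u| @[N --> \oo] --> `|Pexp x u| by apply: cvg_norm; exact: Pexp_cvg.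
rewrite -(cvg_lim _ h) //; apply: limr_le; first exact: cvgP h.
apply: nearW => n; apply: le_trans (Pexp_partial_sum_norm _ _ x0) _.
by rewrite ler_wpM2r // exp_partial_sum_le.
Qed.

Lemma Pexp_linear (x : R) : 0 <= x -> linear (Pexp x).
Proof.
move=> x0 a u v; apply: (cvg_lim (@norm_hausdorff _ V)).
under eq_fun do rewrite Pexp_partial_sum_linear.
by apply: cvgD; [apply: cvgZr|]; exact: Pexp_cvg.
Qed.

Lemma Pexp_partial_sum_recl (x : R) N u :
  F x N.+2 u = u + x *: P u + \sum_(2 <= n < N.+2) exp_coeff x n *: iter n P u.
Proof.
rewrite /F big_nat_recl // big_nat_recl // addrA /exp_coeff /= expr0 expr1 !divr1 scale1r.
by congr (_ + _); rewrite !big_add1.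
Qed.

Lemma Pexp0 u : Pexp 0 u = u.
Proof.
apply: (cvg_lim (@norm_hausdorff _ V)).
rewrite -(cvg_shiftn 2).
under eq_fun => N.
  rewrite addn2 Pexp_partial_sum_recl scale0r addr0 big_nat_cond big1 ?addr0.
  over.
move=> n; rewrite andbT => /andP[n2 _].
by rewrite /exp_coeff /= expr0n; case: n n2 => // n _; rewrite mul0r scale0r.
exact: cvg_cst.
Qed.

(* The error is the part of a double sum over a square that lies outside a
   triangle. For [P = id] it is the scalar error on the right-hand side. *)
Lemma Pexp_partial_sum_mul (s t : R) N u : 0 <= s -> 0 <= t ->
  `|F s N (F t N u) - F (s + t) N u| <= (E s N * E t N - E (s + t) N) * `|u|.
Proof.
move=> s0 t0.
pose r (W : lmodType R) (h : nat -> W) := \sum_(0 <= i < N) \sum_(0 <= j < N | ~~ (i + j < N)%N)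
     (exp_coeff s i * exp_coeff t j) *: h (i + j)%N.
have split (W : lmodType R) (h : nat -> W) :
   \sum_(0 <= i < N) \sum_(0 <= j < N) (exp_coeff s i * exp_coeff t j) *: h (i + j)%N
   - \sum_(0 <= n < N) exp_coeff (s + t) n *: h n = r W h.
  rewrite exp_coeff_triangle; apply/eqP; rewrite subr_eq addrC -big_split /=; apply/eqP.
  by apply: eq_bigr => i _; rewrite [LHS](bigID (fun j => i + j < N)%N).
have -> : F s N (F t N u) - F (s + t) N u = r V (fun n => iter n P u).
  rewrite -split; congr (_ - _); rewrite {1}/F; apply: eq_bigr => i _.
  rewrite /F; elim: (index_iota 0 N) => [|j l IH].
    rewrite !big_nil; have := iterP_linear i (-1) 0 0.
    by rewrite scaler0 addr0 scaleN1r addNr => ->; rewrite scaler0.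
  by rewrite !big_cons iterP_linear scalerDr scalerA IH iterD.
have -> : E s N * E t N - E (s + t) N = r R^o (fun=> 1).
  rewrite -split; congr (_ - _).
    rewrite mulr_suml; apply: eq_bigr => i _; rewrite mulr_sumr.
    by apply: eq_bigr => j _; rewrite /GRing.scale /= mulr1.
  by apply: eq_bigr => j _; rewrite /GRing.scale /= mulr1.
rewrite /r mulr_suml (le_trans (ler_norm_sum _ _ _)) //; apply: ler_sum => i _.
rewrite mulr_suml (le_trans (ler_norm_sum _ _ _)) //; apply: ler_sum => j _.
have w0 : 0 <= exp_coeff s i * exp_coeff t j by rewrite mulr_ge0 ?nneg_exp_coeff.
by rewrite normrZ ger0_norm // /GRing.scale /= mulr1 ler_wpM2l // iterP_norm.
Qed.

(** Since [F s N] is bounded by [expR s] uniformly in [N], the inner sum may be replaced by its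
    limit. The remaining error is governed by the scalar one, which tends to exp(s) exp(t) - exp(s +
    t) = 0. *)
Lemma PexpD (s t : R) u : 0 <= s -> 0 <= t -> Pexp (s + t) u = Pexp s (Pexp t u).
Proof.
move=> s0 t0.
have h1 := @Pexp_cvg s (Pexp t u) s0.
have h2 := @Pexp_cvg _ u (addr_ge0 s0 t0).
have h3 := @Pexp_cvg _ u t0.
apply/eqP; rewrite -subr_eq0 -normr_eq0; apply/eqP.
have h4 : `|F (s + t) N u - F s N (Pexp t u)| @[N --> \oo] -->
    `|Pexp (s + t) u - Pexp s (Pexp t u)| by apply: cvg_norm; exact: cvgB.
rewrite -(cvg_lim _ h4) //; apply: cvg_lim => //.
apply: (@squeeze_cvgr _ _ _ _ (fun=> 0) (fun N => expR s * `|F t N u - Pexp t u| +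
  (E s N * E t N - E (s + t) N) * `|u|)).
- apply: nearW => N; rewrite normr_ge0 /=.
  have FB v w : F s N (v - w) = F s N v - F s N w.
    by have := Pexp_partial_sum_linear s N (-1) w v; rewrite !scaleN1r ![- _ + _]addrC.
  rewrite distrC (_ : F s N (Pexp t u) - F (s + t) N u = - F s N (F t N u - Pexp t u) +
    (F s N (F t N u) - F (s + t) N u)); last by rewrite FB opprB addrA subrK.
  rewrite (le_trans (ler_normD _ _)) // lerD ?Pexp_partial_sum_mul // normrN.
  by rewrite (le_trans (Pexp_partial_sum_norm _ _ s0)) // ler_wpM2r // exp_partial_sum_le.
- exact: cvg_cst.
have z1 : expR s * `|F t N u - Pexp t u| @[N --> \oo] --> expR s * (0 : R).
  by apply: cvgMr; apply/norm_cvg0P/subr_cvg0.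
have z2 : (E s N * E t N - E (s + t) N) * `|u| @[N --> \oo] --> (0 : R) * `|u|.
  apply: cvgMl; rewrite -(subrr (expR (s + t))) {1}expRD.
  by apply: cvgB; [apply: cvgM|]; exact: exp_partial_sum_cvg.
by have := cvgD z1 z2; rewrite mulr0 mul0r addr0; exact.
Qed.

(** This is exp(c t (P - 1)). With the scalar factor split off, the series has nonnegative
    coefficients and norm at most exp(c t), which the factor cancels exactly; bounding a series in P
    - 1 term by term would only give exp(2 c t). *)
Definition exp_semigroup (t : R) (u : V) : V := expR (- (c * t)) *: Pexp (c * t) u.
Notation S := exp_semigroup.

Lemma exp_semigroup_contraction (t : R) u : 0 <= t -> `|S t u| <= `|u|.
Proof.
move=> t0; rewrite /S normrZ ger0_norm ?expR_ge0 //.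
have := Pexp_norm u (mulr_ge0 c_ge0 t0).
rewrite -(ler_pM2l (expR_gt0 (- (c * t)))) => h; apply: le_trans h _.
by rewrite mulrA -expRD addNr expR0 mul1r.
Qed.

(** The coefficients are nonnegative and the iterates of [P] are contractions, so the remainder is
    at most that of the scalar exponential. *)
Lemma Pexp_taylor (x : R) u : 0 <= x ->
  `|Pexp x u - u - x *: P u| <= (expR x - 1 - x) * `|u|.
Proof.
move=> x0.
have h : `|F x N.+2 u - u - x *: P u| @[N --> \oo] --> `|Pexp x u - u - x *: P u|.
  apply: cvg_norm; apply: cvgB; last exact: cvg_cst.
  apply: cvgB; last exact: cvg_cst.
  have := @Pexp_cvg _ u x0; rewrite -(cvg_shiftn 2); under eq_fun do rewrite addn2.
  exact.
rewrite -(cvg_lim _ h) //; apply: limr_le; first exact: cvgP h.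
apply: nearW => N; rewrite Pexp_partial_sum_recl.
rewrite (_ : _ - _ - _ = \sum_(2 <= n < N.+2) exp_coeff x n *: iter n P u); last first.
  by rewrite -addrA -opprD [X in X - _]addrC addrK.
have hE : \sum_(2 <= n < N.+2) exp_coeff x n <= expR x - 1 - x.
  have := exp_partial_sum_le N.+2 x0; rewrite /E big_nat_recl // big_nat_recl //.
  rewrite /exp_coeff /= expr0 expr1 !divr1.
  rewrite !big_add1 /=.
  by move=> h'; lra.
apply: (@le_trans _ _ ((\sum_(2 <= n < N.+2) exp_coeff x n) * `|u|)); last exact: ler_wpM2r.
rewrite mulr_suml (le_trans (ler_norm_sum _ _ _)) //; apply: ler_sum => n _.
by rewrite normrZ ger0_norm ?nneg_exp_coeff // ler_wpM2l ?nneg_exp_coeff // iterP_norm.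
Qed.

Lemma exp_semigroup_taylor (t : R) u : 0 <= t ->
  `|S t u - u - t *: (c *: (P u - u))| <= 2 * (c * t) ^+ 2 * `|u|.
Proof.
move=> t0; rewrite scalerA [t * c]mulrC /S; set x := c * t.
have x0 : 0 <= x by rewrite mulr_ge0.
set q := expR (- x).
have q0 : 0 <= q by exact: expR_ge0.
have q1 : 1 - x <= q by have := expR_ge1Dx (- x).
have qle1 : q <= 1 by rewrite -expR0 ler_expR oppr_le0.
have qE : q * expR x = 1 by rewrite -expRD addNr expR0.
(* The remainder of [Pexp], the remainder of exp(- x), and a cross term that compensates for the
   factor [q] in front of [x *: P u]. *)
rewrite (_ : _ - _ - _ = q *: (Pexp x u - u - x *: P u) + (q - 1 + x) *: u
   + (x * (q - 1)) *: P u); last first.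
  rewrite !scalerBr scalerA scalerDl scalerBl scale1r mulrBr mulr1 scalerBl opprB !addrA.
  congr (_ - _); rewrite [x * q]mulrC.
  by rewrite [RHS](ACl (1*5*6*(2*4)*(3*7)))/= !addNr !addr0.
apply: (@le_trans _ _ (q * ((expR x - 1 - x) * `|u|) + (q - 1 + x) * `|u| + x * (1 - q) * `|u|)).
  rewrite (le_trans (ler_normD _ _)) // lerD //.
    rewrite (le_trans (ler_normD _ _)) // lerD //.
      by rewrite normrZ ger0_norm // ler_wpM2l // Pexp_taylor.
    by rewrite normrZ ger0_norm //; lra.
  rewrite normrZ normrM (ger0_norm x0) ler0_norm ?opprB; last by lra.
  by rewrite ler_wpM2l // mulr_ge0 // subr_ge0.
rewrite mulrA -!mulrDl ler_wpM2r //.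
(* As q exp(x) = 1, the three coefficients add up to 2 x (1 - q), and 1 - q <= x yields the constant
   2. *)
have -> : q * (expR x - 1 - x) + (q - 1 + x) + x * (1 - q) = q * expR x - 1 + 2 * x - 2 * x * q by ring.
by rewrite qE; nra.
Qed.

Lemma exp_semigroup_linear (t : R) : 0 <= t -> linear (S t).
Proof.
move=> t0 a u v; rewrite /S Pexp_linear; last exact: mulr_ge0.
by rewrite scalerDr !scalerA mulrC.
Qed.

Lemma exp_semigroup_opnorm (t : R) : 0 <= t -> (opnorm (S t) <= 1%:E)%E.
Proof.
move=> t0; apply: ub_ereal_sup => _ [u u1 <-].
by rewrite lee_fin (le_trans (exp_semigroup_contraction _ t0)).
Qed.

Lemma exp_semigroup_quotient u :
  h^-1 *: (S h u - u) @[h --> 0^'+] --> c *: (P u - u).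
Proof.
apply/subr_cvg0/norm_cvg0P.
apply: (@squeeze_cvgr _ _ _ _ (fun=> 0) (fun h : R => 2 * c ^+ 2 * `|u| * h)).
- near=> h; rewrite normr_ge0 /=.
  have h0 : 0 < h by [].
  have -> : h^-1 *: (S h u - u) - c *: (P u - u) =
    h^-1 *: (S h u - u - h *: (c *: (P u - u))).
    by rewrite [in RHS]scalerBr [_ *: (h *: _)]scalerA mulVf ?scale1r ?gt_eqF.
  rewrite normrZ gtr0_norm ?invr_gt0 // ler_pdivrMl //.
  have := exp_semigroup_taylor u (ltW h0); rewrite exprMn.
  by move=> h1; apply: le_trans h1 _; rewrite le_eqVlt; apply/orP; left; apply/eqP; ring.
- exact: cvg_cst.
- rewrite -[X in _ --> X](mulr0 (2 * c ^+ 2 * `|u|)); apply: cvgMr.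
  exact: (cvg_at_right_filter (@cvg_id _ _)).
Unshelve. all: by end_near. Qed.

Lemma exp_semigroup_C0 : C0_semigroup S.
Proof.
split.
- move=> t t0; split; first exact: exp_semigroup_linear.
  by apply: (le_lt_trans (exp_semigroup_opnorm t0)); exact: ltry.
- by move=> u; rewrite /S mulr0 oppr0 expR0 scale1r Pexp0.
- move=> s t u s0 t0; rewrite /S mulrDr PexpD ?mulr_ge0 //.
  have := Pexp_linear (mulr_ge0 c_ge0 s0) (expR (- (c * t))) (Pexp (c * t) u) 0.
  have -> : Pexp (c * s) 0 = 0.
    have := Pexp_linear (mulr_ge0 c_ge0 s0) (-1) 0 0.
    by rewrite scaler0 addr0 scaleN1r addNr.
  by rewrite !addr0 => ->; rewrite scalerA opprD expRD.
(* Strong continuity follows from differentiability at 0: [S h u] is [u] plus [h] times a convergent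
   quotient. *)
- move=> u; have := @exp_semigroup_quotient u => h1.
  have h2 : h *: (h^-1 *: (S h u - u)) + u @[h --> 0^'+] --> 0 *: (c *: (P u - u)) + u.
    apply: cvgD; last exact: cvg_cst.
    by apply: cvgZ => //; exact: (cvg_at_right_filter (@cvg_id _ _)).
  rewrite scale0r add0r in h2; apply: cvg_trans h2; apply: near_eq_cvg.
  near=> h; have h0 : h != 0 by rewrite gt_eqF.
  by rewrite scalerA mulfV // scale1r subrK.
Unshelve. all: by end_near. Qed.

Lemma exp_semigroup_generates (A : operator V) :
  domain A = setT -> (forall u, A u = c *: (P u - u)) -> generates A S.
Proof.
move=> dA AE; split.
  rewrite dA; apply/seteqP; split => // u _; exists (c *: (P u - u)).
  exact: exp_semigroup_quotient.
by move=> u _; rewrite AE; exact: exp_semigroup_quotient.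
Qed.

Lemma exp_semigroup_bound : semigroup_bound S 1 0.
Proof. by move=> t t0; rewrite mul0r expR0 mulr1; exact: exp_semigroup_opnorm. Qed.

End exponential_semigroup.

(** * Tonelli's theorem on the circle *)

Section circle_finite.
Variable R : realType.
Notation mu := (@lebesgue_measure R).
Notation m := (@circle_measure R).
Local Open Scope ereal_scope.

Lemma lebesgue_itv01_lty : mu (`[0%R, 1%R[%classic : set R) < +oo.
Proof. by rewrite lebesgue_measure_itv /= lte_fin ltr01 -EFinB ltry. Qed.

(** The same set function as [circle_measure], equipped with the finiteness that Tonelli's theorem
    requires. *)
Definition circle_finite : {finite_measure set (measurableTypeR R) -> \bar R} :=
  @mfrestr _ (measurableTypeR R) R _ (@lebesgue_measure R) (measurable_itv `[0%R, 1%R[) lebesgue_itv01_lty.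

Lemma circle_tonelli (f : measurableTypeR R * measurableTypeR R -> \bar R) :
  measurable_fun setT f -> (forall z, 0 <= f z) ->
  \int[m]_x \int[m]_y f (x, y) = \int[m]_y \int[m]_x f (x, y).
Proof. exact: (@fubini_tonelli _ _ _ _ R circle_finite circle_finite). Qed.

Lemma circle_measurable_integral (f : measurableTypeR R * measurableTypeR R -> \bar R) :
  measurable_fun setT f -> (forall z, 0 <= f z) ->
  measurable_fun setT (fun x => \int[m]_y f (x, y)).
Proof. exact: (@measurable_fun_fubini_tonelli_F _ _ _ _ R circle_finite). Qed.

(** The positive and negative parts have measurable integrals in [0, +oo]. Taking [fine] of their
    difference keeps measurability, including at the points where the integral diverges. *)
Lemma circle_measurable_Rintegral (f : measurableTypeR R * measurableTypeR R -> R) :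
  measurable_fun setT f -> measurable_fun setT (fun x => (\int[m]_y f (x, y))%R).
Proof.
move=> /measurable_EFinP mf; pose F := EFin \o f.
have -> : (fun x => (\int[m]_y f (x, y))%R) =
    fun x => fine (\int[m]_y ((F^\+ \o pair x) y) - \int[m]_y ((F^\- \o pair x) y)).
  by apply/funext => x; rewrite -funepos_comp -funeneg_comp -integralE.
apply: measurableT_comp => //; apply: emeasurable_funB.
- by apply: circle_measurable_integral => //; exact: measurable_funepos.
- by apply: circle_measurable_integral => //; exact: measurable_funeneg.
Qed.

End circle_finite.

(** * Periodization of nonnegative functions *)

Section periodization_theory.
Variable R : realType.
Notation mu := (@lebesgue_measure R).
Notation m := (@circle_measure R).
Local Open Scope ereal_scope.

(** Extended-valued, so that unfolding holds without any convergence question;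
    [periodization_kernel] compares it with [periodization]. *)
Definition per (g : R -> \bar R) (x : R) : \bar R :=
  \esum_(n in [set: int]) g (x + n%:~R)%R.

Lemma perE (g : R -> \bar R) x : (forall x, 0 <= g x) ->
  per g x = \sum_(k <oo) g (x + (nat_to_int k)%:~R)%R.
Proof.
move=> g0; rewrite /per (reindex_esum _ _ _ _ nat_to_int_bij) nneseries_esumT // => k.
Qed.

Lemma per_ge0 (g : R -> \bar R) x : (forall x, 0 <= g x) -> 0 <= per g x.
Proof. by move=> g0; exact: esum_ge0. Qed.

Lemma measurable_per (g : R -> \bar R) : measurable_fun setT g ->
  (forall x, 0 <= g x) -> measurable_fun setT (per g).
Proof.
move=> mg g0; rewrite (_ : per g = fun x => \sum_(k <oo) g (x + (nat_to_int k)%:~R)%R); last first.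
  by apply/funext => x; rewrite perE.
apply: ge0_emeasurable_sum => [k x _ _|k _]; first exact: g0.
by apply: measurableT_comp => //; exact: measurable_funD.
Qed.

Lemma periodic_int (G : R -> R) : (forall x, G (x + 1)%R = G x) ->
  forall (n : int) x, G (x + n%:~R)%R = G x.
Proof.
move=> G1; have Gn (n : nat) x : G (x + n%:R)%R = G x.
  elim: n x => [|n IH] x; first by rewrite addr0.
  by rewrite -natr1 addrA G1 IH.
move=> [n|n] x; first exact: Gn.
by rewrite NegzE mulrNz -[in RHS](subrK n.+1%:R x) Gn.
Qed.

Lemma opp_int_bij : set_bij [set: int] [set: int] (-%R).
Proof. by split. Qed.

(** Periodicity moves G inside the sum over the integers, which becomes the periodization in y of
    g(x - y) G(y) after the reflection n -> - n. Unfolding and substituting z = x - y give the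
    right-hand side. *)
Lemma unfold_convolution (g : R -> \bar R) (G : R -> R) x :
  measurable_fun setT g -> (forall x, 0 <= g x) ->
  measurable_fun setT G -> (forall x, 0 <= G x)%R -> (forall x, G (x + 1)%R = G x) ->
  \int[m]_y (per g (x - y)%R * (G y)%:E) = \int[mu]_z (g z * (G (x - z)%R)%:E).
Proof.
move=> mg g0 mG G0 G1.
pose f y := g (x - y)%R * (G y)%:E.
have mf : measurable_fun setT f.
  apply: emeasurable_funM; last exact/measurable_EFinP.
  by apply: measurableT_comp => //; exact: measurable_funB.
have f0 y : 0 <= f y by rewrite mule_ge0 ?lee_fin.
transitivity (\int[m]_y per f y).
  apply: eq_integral => y _.
  rewrite {1}/per (reindex_esum _ _ _ _ opp_int_bij).
  have -> : per f y = \esum_(i in [set: int]) ((G y)%:E * g (x - y + (- i)%:~R)%R).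
    apply: eq_esum => n _; rewrite /f /= (periodic_int G1).
    by rewrite (muleC (g _)); congr (_ * g _); rewrite mulrNz; lra.
  rewrite !(reindex_esum _ _ _ _ nat_to_int_bij) -!nneseries_esumT; last 2 first.
  - by move=> k; rewrite mule_ge0 ?lee_fin.
  - by move=> k.
  by rewrite nneseriesZl // muleC.
rewrite unfold_integral // -(@ge0_integral_affine _ (-1)%R x) //.
  rewrite normrN1 mul1e; apply: eq_integral => z _; rewrite /f.
  by rewrite mulN1r; congr (g _ * (G _)%:E); lra.
Qed.

(** Integration in x is what remains after Tonelli's theorem; [unfold_per_refl] is the counterpart
    in y and gives the mass of the kernel. *)
Lemma unfold_per (g : R -> \bar R) y :
  measurable_fun setT g -> (forall x, 0 <= g x) ->
  \int[m]_x per g (x - y)%R = \int[mu]_z g z.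
Proof.
move=> mg g0.
transitivity (\int[m]_x per (fun x => g (x - y)%R) x).
  by apply: eq_integral => x _; apply: eq_esum => n _; congr g; lra.
rewrite unfold_integral //; last first.
  by apply: measurableT_comp => //; exact: measurable_funB.
rewrite -[RHS](@ge0_integral_affine _ 1%R (- y)%R) ?oner_neq0 // normr1 mul1e.
by apply: eq_integral => x _; rewrite mul1r.
Qed.

Lemma unfold_per_refl (g : R -> \bar R) x :
  measurable_fun setT g -> (forall x, 0 <= g x) ->
  \int[m]_y per g (x - y)%R = \int[mu]_z g z.
Proof.
move=> mg g0; have := @unfold_convolution g (fun=> 1%R) x mg g0.
move=> /(_ (measurable_cst _) (fun=> ler01) (fun=> erefl)).
by under eq_integral do rewrite mule1; under [in RHS]eq_integral do rewrite mule1.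
Qed.

End periodization_theory.

(** * Convolution by a periodized probability density *)

Section circle_convolution.
Variable R : realType.
Notation mu := (@lebesgue_measure R).
Notation m := (@circle_measure R).
Notation Lf := (Lfun m 2%:E).
Variable h : R -> R.
Hypothesis mh : measurable_fun setT h.
Hypothesis h_ge0 : {ae mu, forall z, 0 <= h z}.
Hypothesis h_mass : (\int[mu]_z (h z)%:E = 1)%E.

Let g : R -> \bar R := fun z => (h^\+ z)%:E.
Let g0 z : (0 <= g z)%E. Proof. by rewrite lee_fin. Qed.
Let mg : measurable_fun setT g.
Proof. by apply/measurable_EFinP; exact: measurable_funrpos. Qed.
Let q := per g.
Let q0 x : (0 <= q x)%E. Proof. exact: per_ge0. Qed.
Let mq : measurable_fun setT q. Proof. exact: measurable_per. Qed.
Notation p := (periodization h).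

Let g_mass : (\int[mu]_z g z = 1)%E.
Proof.
rewrite -h_mass; apply: ae_eq_integral => //; first exact/measurable_EFinP.
apply: (ae_imp h_ge0) => z hz _.
rewrite /g /funrpos; congr EFin.
by apply/max_idPl.
Qed.

Lemma measurable_periodization : measurable_fun setT p.
Proof.
apply: measurable_funB.
  by apply: measurableT_comp => //; exact: mq.
apply: measurableT_comp => //.
apply: (@measurable_per R (fun z => (h^\- z)%:E)); last by move=> x; rewrite lee_fin.
by apply/measurable_EFinP; exact: measurable_funrneg.
Qed.

Let q_fin x : {ae m, forall y, q (x - y) \is a fin_num}.
Proof.
have iq : m.-integrable setT (fun y => q (x - y)).
  apply/integrableP; split.
    by apply: measurableT_comp => //; exact: measurable_funB.
  under eq_integral do rewrite gee0_abs //.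
  by rewrite unfold_per_refl // g_mass ltry.
by apply: (ae_imp (integrable_ae measurableT iq)) => y; exact.
Qed.

(** Both uses of [fine] are harmless almost everywhere: the sum of the positive parts has integral 1
    and is thus almost everywhere finite, and the sum of the negative parts has integral 0. The null
    set depends on x, but no x is excluded. *)
Lemma periodization_kernel x : {ae m, forall y, (p (x - y))%:E = q (x - y)}.
Proof.
pose g' z := (h^\- z)%:E.
have g'0 z : (0 <= g' z)%E by rewrite lee_fin.
have mg' : measurable_fun setT g' by apply/measurable_EFinP; exact: measurable_funrneg.
have z0 : {ae m, forall y, per g' (x - y) = 0%E}.
  have : ae_eq m setT (fun y => per g' (x - y)) (cst 0%E).
    apply/ae_eq_integral_abs => //.
      by apply: measurableT_comp; [exact: measurable_per|exact: measurable_funB].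
    under eq_integral do rewrite gee0_abs ?per_ge0 //.
    rewrite unfold_per_refl // -(integral0 mu setT); apply: ae_eq_integral => //.
    apply: (ae_imp h_ge0) => z hz _.
    rewrite /g' /funrneg; congr EFin.
    by apply/max_idPr; rewrite oppr_le0.
  by move=> H; apply: (ae_imp H) => y; exact.
apply: (ae_imp2 (q_fin x) z0) => y qf pz0.
rewrite /p; have -> : (\esum_(n in [set: int]) (h^\- (x - y + n%:~R))%:E = 0)%E by exact: pz0.
by rewrite subr0 fineK //; exact: qf.
Qed.

Lemma periodization_ge0 x : {ae m, forall y, 0 <= p (x - y)}.
Proof.
by apply: (ae_imp (periodization_kernel x)) => y E; rewrite -lee_fin E; exact: q0.
Qed.

Let mpx (x : R) : measurable_fun setT (fun y : R => p (x - y)).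
Proof. by apply: measurableT_comp; [exact: measurable_periodization|exact: measurable_funB]. Qed.

Lemma periodization_integrable x : m.-integrable setT (EFin \o (fun y => p (x - y))).
Proof.
apply/integrableP; split; first by apply/measurable_EFinP; exact: mpx.
rewrite (@ae_eq_integral _ _ _ m setT (fun y => q (x - y))) //; last 3 first.
- by apply: measurableT_comp => //; apply/measurable_EFinP; exact: mpx.
- by apply: measurableT_comp => //; exact: measurable_funB.
- by apply: (ae_imp (periodization_kernel x)) => y E _; rewrite -[RHS]gee0_abs // -E.
by rewrite unfold_per_refl // g_mass ltry.
Qed.

Lemma periodization_mass x : \int[m]_y p (x - y) = 1.
Proof.
rewrite /Rintegral (@ae_eq_integral _ _ _ m setT (fun y => q (x - y))) //; last 3 first.
- by apply/measurable_EFinP; exact: mpx.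
- by apply: measurableT_comp => //; exact: measurable_funB.
- by apply: (ae_imp (periodization_kernel x)) => y E _.
by rewrite unfold_per_refl // g_mass.
Qed.

Definition conv (u : R -> R) (x : R) : R := \int[m]_y (p (x - y) * u y).

(** The convolution of the square. It dominates the square of the convolution by Jensen's
    inequality, and its integral is that of [u ^+ 2] by Tonelli's theorem; hence it is finite for
    almost every x, and these are the points where [conv u x] is known to converge. *)
Let J (u : R -> R) x := (\int[m]_y (q (x - y) * (u y ^+ 2)%:E))%E.

Let mqq (u : R -> R) : measurable_fun setT u ->
  measurable_fun setT (fun z : measurableTypeR R * measurableTypeR R => (q (z.1 - z.2) * (u z.2 ^+ 2)%:E)%E).
Proof.
move=> mu_; apply: emeasurable_funM.
  by apply: measurableT_comp => //; exact: measurable_funB.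
by apply/measurable_EFinP; apply: measurable_funX; exact: measurableT_comp.
Qed.

Let J_int (u : R -> R) : u \in Lf -> (\int[m]_x J u x = \int[m]_y (u y ^+ 2)%:E)%E.
Proof.
move=> /Lfun2P[mu_ _].
rewrite /J (circle_tonelli (mqq mu_)); last by move=> z; rewrite mule_ge0 // lee_fin sqr_ge0.
apply: eq_integral => y _ /=.
rewrite ge0_integralZr //; last 2 first.
- by apply: (measurableT_comp mq); exact: measurable_funB.
- by rewrite lee_fin sqr_ge0.
by rewrite unfold_per // g_mass mul1e.
Qed.

Let mJ (u : R -> R) : u \in Lf -> measurable_fun setT (J u).
Proof.
move=> /Lfun2P[mu_ _]; apply: (circle_measurable_integral (mqq mu_)).
by move=> z; rewrite mule_ge0 // lee_fin sqr_ge0.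
Qed.

Let J0 u x : (0 <= J u x)%E.
Proof. by apply: integral_ge0 => y _; rewrite mule_ge0 // lee_fin sqr_ge0. Qed.

Let J_fin (u : R -> R) : u \in Lf -> {ae m, forall x, J u x \is a fin_num}.
Proof.
move=> hu; have iJ : m.-integrable setT (J u).
  apply/integrableP; split; first exact: mJ.
  under eq_integral do rewrite gee0_abs //.
  by rewrite J_int //; have /Lfun2P[] := hu.
by apply: (ae_imp (integrable_ae measurableT iJ)) => y; exact.
Qed.

Let sqr_integrable (u : R -> R) x : u \in Lf -> J u x \is a fin_num ->
  m.-integrable setT (EFin \o (fun y => p (x - y) * u y ^+ 2)) /\
  (\int[m]_y (p (x - y) * u y ^+ 2))%:E = J u x.
Proof.
move=> /Lfun2P[mu_ _] fJ.
have mpu : measurable_fun setT (fun y : R => p (x - y) * u y ^+ 2).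
  by apply: measurable_funM => //; exact: measurable_funX.
have mqu : measurable_fun setT (fun y : R => q (x - y) * (u y ^+ 2)%:E)%E.
  apply: emeasurable_funM.
    by apply: measurableT_comp => //; exact: measurable_funB.
  by apply/measurable_EFinP; exact: measurable_funX.
have E : (\int[m]_y (p (x - y) * u y ^+ 2)%:E = J u x)%E.
  apply: ae_eq_integral => //; first exact/measurable_EFinP.
  by apply: (ae_imp (periodization_kernel x)) => y E _; rewrite EFinM E.
split; last by rewrite /Rintegral E fineK.
apply/integrableP; split; first exact/measurable_EFinP.
rewrite (_ : (\int[m]_y _ = J u x)%E); first by rewrite ltey_eq fJ.
rewrite -E; apply: ae_eq_integral => //; [|exact/measurable_EFinP|].
  by apply: measurableT_comp => //; exact/measurable_EFinP.
apply: (ae_imp (periodization_ge0 x)) => y py _.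
by rewrite /= ger0_norm // mulr_ge0 // sqr_ge0.
Qed.

Let lin_integrable (u : R -> R) x : u \in Lf -> J u x \is a fin_num ->
  m.-integrable setT (EFin \o (fun y => p (x - y) * u y)).
Proof.
move=> hu fJ; have [i2 _] := sqr_integrable hu fJ.
have mu_ := Lfun2_measurable hu.
(* The function p + p u^2 dominates |p u|, as a <= 1 + a^2. *)
have i3 := integrableD measurableT (periodization_integrable x) i2.
have mm : measurable_fun setT (fun y : R => p (x - y) * u y) by exact: measurable_funM.
apply/integrableP; split; first exact/measurable_EFinP.
apply: le_lt_trans (integrable_lty measurableT (integrable_abse i3)).
apply: ae_ge0_le_integral => //.
- by apply: measurableT_comp => //; exact/measurable_EFinP.
- by move=> y _; exact: abse_ge0.
- by apply: measurableT_comp => //; have /integrableP[] := i3.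
apply: (ae_imp (periodization_ge0 x)) => y py _.
rewrite /= lee_fin; apply: le_trans (ler_norm _).
rewrite normrM (ger0_norm py) -{2}(mulr1 (p _)) -mulrDr ler_wpM2l //.
rewrite -[u y ^+ 2]real_normK ?num_real //; move: `|u y| (normr_ge0 (u y)) => a a0.
by nra.
Qed.

Let mconv (u : R -> R) : u \in Lf -> measurable_fun setT (conv u).
Proof.
move=> /Lfun2P[mu_ _].
pose f (z : measurableTypeR R * measurableTypeR R) := p (z.1 - z.2) * u z.2.
apply: (@circle_measurable_Rintegral _ f).
apply: measurable_funM; last exact: measurableT_comp.
by apply: (measurableT_comp measurable_periodization); exact: measurable_funB.
Qed.

(* Integrate [0 <= p (x - y) * (a - u y) ^+ 2] in [y], with [a = conv u x]. *)
Let conv_sqr (u : R -> R) x : u \in Lf -> J u x \is a fin_num ->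
  ((conv u x ^+ 2)%:E <= J u x)%E.
Proof.
move=> hu fJ; have [i2 e2] := sqr_integrable hu fJ.
have i1 := lin_integrable hu fJ.
have i0 := periodization_integrable x.
rewrite -e2 lee_fin; set a := conv u x.
have il : m.-integrable setT (EFin \o (fun y => 2 * a * (p (x - y) * u y))).
  exact: (integrableZl measurableT (2 * a) i1).
have ir : m.-integrable setT (EFin \o (fun y => a ^+ 2 * p (x - y) + p (x - y) * u y ^+ 2)).
  exact: (integrableD measurableT (integrableZl measurableT (a ^+ 2) i0) i2).
have : \int[m]_y (2 * a * (p (x - y) * u y)) <=
       \int[m]_y (a ^+ 2 * p (x - y) + p (x - y) * u y ^+ 2).
  rewrite -subr_ge0 -RintegralB // fine_ge0 //.
  have mB : measurable_fun setT (fun y : R => a ^+ 2 * p (x - y) + p (x - y) * u y ^+ 2 - 2 * a * (p (x - y) * u y)).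
    apply: measurable_funB; apply/measurable_EFinP.
      by have /integrableP[] := ir.
    by have /integrableP[] := il.
  rewrite (@ae_eq_integral _ _ _ m setT (fun y : R => (`|a ^+ 2 * p (x - y) + p (x - y) * u y ^+ 2 - 2 * a * (p (x - y) * u y)|)%:E)) //.
  - by apply: integral_ge0 => y _; rewrite lee_fin.
  - exact/measurable_EFinP.
  - by apply/measurable_EFinP; exact: measurableT_comp.
  apply: (ae_imp (periodization_ge0 x)) => y py _.
  have E : a ^+ 2 * p (x - y) + p (x - y) * u y ^+ 2 - 2 * a * (p (x - y) * u y)
      = p (x - y) * (a - u y) ^+ 2 by ring.
  rewrite ger0_norm // E.
  by rewrite mulr_ge0 // sqr_ge0.
rewrite RintegralZl // RintegralD //; last exact: (integrableZl measurableT (a ^+ 2) i0).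
rewrite RintegralZl // periodization_mass -/(conv u x) -/a => h1.
by lra.
Qed.

Lemma conv_Lfun (u : R -> R) : u \in Lf -> conv u \in Lf.
Proof.
move=> hu; apply/Lfun2P; split; first exact: mconv.
have /Lfun2P[_] := hu; apply: le_lt_trans; rewrite -(J_int hu).
apply: ae_ge0_le_integral => //.
- by move=> x _; rewrite lee_fin sqr_ge0.
- by apply/measurable_EFinP; apply: measurable_funX; exact: mconv.
- exact: mJ.
by apply: (ae_imp (J_fin hu)) => x fJ _; exact: conv_sqr.
Qed.

Lemma conv_contraction (u : R -> R) : u \in Lf ->
  `|to_L2 m (conv u)| <= `|to_L2 m u|.
Proof.
move=> hu; have hc := conv_Lfun hu.
rewrite -(@ler_pXn2r _ 2) ?nnegrE // !L2_sqr_norm_to_L2 //.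
rewrite /Rintegral fine_le //.
- exact: (integrable_fin_num measurableT (Lfun2_integrable_sqr hc)).
- exact: (integrable_fin_num measurableT (Lfun2_integrable_sqr hu)).
rewrite -(J_int hu); apply: ae_ge0_le_integral => //.
- by move=> x _; rewrite lee_fin sqr_ge0.
- by apply/measurable_EFinP; apply: measurable_funX; exact: mconv.
- exact: mJ.
by apply: (ae_imp (J_fin hu)) => x fJ _; exact: conv_sqr.
Qed.

Lemma conv_integrable (u : R -> R) : u \in Lf ->
  {ae m, forall x, m.-integrable setT (EFin \o (fun y => p (x - y) * u y))}.
Proof. by move=> hu; apply: (ae_imp (J_fin hu)) => x; exact: lin_integrable. Qed.

(** Restricted to the points where both integrals converge: at a divergent one [fine] returns a
    default value, and additivity may fail. *)
Lemma conv_linear a (u v : R -> R) : u \in Lf -> v \in Lf ->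
  {ae m, forall x, conv (fun y => a * u y + v y) x = a * conv u x + conv v x}.
Proof.
move=> hu hv; apply: (ae_imp2 (conv_integrable hu) (conv_integrable hv)) => x iu iv.
rewrite /conv -RintegralZl // -RintegralD //; last exact: (integrableZl measurableT a iu).
by apply: eq_Rintegral => y _; ring.
Qed.

(** Changing [u] on a null set changes the integral at no point x, so the convolution of a class
    does not depend on its representative. *)
Lemma conv_ae (u v : R -> R) : u \in Lf -> v \in Lf ->
  {ae m, forall x, u x = v x} -> conv u = conv v.
Proof.
move=> hu hv uv; apply/funext => x.
have mm (w : R -> R) : w \in Lf -> measurable_fun setT (fun y : R => p (x - y) * w y).
  by move=> hw; apply: measurable_funM; [exact: mpx|exact: Lfun2_measurable hw].
rewrite /conv /Rintegral; congr fine.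
apply: ae_eq_integral => //.
- by apply/measurable_EFinP; exact: mm.
- by apply/measurable_EFinP; exact: mm.
by apply: (ae_imp uv) => y -> _.
Qed.

(** The increment form agrees with [conv u x - u x] only almost everywhere, so its measurability is
    proved on its own. *)
Lemma measurable_increment (u : R -> R) : u \in Lf ->
  measurable_fun setT (fun x : R => \int[m]_y (p (x - y) * (u y - u x))).
Proof.
move=> /Lfun2P[mu_ _].
pose f (z : measurableTypeR R * measurableTypeR R) := p (z.1 - z.2) * (u z.2 - u z.1).
apply: (@circle_measurable_Rintegral _ f); apply: measurable_funM.
  by apply: (measurableT_comp measurable_periodization); exact: measurable_funB.
by apply: measurable_funB; exact: measurableT_comp.
Qed.

Lemma conv_increment (u : R -> R) : u \in Lf ->
  {ae m, forall x, \int[m]_y (p (x - y) * (u y - u x)) = conv u x - u x}.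
Proof.
move=> hu; apply: (ae_imp (conv_integrable hu)) => x iu.
have i0 := periodization_integrable x.
transitivity (\int[m]_y (p (x - y) * u y - u x * p (x - y))).
  by apply: eq_Rintegral => y _; ring.
rewrite RintegralB //; last exact: (integrableZl measurableT (u x) i0).
by rewrite RintegralZl // periodization_mass mulr1.
Qed.

End circle_convolution.

(** * Taylor bounds for the cosine *)

Section cosine_bounds.
Variable R : realType.

(** Applied four times, starting from cos <= 1: each of the bounds below says that the derivative
    occurring in the next one is nonnegative. *)
Lemma ge0_derive_ge0 (f f' : R -> R) : (forall x : R, is_derive x (1 : R) f (f' x)) ->
  f 0 = 0 -> (forall x, 0 <= x -> 0 <= f' x) -> forall x, 0 <= x -> 0 <= f x.
Proof.
move=> df f0 f'0 x; rewrite le_eqVlt => /orP[/eqP <-|x0]; first by rewrite f0.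
have [|c c0x] := @MVT R f f' 0 x x0 (fun y _ => df y).
  by apply: derivable_within_continuous => y _; exact: (@ex_derive _ _ _ _ _ _ _ (df y)).
rewrite f0 !subr0 => ->; apply: mulr_ge0; last exact: ltW.
apply: f'0.
by move: c0x; rewrite in_itv /= => /andP[/ltW].
Qed.

Lemma sin_le (x : R) : 0 <= x -> sin x <= x.
Proof.
move=> x0; rewrite -subr_ge0.
apply: (@ge0_derive_ge0 (fun x => x - sin x) (fun x => 1 - cos x)) => //.
- by rewrite sin0 subr0.
Qed.

Lemma cos_ge_quadratic0 (x : R) : 0 <= x -> 1 - x ^+ 2 / 2 <= cos x.
Proof.
move=> x0; rewrite -subr_ge0.
apply: (@ge0_derive_ge0 (fun x => cos x - (1 - x ^+ 2 / 2)) (fun x => x - sin x)) => //.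
- move=> y; by apply: is_derive_eq; rewrite /GRing.scale /=; field.
- by rewrite cos0; field.
by move=> y y0; rewrite subr_ge0 sin_le.
Qed.

Lemma sin_ge_cubic (x : R) : 0 <= x -> x - x ^+ 3 / 6 <= sin x.
Proof.
move=> x0; rewrite -subr_ge0.
apply: (@ge0_derive_ge0 (fun x => sin x - (x - x ^+ 3 / 6)) (fun x => cos x - (1 - x ^+ 2 / 2))) => //.
- move=> y; by apply: is_derive_eq; rewrite /GRing.scale /=; field.
- by rewrite sin0; field.
by move=> y y0; rewrite subr_ge0 cos_ge_quadratic0.
Qed.

Lemma cos_le_quartic0 (x : R) : 0 <= x -> cos x <= 1 - x ^+ 2 / 2 + x ^+ 4 / 24.
Proof.
move=> x0; rewrite -subr_ge0.
apply: (@ge0_derive_ge0 (fun x => (1 - x ^+ 2 / 2 + x ^+ 4 / 24) - cos x) (fun x => sin x - (x - x ^+ 3 / 6))) => //.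
- move=> y; by apply: is_derive_eq; rewrite /GRing.scale /=; field.
- by rewrite cos0; field.
by move=> y y0; rewrite subr_ge0 sin_ge_cubic.
Qed.

Lemma cos_taylor_bounds (x : R) : 0 <= cos x - 1 + x ^+ 2 / 2 <= x ^+ 4 / 24.
Proof.
wlog x0 : x / 0 <= x.
  move=> H; have [/H //|/ltW x0] := leP 0 x.
  have := H (- x); rewrite cosN oppr_ge0 sqrrN => /(_ x0).
  by rewrite (_ : (- x) ^+ 4 = x ^+ 4) //; ring.
have := cos_ge_quadratic0 x0; have := cos_le_quartic0 x0; lra.
Qed.

End cosine_bounds.

(** * Cosine waves with a phase *)

Section waves.
Variable R : realType.
Notation mu := (@lebesgue_measure R).
Notation m := (@circle_measure R).
Notation Lf := (Lfun m 2%:E).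

(* The phases [0] and [pi / 2] give the cosine and the opposite of the sine. *)
Definition wave (k : nat) (a x : R) : R := cos (2 * pi * k%:R * x + a).

Lemma cos_int (n : nat) (x : R) : cos (x + 2 * pi * n%:R) = cos x.
Proof.
rewrite (_ : 2 * pi * n%:R = pi *+ 2 *+ n); first exact: periodicn (@cosD2pi R) n x.
by rewrite -mulrnA -[RHS]mulr_natr natrM; move: pi => q; ring.
Qed.

Lemma wave_periodic k a x : wave k a (x + 1) = wave k a x.
Proof.
rewrite /wave (_ : _ + a = (2 * pi * k%:R * x + a) + 2 * pi * k%:R); last by ring.
exact: cos_int.
Qed.

Lemma is_derive_wave k a (x : R) : is_derive x (1 : R) (wave k a) (2 * pi * k%:R * wave k (a + pi / 2) x).
Proof.
rewrite /wave addrA cosDpihalf; apply: is_derive_eq; rewrite /GRing.scale /=; ring.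
Qed.

Lemma wave_bound k a x : `|wave k a x| <= 1.
Proof. by rewrite ler_norml cos_geN1 cos_le1. Qed.

Lemma measurable_wave k a : measurable_fun setT (wave k a).
Proof.
apply: measurableT_comp; first exact: continuous_measurable_fun (@continuous_cos R).
by apply: measurable_funD => //; exact: measurable_funM.
Qed.

Lemma bounded_Lfun2 (f : R -> R) (B : R) : measurable_fun setT f -> (forall x, `|f x| <= B) -> f \in Lf.
Proof.
move=> mf fB; apply: (@Lfun2_le _ _ _ m f (cst B)) => //.
  apply/Lfun2P; split; first exact: measurable_cst.
  by rewrite (integral_cst _ measurableT (B ^+ 2)%:E) circle_measureT mule1 ltry.
exact: aeW.
Qed.

Lemma wave_Lfun k a : wave k a \in Lf.
Proof. exact: bounded_Lfun2 (measurable_wave k a) (wave_bound k a). Qed.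

Lemma integral_affine (a b : R) (f : R -> R) : a != 0 ->
  mu.-integrable setT (EFin \o f) ->
  `|a| * \int[mu]_x f (a * x + b) = \int[mu]_x f x.
Proof.
move=> a0 fi; pose F := EFin \o f.
have mF : measurable_fun setT F by have /integrableP[] := fi.
pose phi x := a * x + b.
have na0 : `|a| != 0 by rewrite normr_eq0.
have div (X Y : \bar R) : (`|a|%:E * X = Y -> X = `|a|^-1%:E * Y)%E.
  by move=> <-; rewrite muleA -EFinM mulVf // mul1e.
have E : (\int[mu]_x F (phi x) = \int[mu]_x F^\+ (phi x) - \int[mu]_x F^\- (phi x))%E.
  by rewrite -[LHS]/(\int[mu]_x (F \o phi) x)%E integralE funepos_comp funeneg_comp.
have hp := @ge0_integral_affine _ a b F^\+%E a0 (measurable_funepos mF) (funepos_ge0 F).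
have hn := @ge0_integral_affine _ a b F^\-%E a0 (measurable_funeneg mF) (funeneg_ge0 F).
have fp := integrable_pos_fin_num measurableT fi.
have fn := integrable_neg_fin_num measurableT fi.
rewrite /Rintegral [X in _ * fine X]E (div _ _ hp) (div _ _ hn) [in RHS]integralE.
rewrite -(fineK fp) -(fineK fn) -!EFinM -!EFinB /=.
by rewrite -mulrBr mulrA mulfV // mul1r.
Qed.

End waves.

(** * Convolution by an even density as a multiplier on waves *)

Section wave_multiplier.
Variable R : realType.
Notation mu := (@lebesgue_measure R).
Notation m := (@circle_measure R).
Notation Lf := (Lfun m 2%:E).
Variable h : R -> R.
Hypothesis mh : measurable_fun setT h.
Hypothesis h_ge0 : {ae mu, forall z, 0 <= h z}.
Hypothesis h_mass : (\int[mu]_z (h z)%:E = 1)%E.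
Hypothesis h_even : {ae mu, forall z, h (- z) = h z}.

Lemma density_integrable : mu.-integrable setT (EFin \o h).
Proof.
apply/integrableP; split; first exact/measurable_EFinP.
rewrite (@ae_eq_integral _ _ _ mu setT (EFin \o h)) //.
- by rewrite h_mass ltry.
- by apply: measurableT_comp => //; exact/measurable_EFinP.
- exact/measurable_EFinP.
by apply: (ae_imp h_ge0) => z hz _; rewrite /= ger0_norm.
Qed.

Lemma density_bounded_integrable (w : R -> R) : measurable_fun setT w ->
  (forall z, `|w z| <= 1) -> mu.-integrable setT (EFin \o (fun z => h z * w z)).
Proof.
move=> mw w1; apply: le_integrable density_integrable => //.
  by apply/measurable_EFinP; exact: measurable_funM.
by move=> z _; rewrite /= lee_fin normrM ler_piMr.
Qed.

Definition cosine_transform (k : nat) : R := \int[mu]_z (h z * cos (2 * pi * k%:R * z)).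

Let mcos (c : R) : measurable_fun setT (fun z : R => cos (c * z)).
Proof.
apply: measurableT_comp; first exact: continuous_measurable_fun (@continuous_cos R).
exact: measurable_funM.
Qed.

Let msin (c : R) : measurable_fun setT (fun z : R => sin (c * z)).
Proof.
apply: measurableT_comp; first exact: continuous_measurable_fun (@continuous_sin R).
exact: measurable_funM.
Qed.

Let cos1 (c : R) : `|cos c| <= 1. Proof. by rewrite ler_norml cos_geN1 cos_le1. Qed.
Let sin1 (c : R) : `|sin c| <= 1. Proof. by rewrite ler_norml sin_geN1 sin_le1. Qed.

Lemma sine_transform0 (c : R) : \int[mu]_z (h z * sin (c * z)) = 0.
Proof.
have i : mu.-integrable setT (EFin \o (fun z => h z * sin (c * z))) by exact: density_bounded_integrable.
have := @integral_affine R (-1) 0 _ _ i; rewrite oppr_eq0 oner_neq0 => /(_ isT).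
rewrite normrN1 mul1r => E.
suff : \int[mu]_z (h z * sin (c * z)) = - \int[mu]_z (h z * sin (c * z)) by lra.
transitivity (\int[mu]_z (-1 * (h z * sin (c * z)))); last by rewrite RintegralZl // mulN1r.
rewrite -E /Rintegral; congr fine.
have mm : measurable_fun setT (fun z : R => h z * sin (c * z)) by exact: measurable_funM.
apply: ae_eq_integral => //.
- apply/measurable_EFinP; apply: (measurableT_comp mm); exact: measurable_funD.
- by apply/measurable_EFinP; apply: measurable_funM => //.
apply: (ae_imp h_even) => z hz _.
have -> : -1 * z + 0 = - z by lra.
by rewrite hz mulrN sinN mulrN mulN1r.
Qed.

(** Unfolding turns the convolution into an integral over the line. There the addition formula
    splits the wave into a cosine part, which gives the multiplier, and a sine part, which vanishes
    by evenness. *)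
Lemma conv_wave k a x : conv h (wave k a) x = cosine_transform k * wave k a x.
Proof.
pose g z := (h^\+ z)%:E.
have g0 z : (0 <= g z)%E by rewrite lee_fin.
have mg : measurable_fun setT g by apply/measurable_EFinP; exact: measurable_funrpos.
(* Unfolding applies to nonnegative functions; the added constant contributes the mass 1 to both
   sides and cancels at the end. *)
pose G y := 1 + wave k a y.
have G0 y : 0 <= G y by have := wave_bound k a y; rewrite ler_norml /G => /andP[]; lra.
have mG : measurable_fun setT G by apply: measurable_funD => //; exact: measurable_wave.
have G1 y : G (y + 1) = G y by rewrite /G wave_periodic.
have mp : measurable_fun setT (fun y : R => periodization h (x - y)).
  by apply: (measurableT_comp (measurable_periodization mh)); exact: measurable_funB.
have U := unfold_convolution x mg g0 mG G0 G1.
have pk : {ae m, forall y, (periodization h (x - y))%:E = per g (x - y)} :=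
  periodization_kernel mh h_ge0 h_mass x.
have ip := periodization_integrable mh h_ge0 h_mass x.
have iw : m.-integrable setT (EFin \o (fun y => periodization h (x - y) * wave k a y)).
  apply: le_integrable ip => //.
    by apply/measurable_EFinP; apply: measurable_funM => //; exact: measurable_wave.
  by move=> z _; rewrite /= lee_fin normrM ler_piMr // wave_bound.
have L : \int[m]_y (periodization h (x - y) * G y) = 1 + conv h (wave k a) x.
  rewrite -(periodization_mass mh h_ge0 h_mass x) /conv -RintegralD //.
  by apply: eq_Rintegral => y _; rewrite /G mulrDr mulr1.
set A := 2 * pi * k%:R * x + a.
pose th := 2 * pi * k%:R : R.
have ic : mu.-integrable setT (EFin \o (fun z => h z * cos (th * z))) by exact: density_bounded_integrable.
have is_ : mu.-integrable setT (EFin \o (fun z => h z * sin (th * z))) by exact: density_bounded_integrable.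
have icA := integrableZl measurableT (cos A) ic.
have isA := integrableZl measurableT (sin A) is_.
have Rr : \int[mu]_z (h z * G (x - z)) = 1 + cosine_transform k * wave k a x.
  transitivity (\int[mu]_z (h z + (cos A * (h z * cos (th * z)) + sin A * (h z * sin (th * z))))).
    apply: eq_Rintegral => z _; rewrite /G /wave.
    have -> : 2 * pi * k%:R * (x - z) + a = A - th * z by rewrite /A /th; move: pi => q; ring.
    by rewrite cosB; ring.
  rewrite RintegralD //; last 2 first.
  - exact: density_integrable.
  - exact: (integrableD measurableT icA isA).
  rewrite RintegralD // !RintegralZl // sine_transform0 mulr0 addr0.
  by rewrite /Rintegral h_mass /= mulrC.
apply: (@addrI _ 1); rewrite -L -Rr /Rintegral; congr fine.
transitivity (\int[m]_y (per g (x - y) * (G y)%:E))%E.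
  apply: ae_eq_integral => //.
  - by apply/measurable_EFinP; exact: measurable_funM.
  - apply: emeasurable_funM; last exact/measurable_EFinP.
    by apply: (measurableT_comp (measurable_per mg g0)); exact: measurable_funB.
  by apply: (ae_imp pk) => y E _; rewrite EFinM E.
rewrite U; apply: ae_eq_integral => //.
- apply: emeasurable_funM => //; apply/measurable_EFinP.
  by apply: (measurableT_comp mG); exact: measurable_funB.
- apply/measurable_EFinP; apply: measurable_funM => //.
  by apply: (measurableT_comp mG); exact: measurable_funB.
apply: (ae_imp h_ge0) => z hz _.
by rewrite EFinM /g /funrpos; congr (_%:E * _)%E; apply/max_idPl.
Qed.

Definition conv_op (u : L2T R) : L2T R := to_L2 m (conv h u).

Lemma conv_op_linear : linear conv_op.
Proof.
suff H a (u v : L2T R) : conv_op (a *: u + v) = a *: conv_op u + conv_op v by move=> a u v; exact: H.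
rewrite /conv_op.
have hu := L2_Lfun u; have hv := L2_Lfun v.
have huv : (fun y => a * u y + v y) \in Lf by apply: Lfun2D => //; exact: Lfun2Z.
have -> : conv h (a *: u + v : L2T R) = conv h (fun y => a * u y + v y).
  apply: conv_ae => //; first exact: L2_Lfun.
  by apply: (ae_imp2 (L2_addE (a *: u) v) (L2_scaleE a u)) => x -> ->.
have hcu := conv_Lfun mh h_ge0 h_mass hu.
have hcv := conv_Lfun mh h_ge0 h_mass hv.
rewrite -to_L2Z // -to_L2D //; last exact: Lfun2Z.
apply: to_L2_ae.
- exact: conv_Lfun.
- by apply: Lfun2D => //; exact: Lfun2Z.
exact: conv_linear.
Qed.

Lemma conv_op_contraction u : `|conv_op u| <= `|u|.
Proof. by rewrite -[in leRHS](to_L2K u); apply: conv_contraction => //; exact: L2_Lfun. Qed.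

Lemma conv_op_to_L2 (f : R -> R) : f \in Lf -> conv_op (to_L2 m f) = to_L2 m (conv h f).
Proof.
move=> hf; rewrite /conv_op; congr to_L2; apply: conv_ae => //; first exact: L2_Lfun.
exact: to_L2E.
Qed.

End wave_multiplier.

(** * The algebra of trigonometric polynomials, and polynomial approximation of a step *)

Section trigonometric_polynomials.
Variable R : realType.
Notation mu := (@lebesgue_measure R).
Notation m := (@circle_measure R).
Notation Lf := (Lfun m 2%:E).

(** Each entry is a coefficient, a frequency and a phase. No normal form is imposed and frequencies
    may repeat: addition is concatenation, and derivatives and multipliers act entry by entry. *)
Definition tpoly (s : seq (R * (nat * R))) (x : R) : R :=
  \sum_(t <- s) t.1 * wave t.2.1 t.2.2 x.

Lemma tpoly_cat s s' x : tpoly (s ++ s') x = tpoly s x + tpoly s' x.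
Proof. by rewrite /tpoly big_cat. Qed.

Lemma tpoly_cons t s x : tpoly (t :: s) x = t.1 * wave t.2.1 t.2.2 x + tpoly s x.
Proof. by rewrite /tpoly big_cons. Qed.

(** A Fourier multiplier with symbol [f]; a constant symbol gives scalar multiplication. *)
Definition tscale (f : nat -> R) (s : seq (R * (nat * R))) : seq (R * (nat * R)) :=
  [seq (f t.2.1 * t.1, t.2) | t <- s].

Lemma tpoly_scale a s x : tpoly (tscale (fun=> a) s) x = a * tpoly s x.
Proof.
by rewrite /tpoly big_map mulr_sumr; apply: eq_bigr => t _; rewrite mulrA.
Qed.

Lemma measurable_tpoly s : measurable_fun setT (tpoly s).
Proof.
apply: measurable_sum => t; apply: measurable_funM => //; exact: measurable_wave.
Qed.

Lemma tpoly_bounded s : exists B, forall x, `|tpoly s x| <= B.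
Proof.
exists (\sum_(t <- s) `|t.1|) => x; rewrite (le_trans (ler_norm_sum _ _ _)) //.
by apply: ler_sum => t _; rewrite normrM ler_piMr // wave_bound.
Qed.

Lemma tpoly_Lfun s : tpoly s \in Lf.
Proof. by have [B sB] := tpoly_bounded s; exact: bounded_Lfun2 (measurable_tpoly s) sB. Qed.

(** The product-to-sum formula. Frequencies being naturals, their difference is the maximum minus
    the minimum, and the evenness of the cosine adjusts the sign of the phase. *)
Lemma waveM k l (a b x : R) : wave k a x * wave l b x =
  2^-1 * wave (k + l) (a + b) x +
  2^-1 * wave (maxn k l - minn k l) (if (k <= l)%N then b - a else a - b) x.
Proof.
rewrite /wave natrD.
have -> : 2 * pi * (k%:R + l%:R) * x + (a + b) =
   (2 * pi * k%:R * x + a) + (2 * pi * l%:R * x + b) by move: pi => q; ring.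
have -> : cos (2 * pi * (maxn k l - minn k l)%:R * x + (if (k <= l)%N then b - a else a - b)) =
    cos ((2 * pi * k%:R * x + a) - (2 * pi * l%:R * x + b)).
  case: leqP => kl; rewrite /=.
    by rewrite natrB // -[LHS]cosN; congr (cos _); move: pi => q; ring.
  by rewrite natrB; [congr (cos _); move: pi => q; ring|exact: ltnW].
move: (_ + a) (_ + b) => A B.
by rewrite cosB cosD; field.
Qed.

Lemma tpoly_waveM c k a s : exists s', forall x, c * wave k a x * tpoly s x = tpoly s' x.
Proof.
elim: s => [|[c' [l b]] s [s' IH]].
  by exists [::] => x; rewrite /tpoly !big_nil mulr0.
exists [:: (c * c' / 2, ((k + l)%N, a + b)),
  (c * c' / 2, ((maxn k l - minn k l)%N, if (k <= l)%N then b - a else a - b)) & s'] => x.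
rewrite !tpoly_cons mulrDr IH addrA /=; congr (_ + _).
by rewrite mulrACA waveM; ring.
Qed.

Lemma tpolyM s1 s2 : exists s, forall x, tpoly s1 x * tpoly s2 x = tpoly s x.
Proof.
elim: s1 => [|[c [k a]] s [s' IH]].
  by exists [::] => x; rewrite /tpoly !big_nil mul0r.
have [s'' h] := tpoly_waveM c k a s2.
by exists (s'' ++ s') => x; rewrite tpoly_cons mulrDl IH tpoly_cat h.
Qed.

Definition trig (f : R -> R) := exists s, forall x, f x = tpoly s x.

Lemma trig_wave k a : trig (wave k a).
Proof. by exists [:: (1, (k, a))] => x; rewrite /tpoly big_seq1 mul1r. Qed.

Lemma trigM f g : trig f -> trig g -> trig (fun x => f x * g x).
Proof.
move=> [s hf] [s' hg]; have [s'' h] := tpolyM s s'.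
by exists s'' => x; rewrite hf hg h.
Qed.

Lemma trigD f g : trig f -> trig g -> trig (fun x => f x + g x).
Proof. by move=> [s hf] [s' hg]; exists (s ++ s') => x; rewrite hf hg tpoly_cat. Qed.

Lemma trigZ a f : trig f -> trig (fun x => a * f x).
Proof. by move=> [s hf]; exists (tscale (fun=> a) s) => x; rewrite hf tpoly_scale. Qed.

Lemma trig_cst a : trig (fun=> a).
Proof.
have [s h] := trigZ a (trig_wave 0 0); exists s => x; rewrite -h.
by rewrite /wave mulr0 mul0r addr0 cos0 mulr1.
Qed.

Lemma trigB f g : trig f -> trig g -> trig (fun x => f x - g x).
Proof.
move=> hf hg; have [s h] := trigD hf (trigZ (-1) hg).
by exists s => x; rewrite -h mulN1r.
Qed.

Lemma trigX f n : trig f -> trig (fun x => f x ^+ n).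
Proof.
move=> hf; elim: n => [|n IH]; first exact: trig_cst.
by have [s h] := trigM hf IH; exists s => x; rewrite exprS h.
Qed.

Lemma trig_Lfun f : trig f -> f \in Lf.
Proof. by move=> [s h]; rewrite (_ : f = tpoly s); [exact: tpoly_Lfun|exact/funext]. Qed.

(* The polynomials [1 - (1 - s ^ n) ^ 2 ^ n] converge to the indicator of
   [s > 1 / 2] on [0, 1], away from [s = 1 / 2]. *)
Definition threshold (n : nat) (s : R) : R := 1 - (1 - s ^+ n) ^+ (2 ^ n).

Lemma threshold01 n s : 0 <= s <= 1 -> 0 <= threshold n s <= 1.
Proof.
move=> /andP[s0 s1]; rewrite /threshold.
have h0 : 0 <= 1 - s ^+ n by rewrite subr_ge0 exprn_ile1.
have h1 : 1 - s ^+ n <= 1 by rewrite gerBl exprn_ge0.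
by rewrite subr_ge0 exprn_ile1 //= gerBl exprn_ge0.
Qed.

Lemma bernoulli_ineq (y : R) n : -1 <= y -> 1 + n%:R * y <= (1 + y) ^+ n.
Proof.
move=> y1; elim: n => [|n IH]; first by rewrite mul0r addr0 expr0.
rewrite exprS -natr1; apply: (@le_trans _ _ ((1 + y) * (1 + n%:R * y))).
  have : 0 <= n%:R * y ^+ 2 by rewrite mulr_ge0 // sqr_ge0.
  by move: (n%:R) => t; nra.
by apply: ler_wpM2l => //; lra.
Qed.

(** Bernoulli's inequality gives (1 - s^n)^(2^n) >= 1 - (2 s)^n, so the threshold is at most (2
    s)^n. *)
Lemma threshold_cvg0 s : 0 <= s < 2^-1 -> threshold n s @[n --> \oo] --> (0 : R).
Proof.
move=> /andP[s0 s1].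
apply: (@squeeze_cvgr _ _ _ _ (fun=> 0) (fun n => (2 * s) ^+ n)).
- apply: nearW => n.
  have /andP[-> _] /= : 0 <= threshold n s <= 1 by apply: threshold01; rewrite s0 /=; lra.
  have sn1 : s ^+ n <= 1 by rewrite exprn_ile1 //; lra.
  have := @bernoulli_ineq (- s ^+ n) (2 ^ n); rewrite lerN2 => /(_ sn1).
  rewrite mulrN natrX -exprMn /threshold; lra.
- exact: cvg_cst.
- by apply: cvg_expr; rewrite ger0_norm; lra.
Qed.

(** With a = s^n, (1 - a)(1 + a) <= 1, and Bernoulli's inequality for 1 + a bounds (1 - a)^(2^n) by
    (2 s)^(-n). *)
Lemma threshold_cvg1 s : 2^-1 < s <= 1 -> threshold n s @[n --> \oo] --> (1 : R).
Proof.
move=> /andP[s0 s1].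
apply: (@squeeze_cvgr _ _ _ _ (fun n => 1 - (2 * s)^-1 ^+ n) (fun=> 1)); last exact: cvg_cst.
- apply: nearW => n.
  have s00 : 0 <= s by lra.
  have /andP[_ ->] : 0 <= threshold n s <= 1 by apply: threshold01; rewrite s00.
  rewrite andbT /threshold lerB //.
  have sn1 : s ^+ n <= 1 by rewrite exprn_ile1.
  have sn0 : 0 <= s ^+ n by rewrite exprn_ge0.
  have h := @bernoulli_ineq (s ^+ n) (2 ^ n); have {}h := h ltac:(lra).
  rewrite natrX -exprMn in h.
  rewrite exprVn -[leRHS]mul1r ler_pdivlMr ?exprn_gt0 //; last by lra.
  apply: (@le_trans _ _ ((1 - s ^+ n) ^+ (2 ^ n) * (1 + s ^+ n) ^+ (2 ^ n))).
    by apply: ler_wpM2l; [rewrite exprn_ge0 // subr_ge0|lra].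
  rewrite -exprMn exprn_ile1 //; nra.
- rewrite -[X in _ --> X]subr0; apply: cvgB; first exact: cvg_cst.
  apply: cvg_expr; rewrite ger0_norm; last by rewrite invr_ge0; lra.
  by rewrite invf_lt1; lra.
Qed.

(** A polynomial in [w] that approximates the indicator of 0 < w when |w| <= 1: the rescaling moves
    the cut from 1 / 2 to w = 0. *)
Definition positivity (w : R -> R) (n : nat) (x : R) : R := threshold n ((1 + w x) / 2).

Lemma trig_positivity w n : trig w -> trig (positivity w n).
Proof.
move=> hw; rewrite /positivity /threshold.
apply: trigB; first exact: trig_cst.
apply: trigX; apply: trigB; first exact: trig_cst.
apply: trigX.
have [s h] := trigZ 2^-1 (trigD (trig_cst 1) hw).
by exists s => x; rewrite -h mulrC.
Qed.

Lemma positivity01 w n x : `|w x| <= 1 -> 0 <= positivity w n x <= 1.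
Proof. by rewrite ler_norml => /andP[h1 h2]; apply: threshold01; apply/andP; split; lra. Qed.

Lemma positivity_cvg w x : `|w x| <= 1 -> w x != 0 ->
  positivity w n x @[n --> \oo] --> ((0 < w x)%R%:R : R).
Proof.
rewrite ler_norml => /andP[h1 h2]; rewrite neq_lt => /orP[h|h].
  rewrite ltNge ltW //=; apply: threshold_cvg0; apply/andP; split; lra.
by rewrite h; apply: threshold_cvg1; apply/andP; split; lra.
Qed.

End trigonometric_polynomials.

(** * Density of trigonometric polynomials in L^2 *)

Section trigonometric_density.
Variable R : realType.
Notation mu := (@lebesgue_measure R).
Notation m := (@circle_measure R).
Notation Lf := (Lfun m 2%:E).
Import HBNNSimple.

Lemma ae_circle_neq (c : R) : {ae m, forall x, x != c}.
Proof.
apply: ae_circle; exists [set c]; split.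
- exact: measurable_set1.
- exact: lebesgue_measure_set1.
- by move=> x /= /negP; rewrite negbK => /eqP.
Qed.

Lemma ae_circle_itv : {ae m, forall x : R, 0 <= x < 1}.
Proof.
have mI : measurable (`[0%R, 1%R[%classic : set R) by exact: measurable_itv.
exists (~` `[0%R, 1%R[%classic); split.
- exact: measurableC.
- by rewrite /circle_measure /= /mrestr setICl measure0.
- by move=> x /= h1; rewrite in_itv /=.
Qed.

Definition trig_closure (u : L2T R) := forall e, 0 < e ->
  exists2 f, trig f & `|u - to_L2 m f| < e.
Notation Cl := trig_closure.

Lemma trig_closure_lim (u_ : nat -> L2T R) (u : L2T R) : (forall n, Cl (u_ n)) ->
  u_ n @[n --> \oo] --> u -> Cl u.
Proof.
move=> hu uu e e0; have e20 : 0 < e / 2 by rewrite divr_gt0.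
move/cvgrPdist_lt : uu => /(_ _ e20) [n _ hn].
have [f tf hf] := hu n _ e20; exists f => //.
rewrite (_ : u - to_L2 m f = (u - u_ n) + (u_ n - to_L2 m f)); last by rewrite addrA subrK.
rewrite (le_lt_trans (ler_normD _ _)) // (splitr e) ltrD //.
by apply: hn => /=.
Qed.

Lemma trig_closure_trig f : trig f -> Cl (to_L2 m f).
Proof. by move=> tf e e0; exists f => //; rewrite subrr normr0. Qed.

Lemma trig_closureD u v : Cl u -> Cl v -> Cl (u + v).
Proof.
move=> hu hv e e0; have e20 : 0 < e / 2 by rewrite divr_gt0.
have [f tf hf] := hu _ e20; have [g tg hg] := hv _ e20.
exists (fun x => f x + g x); first exact: trigD.
rewrite to_L2D; [|exact: trig_Lfun|exact: trig_Lfun].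
rewrite opprD addrACA (le_lt_trans (ler_normD _ _)) // (splitr e); exact: ltrD.
Qed.

Lemma trig_closureZ a u : Cl u -> Cl (a *: u).
Proof.
move=> hu e e0; have n0 : 0 < `|a| + 1 by rewrite ltr_wpDl.
have [f tf hf] := hu (e / (`|a| + 1)) (divr_gt0 e0 n0).
exists (fun x => a * f x); first exact: trigZ.
rewrite to_L2Z; last exact: trig_Lfun.
rewrite -scalerBr normrZ.
move: hf; rewrite ltr_pdivlMr //; apply: le_lt_trans.
by rewrite mulrC ler_wpM2l // lerDl.
Qed.

Lemma trig_closureB u v : Cl u -> Cl v -> Cl (u - v).
Proof. by move=> hu hv; rewrite -scaleN1r; apply: trig_closureD => //; exact: trig_closureZ. Qed.

Lemma trig_closure_sum (I : Type) (s : seq I) (f : I -> L2T R) :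
  (forall i, Cl (f i)) -> Cl (\sum_(i <- s) f i).
Proof.
move=> hf; elim: s => [|i s IH]; last by rewrite big_cons; exact: trig_closureD.
rewrite big_nil -[0](@to_L20 _ _ _ m); apply: trig_closure_trig; exact: trig_cst.
Qed.

Lemma sin2pi_gt0 (t : R) : 0 < t < 2^-1 -> 0 < sin (2 * pi * t).
Proof.
move=> /andP[t0 t1]; apply: sin_gt0_pi; have := pi_gt0 R; move: pi => q q0.
by apply/andP; split; nra.
Qed.

Lemma sin2pi_lt0 (t : R) : 2^-1 < t < 1 -> sin (2 * pi * t) < 0.
Proof.
move=> /andP[t0 t1].
have -> : 2 * pi * t = 2 * pi * (t - 2^-1) + pi / 2 + pi / 2.
  by move: pi => q; field.
rewrite sinDpihalf cosDpihalf oppr_lt0; apply: sin2pi_gt0.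
by apply/andP; split; lra.
Qed.

(** The range covers [a - x] for [a] and [x] in ]0, 1[; the signs for negative t follow from
    oddness. *)
Lemma sin2pi_sign (t : R) : -1 < t < 1 -> t != 0 -> t != 2^-1 -> t != - 2^-1 ->
  sin (2 * pi * t) != 0 /\
  (0 < sin (2 * pi * t)) = ((0 < t) && (t < 2^-1)) || (t < - 2^-1).
Proof.
move=> /andP[t0 t1] n0 n1 n2.
have opp : sin (2 * pi * t) = - sin (2 * pi * (- t)) by rewrite mulrN sinN opprK.
case: (ltgtP t 0) n0 => // [tn|tp] _.
  case: (ltgtP t (- 2^-1)) n2 => // [tl|tg] _.
    have h : sin (2 * pi * (- t)) < 0 by apply: sin2pi_lt0; apply/andP; split; lra.
    by rewrite orbT opp oppr_gt0 oppr_eq0 lt_eqF.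
  have h : 0 < sin (2 * pi * (- t)) by apply: sin2pi_gt0; apply/andP; split; lra.
  by rewrite opp oppr_gt0 oppr_eq0 gt_eqF //= ltNge ltW.
have -> : (t < - 2^-1) = false by apply/negbTE; rewrite -leNgt; lra.
rewrite orbF; case: (ltgtP t (2^-1)) n1 => // [tl|tg] _.
  have h : 0 < sin (2 * pi * t) by apply: sin2pi_gt0; apply/andP; split; lra.
  by rewrite h gt_eqF.
have h : sin (2 * pi * t) < 0 by apply: sin2pi_lt0; apply/andP; split; lra.
by rewrite lt_eqF // ltNge ltW.
Qed.

(* [h] and [s] are the positivity of [sin (2 * pi * x)] and of
   [sin (2 * pi * (a - x))]. *)
Lemma ray_indicator (a x : R) (h : bool := (x < 2^-1)%R)
    (s : bool := (((0 < a - x) && (a - x < 2^-1)) || (a - x < - 2^-1))%R) :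
  0 < a < 1 -> 0 < x < 1 -> x != a ->
  (x < a)%R%:R = (if a <= 2^-1 then h%:R * s%:R else h%:R + s%:R - h%:R * s%:R) :> R.
Proof.
move=> /andP[a0 a1] /andP[x0 x1]; rewrite neq_lt /h /s => {h s}/orP[xa|xa].
- rewrite xa subr_gt0 xa /=; case: (leP a 2^-1) => ha.
    have -> : (x < 2^-1) = true by apply/idP; lra.
    have -> : (a - x < 2^-1) = true by apply/idP; lra.
    by rewrite mulr1.
  case: (ltP x 2^-1) => xh; first by rewrite mul1r addrK.
  have -> : (a - x < 2^-1) = true by apply/idP; lra.
  by rewrite mul0r add0r subr0.
have -> : (x < a) = false by rewrite ltNge ltW.
have -> : (0 < a - x) = false by rewrite subr_gt0 ltNge ltW.
case: (leP a 2^-1) => ha /=.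
  case: (ltP x 2^-1) => xh; last by rewrite mul0r.
  have -> : (a - x < - 2^-1) = false by rewrite ltNge; apply/negbF; lra.
  by rewrite mulr0.
have -> : (a - x < - 2^-1) = false by rewrite ltNge; apply/negbF; lra.
have -> : (x < 2^-1) = false by rewrite ltNge; apply/negbF; lra.
by rewrite mul0r add0r subr0.
Qed.

Lemma ray_Lfun (a : R) : (fun x : R => (x < a)%R%:R : R) \in Lf.
Proof.
apply: (bounded_Lfun2 (B := 1)); last first.
  by move=> x; case: (x < a); rewrite ?normr1 ?normr0 ?ler01.
rewrite (_ : (fun x => _) = \1_(`]-oo, a[)); first exact: measurable_indic.
by apply/funext => x; rewrite indicE; congr (_%:R); rewrite mem_setE in_itv.
Qed.

(** Modulo 1, the interval ]0, a[ is the intersection of the half circles ]0, 1/2[ and ]a - 1/2, a[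
    if a <= 1/2, and their union otherwise. Each half circle is the positivity set of a wave of
    frequency one. *)
Lemma trig_closure_ray0 a : 0 < a < 1 -> Cl (to_L2 m (fun x => (x < a)%R%:R)).
Proof.
move=> /andP[a0 a1].
pose w1 : R -> R := wave 1 (- (pi / 2)).
pose w2 : R -> R := wave 1 (pi / 2 - 2 * pi * a).
have w1E x : w1 x = sin (2 * pi * x) by rewrite /w1 /wave mulr1 cosBpihalf.
have w2E x : w2 x = sin (2 * pi * (a - x)).
  rewrite /w2 /wave mulr1 (_ : _ + _ = 2 * pi * (x - a) + pi / 2); last by move: pi => q; ring.
  by rewrite cosDpihalf -sinN; congr sin; ring.
pose p1 n x := positivity w1 n x; pose p2 n x := positivity w2 n x.
pose f n x := if a <= 2^-1 then p1 n x * p2 n x else p1 n x + p2 n x - p1 n x * p2 n x.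
have tp1 n : trig (p1 n) by apply: trig_positivity; exact: trig_wave.
have tp2 n : trig (p2 n) by apply: trig_positivity; exact: trig_wave.
have tf n : trig (f n).
  by rewrite /f; case: (a <= _); [exact: trigM|apply: trigB; [exact: trigD|exact: trigM]].
have h1 n x : 0 <= p1 n x <= 1 by apply: positivity01; exact: wave_bound.
have h2 n x : 0 <= p2 n x <= 1 by apply: positivity01; exact: wave_bound.
have ml := Lfun2_measurable (ray_Lfun a).
have fle : {ae m, forall x, forall n, `|f n x| <= cst 1 x}.
  apply: aeW => x n /=; have /andP[? ?] := h1 n x; have /andP[? ?] := h2 n x.
  by rewrite /f; case: (a <= _); rewrite ler_norml; apply/andP; split; nra.
suff fcv : {ae m, forall x, f n x @[n --> \oo] --> ((x < a)%R%:R : R)}.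
  have [_ _ cv] := L2_dominated_cvg (fun n => Lfun2_measurable (trig_Lfun (tf n))) ml
    (trig_Lfun (trig_cst 1)) fcv fle.
  by apply: (trig_closure_lim _ cv) => n; exact: trig_closure_trig.
(* The points left out are the zeros of the two sines, where the thresholds need not converge to the
   indicators. *)
apply: (ae_imp3 (ae_imp2 ae_circle_itv (ae_circle_neq 0) (fun x => @conj _ _))
  (ae_imp2 (ae_circle_neq 2^-1) (ae_circle_neq a) (fun x => @conj _ _))
  (ae_imp2 (ae_circle_neq (a - 2^-1)) (ae_circle_neq (a + 2^-1)) (fun x => @conj _ _))).
move=> x [/andP[x0 x1] xn0] [xn1 xna] [xn2 xn3].
have {}x0 : 0 < x by rewrite lt_neqAle eq_sym xn0.
have [n1 s1] : sin (2 * pi * x) != 0 /\ (0 < sin (2 * pi * x)) = ((0 < x) && (x < 2^-1)) || (x < - 2^-1).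
  apply: sin2pi_sign => //; first by apply/andP; split; lra.
  by rewrite gt_eqF //; lra.
have [n2 s2] : sin (2 * pi * (a - x)) != 0 /\
    (0 < sin (2 * pi * (a - x))) = ((0 < a - x) && (a - x < 2^-1)) || (a - x < - 2^-1).
  apply: sin2pi_sign; first by apply/andP; split; lra.
  - by rewrite subr_eq0 eq_sym.
  - by apply: contra xn2 => /eqP h; apply/eqP; lra.
  - by apply: contra xn3 => /eqP h; apply/eqP; lra.
have c1 : p1 n x @[n --> \oo] --> ((x < 2^-1)%R%:R : R).
  have := @positivity_cvg R w1 x (wave_bound _ _ _); rewrite w1E s1 x0 /=.
  by rewrite (_ : (x < - 2^-1) = false) ?orbF; [exact|apply/negbTE; rewrite -leNgt; lra].
have c2 : p2 n x @[n --> \oo] -->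
    ((((0 < a - x) && (a - x < 2^-1)) || (a - x < - 2^-1))%R%:R : R).
  by have := @positivity_cvg R w2 x (wave_bound _ _ _); rewrite w2E s2; exact.
rewrite /f (ray_indicator (introT andP (conj a0 a1)) (introT andP (conj x0 x1)) xna).
by case: (a <= _); [exact: cvgM|apply: cvgB; [exact: cvgD|exact: cvgM]].
Qed.

Lemma trig_closure_ray a : Cl (to_L2 m (fun x => (x < a)%R%:R)).
Proof.
have hl := ray_Lfun a.
have [a0|a0] := leP a 0.
  rewrite (to_L2_ae hl (trig_Lfun (trig_cst 0))); first exact/trig_closure_trig/trig_cst.
  by apply: (ae_imp ae_circle_itv) => x /andP[x0 x1]; rewrite ltNge (le_trans a0 x0).
have [a1|a1] := leP 1 a.
  rewrite (to_L2_ae hl (trig_Lfun (trig_cst 1))); first exact/trig_closure_trig/trig_cst.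
  by apply: (ae_imp ae_circle_itv) => x /andP[x0 x1]; rewrite (lt_le_trans x1 a1).
by apply: trig_closure_ray0; rewrite a0 a1.
Qed.

Lemma indic_Lfun (A : set R) : measurable A -> (\1_A : R -> R) \in Lf.
Proof.
move=> mA; apply: (bounded_Lfun2 (B := 1)); first exact: measurable_indic.
by move=> x; rewrite indicE; case: (_ \in _); rewrite ?normr1 ?normr0 ?ler01.
Qed.

(** Dynkin's theorem: the sets whose indicator lies in the closure are stable under complements and
    countable disjoint unions, and they contain the rays [x, +oo[, which are stable under
    intersection and generate the Borel sets. *)
Lemma trig_closure_indic (A : set R) : measurable A -> Cl (to_L2 m (\1_A : R -> R)).
Proof.
have one : Cl (to_L2 m (fun=> 1)) by exact/trig_closure_trig/trig_cst.
have onef := trig_Lfun (trig_cst (1 : R)).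
move=> mA; have {}mA : (@RGenCInfty.G R).-sigma.-measurable A.
  by rewrite -RGenCInfty.measurableE.
move: A mA; apply: (@dynkin_induction _ (measurableTypeR R) (@RGenCInfty.G R) (fun A => Cl (to_L2 m (\1_A : R -> R)))).
- exact: RGenCInfty.measurableE.
- move=> _ _ [x ->] [y ->]; exists (Num.max x y).
  by apply/seteqP; split => z /=; rewrite !in_itv /= !andbT ge_max; [move=> [-> ->]|move=> /andP[]].
- by rewrite indicT.
- move=> _ [x ->].
  rewrite (_ : \1_ _ = (fun z => 1 - (z < x)%R%:R)).
    rewrite to_L2B //; last exact: ray_Lfun.
    by apply: trig_closureB => //; exact: trig_closure_ray.
  apply/funext => z; rewrite indicE mem_setE in_itv /= andbT.
  by case: ltP => _; rewrite ?subr0 ?subrr.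
- move=> S mS hS; rewrite (_ : \1_ _ = (fun z => 1 - \1_S z)).
    by rewrite to_L2B //; [exact: trig_closureB|exact: indic_Lfun].
  by apply/funext => z; rewrite !indicE in_setC; case: (z \in S); rewrite ?subr0 ?subrr.
- move=> F mF tF hF.
  (* The finite partial unions: by disjointness their indicators are sums, and they converge
     pointwise under the bound 1. *)
  pose U n := [set x | exists2 k, (k < n)%N & F k x].
  have US n : U n.+1 = U n `|` F n.
    apply/seteqP; split => x /=.
      by move=> [k]; rewrite ltnS leq_eqVlt => /orP[/eqP -> ?|kn ?]; [right|left; exists k].
    by move=> [[k kn ?]|?]; [exists k => //; exact: ltnW|exists n].
  have mU n : measurable (U n).
    elim: n => [|n IH]; last by rewrite US; exact: measurableU.
    by rewrite (_ : U 0%N = set0) //; apply/seteqP; split => // x [].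
  have UE n : (\1_(U n.+1) : R -> R) = (fun x => \1_(U n) x + \1_(F n) x).
    apply/funext => x; rewrite US !indicE in_setU.
    case: (boolP (x \in F n)) => xF; rewrite ?orbF ?addr0 // orbT.
    case: (boolP (x \in U n)) => [|_]; last by rewrite add0r.
    rewrite inE => -[k kn Fk]; move: xF; rewrite inE => Fn.
    have := tF k n I I (ex_intro _ x (conj Fk Fn)) => kE.
    by move: kn; rewrite kE ltnn.
  have clU n : Cl (to_L2 m (\1_(U n) : R -> R)).
    elim: n => [|n IH]; last first.
      rewrite UE to_L2D; [|exact: indic_Lfun (mU n)|exact: indic_Lfun (mF n)].
      exact: trig_closureD IH (hF n).
    rewrite (_ : \1_ _ = fun=> 0); first exact/trig_closure_trig/trig_cst.
    by apply/funext => x; rewrite indicE memNset // => -[].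
  have mUU : measurable (\bigcup_k F k) by exact: bigcup_measurable.
  have Ule : {ae m, forall x, forall n, `|\1_(U n) x| <= cst (1 : R) x}.
    by apply: aeW => x n /=; rewrite indicE; case: (_ \in _); rewrite ?normr1 ?normr0 ?ler01.
  suff Ucv : {ae m, forall x, \1_(U n) x @[n --> \oo] --> (\1_(\bigcup_k F k) x : R)}.
    have [_ _ cv] := L2_dominated_cvg (fun n => measurable_indic (mU n)) (measurable_indic mUU)
      onef Ucv Ule.
    by apply: (trig_closure_lim _ cv) => n; exact: clU.
  apply: aeW => x; rewrite [X in _ --> X]indicE.
  case: (boolP (x \in \bigcup_k F k)) => [|xF].
    rewrite inE => -[j _ Fj]; apply: cvg_near_cst; exists j.+1 => // n /= jn.
    by rewrite indicE mem_set //; exists j.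
  apply: cvg_near_cst; apply: nearW => n; rewrite indicE memNset // => -[k kn Fk].
  by move: xF; rewrite notin_setE; apply; exists k.
Qed.

Lemma trig_closure_ge0 (f : R -> R) : f \in Lf -> (forall x, 0 <= f x) -> Cl (to_L2 m f).
Proof.
move=> hf f0; have mf := Lfun2_measurable hf.
have mEf : measurable_fun setT (EFin \o f) by exact/measurable_EFinP.
pose s := nnsfun_approx measurableT mEf.
have s_f x : s n x @[n --> \oo] --> f x.
  have h : (s n x)%:E @[n --> \oo] --> (f x)%:E.
    by apply: (@cvg_nnsfun_approx _ _ _ _ measurableT _ mEf) => // y _; rewrite lee_fin.
  by move/fine_cvgP : h => [].
have s_nd x : nondecreasing_seq (fun n => s n x).
  by move=> n k nk; have /lefP := nd_nnsfun_approx measurableT mEf nk; exact.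
have s_le n x : `|s n x| <= f x.
  rewrite ger0_norm // -(cvg_lim _ (s_f x)) //.
  by apply: nondecreasing_cvgn_le => //; exact: cvgP (s_f x).
have ms n : measurable_fun setT (s n) by [].
have ae_cvg : {ae m, forall x : R, s n x @[n --> \oo] --> f x} by exact: aeW.
have ae_le : {ae m, forall x : R, forall n, `|s n x| <= f x} by exact: aeW.
have [_ _ cv] := @L2_dominated_cvg _ _ R m (fun n => s n) f f ms mf hf ae_cvg ae_le.
apply: (trig_closure_lim _ cv) => n.
pose A r := s n @^-1` [set r].
have mA r : measurable (A r).
  by rewrite -[A r]setTI; apply: (ms n) => //; exact: measurable_set1.
have hA r : (fun x => r * \1_(A r) x) \in Lf by apply: Lfun2Z; exact: indic_Lfun.
have -> : (s n : R -> R) = fun x => \sum_(r <- finmap.enum_fset (fset_set (range (s n)))) r * \1_(A r) x.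
  by apply/funext => x; rewrite fimfunE fsbig_finite.
have [_ ->] := to_L2_sum (finmap.enum_fset (fset_set (range (s n)))) hA.
apply: trig_closure_sum => r; rewrite to_L2Z; last exact: indic_Lfun.
by apply: trig_closureZ; exact: trig_closure_indic.
Qed.

Lemma trig_dense (u : L2T R) e : 0 < e -> exists2 f, trig f & `|u - to_L2 m f| < e.
Proof.
move: e; suff : Cl u by [].
have hu := L2_Lfun u; have mu_ := Lfun2_measurable hu.
have habs : (fun x => `|u x|) \in Lf := (L2_abs u).1.
have hp : (u : R -> R)^\+ \in Lf.
  apply: (Lfun2_le (measurable_funrpos mu_) habs); apply: aeW => x.
  rewrite ger0_norm ?funrpos_ge0 // /funrpos.
  by case: (leP (u x) 0) => _; rewrite ?normr_ge0 ?ler_norm.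
have hn : (u : R -> R)^\- \in Lf.
  apply: (Lfun2_le (measurable_funrneg mu_) habs); apply: aeW => x.
  rewrite ger0_norm ?funrneg_ge0 // /funrneg.
  by case: (leP (- u x) 0) => _; rewrite ?normr_ge0 // -normrN ler_norm.
have -> : u = to_L2 m (u : R -> R)^\+ - to_L2 m (u : R -> R)^\-.
  rewrite -to_L2B // -[LHS]to_L2K; congr to_L2; apply/funext => x.
  by rewrite -[in LHS](funrposBneg (u : R -> R)).
by apply: trig_closureB; apply: trig_closure_ge0.
Qed.

End trigonometric_density.

(** * Integration by parts on the circle and weak derivatives *)

Section circle_calculus.
Variable R : realType.
Notation mu := (@lebesgue_measure R).
Notation m := (@circle_measure R).
Notation Lf := (Lfun m 2%:E).

Lemma is_derive_continuous (F F' : R -> R) : (forall x : R, is_derive x (1 : R) F (F' x)) -> continuous F.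
Proof.
move=> dF x; apply: differentiable_continuous; apply/derivable1_diffP.
exact: (@ex_derive _ _ _ _ _ _ _ (dF x)).
Qed.

Lemma circle_integral_derivative (F F' : R -> R) : (forall x : R, is_derive x (1 : R) F (F' x)) ->
  continuous F' -> (forall x, F (x + 1) = F x) -> \int[m]_x F' x = 0.
Proof.
move=> dF cF' F1; have cF := is_derive_continuous dF.
have mF' : measurable_fun setT F' by exact: continuous_measurable_fun.
rewrite /Rintegral integral_circle; last exact/measurable_EFinP.
rewrite integral_itv_bndo_bndc; last by apply/measurable_EFinP; exact: measurable_funTS.
rewrite (@continuous_FTC2 _ F' F 0 1) //.
- by rewrite -EFinB /= -[X in F X]add0r F1 subrr.
- by apply: continuous_subspaceT.
- split.
  + by move=> x _; exact: (@ex_derive _ _ _ _ _ _ _ (dF x)).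
  + by apply: cvg_at_right_filter; exact: cF.
  + by apply: cvg_at_left_filter; exact: cF.
- by move=> x _; rewrite derive1E; exact: (@derive_val _ _ _ _ _ _ _ (dF x)).
Qed.

Lemma periodic_bounded (f : R -> R) : continuous f -> (forall x, f (x + 1) = f x) ->
  exists B, forall x, `|f x| <= B.
Proof.
move=> cf f1.
have [c _ hc] : exists2 c, c \in `[0%R, 1%R] & forall t, t \in `[0%R, 1%R] -> `|f t| <= `|f c|.
  apply: (@EVT_max R (fun x => `|f x|) 0 1) => //.
  by apply: continuous_subspaceT => x; apply: cvg_norm; exact: cf.
exists `|f c| => x.
rewrite -(subrK (Num.floor x)%:~R x) periodic_int //; apply: hc.
rewrite in_itv /= subr_ge0 ge_floor /= lerBlDr addrC -intrD1.
by apply: ltW; exact: floorD1_gt.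
Qed.

Lemma periodic_Lfun (f : R -> R) : continuous f -> (forall x, f (x + 1) = f x) -> f \in Lf.
Proof.
move=> cf f1; have [B hB] := periodic_bounded cf f1.
by apply: bounded_Lfun2 hB; exact: continuous_measurable_fun.
Qed.

Lemma circle_by_parts (f f' g g' : R -> R) :
  (forall x : R, is_derive x (1 : R) f (f' x)) -> (forall x : R, is_derive x (1 : R) g (g' x)) ->
  continuous f' -> continuous g' -> (forall x, f (x + 1) = f x) -> (forall x, g (x + 1) = g x) ->
  (forall x, f' (x + 1) = f' x) -> (forall x, g' (x + 1) = g' x) ->
  ip m f g' = - ip m f' g.
Proof.
move=> df dg cf' cg' f1 g1 f'1 g'1.
have cf := is_derive_continuous df; have cg := is_derive_continuous dg.
have := @circle_integral_derivative (fun x => f x * g x) (fun x => f x * g' x + f' x * g x) _ _ _.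
have h1 : forall x : R, is_derive x (1 : R) (fun x => f x * g x) (f x * g' x + f' x * g x).
  move=> x; have := is_deriveM (df x) (dg x).
  by rewrite /GRing.scale /= [g x * _]mulrC; exact.
move=> /(_ h1) h; apply/eqP; rewrite -addr_eq0; apply/eqP.
rewrite /ip -RintegralD //; last 2 first.
- by apply: Lfun2_mul; apply: periodic_Lfun.
- by apply: Lfun2_mul; apply: periodic_Lfun.
apply: h.
- move=> x; apply: cvgD; apply: cvgM; [exact: cf|exact: cg'|exact: cf'|exact: cg].
- by move=> x; rewrite f1 g1.
Qed.

Lemma is_derive_shift (g g' : R -> R) : (forall x : R, is_derive x (1 : R) g (g' x)) ->
  forall x : R, is_derive x (1 : R) (fun y => g (y + 1)) (g' (x + 1)).
Proof.
move=> dg x.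
have h := @is_derive1_comp R g (fun y => y + 1) x (g' (x + 1)) 1 (dg (x + 1)).
rewrite -[X in is_derive _ _ _ X]mulr1; apply: h.
by apply: is_derive_eq; rewrite addr0.
Qed.

Lemma periodic_smooth_is_derive (phi : R -> R) k : periodic_smooth phi ->
  forall x : R, is_derive x (1 : R) (derive1n k phi) (derive1n k.+1 phi x).
Proof.
move=> [_ sm] x; have := derivableP (sm k x).
by rewrite derive1nS derive1E.
Qed.

(** The definition asks periodicity of [phi] itself; the derivatives inherit it by differentiating
    the shifted function. *)
Lemma periodic_smooth_periodic (phi : R -> R) k : periodic_smooth phi ->
  forall x, derive1n k phi (x + 1) = derive1n k phi x.
Proof.
move=> hphi; elim: k => [|k IH] x; first by case: hphi => h _; exact: h.
have h1 := periodic_smooth_is_derive k hphi.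
have h2 := is_derive_shift h1 x.
have e : (fun y : R => derive1n k phi (y + 1)) = derive1n k phi by exact/funext.
rewrite e in h2.
by rewrite -(@derive_val _ _ _ _ _ _ _ (h1 x)) -(@derive_val _ _ _ _ _ _ _ h2).
Qed.

Lemma periodic_smooth_continuous (phi : R -> R) k : periodic_smooth phi -> continuous (derive1n k phi).
Proof. by move=> hphi; apply: is_derive_continuous; exact: periodic_smooth_is_derive. Qed.

Lemma periodic_smooth_Lfun (phi : R -> R) k : periodic_smooth phi -> derive1n k phi \in Lf.
Proof.
move=> hphi; apply: periodic_Lfun; first exact: periodic_smooth_continuous.
exact: periodic_smooth_periodic.
Qed.

Definition tder (s : seq (R * (nat * R))) : seq (R * (nat * R)) :=
  [seq (t.1 * (2 * pi * t.2.1%:R), (t.2.1, t.2.2 + pi / 2)) | t <- s].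

Lemma is_derive_tpoly s (x : R) : is_derive x (1 : R) (tpoly s) (tpoly (tder s) x).
Proof.
elim: s => [|t s IH].
  rewrite (_ : tpoly [::] = cst 0); last by apply/funext => y; rewrite /tpoly big_nil.
  exact: is_derive_cst.
rewrite (_ : tpoly (t :: s) = (fun x => t.1 * wave t.2.1 t.2.2 x) + tpoly s); last first.
  by apply/funext => y; rewrite tpoly_cons.
rewrite /= tpoly_cons /=; apply: is_deriveD.
have h := is_derive_wave t.2.1 t.2.2 x.
have := @is_deriveZ _ _ _ _ t.1 _ _ _ h.
by rewrite /GRing.scale /= -[in X in _ -> X]mulrA; exact.
Qed.

Lemma tpoly_periodic s (x : R) : tpoly s (x + 1) = tpoly s x.
Proof. by apply: eq_bigr => t _; rewrite wave_periodic. Qed.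

Lemma derive1n_tpoly (s : seq (R * (nat * R))) k : derive1n k (tpoly s) = tpoly (iter k tder s).
Proof.
elim: k => [//|k IH]; rewrite derive1nS IH; apply/funext => x.
by rewrite derive1E; exact: (@derive_val _ _ _ _ _ _ _ (is_derive_tpoly _ x)).
Qed.

Lemma tpoly_smooth (s : seq (R * (nat * R))) : periodic_smooth (tpoly s).
Proof.
split; first exact: tpoly_periodic.
by move=> k x; rewrite derive1n_tpoly; exact: (@ex_derive _ _ _ _ _ _ _ (is_derive_tpoly _ x)).
Qed.

Lemma tpoly_continuous (s : seq (R * (nat * R))) : continuous (tpoly s).
Proof. exact: is_derive_continuous (is_derive_tpoly s). Qed.

Lemma tpoly_by_parts s (phi : R -> R) k : periodic_smooth phi ->
  ip m (tpoly s) (derive1n k phi) = (-1) ^+ k * ip m (tpoly (iter k tder s)) phi.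
Proof.
move=> hphi; elim: k s => [|k IH] s; first by rewrite expr0 mul1r.
have -> : ip m (tpoly s) (derive1n k.+1 phi) = - ip m (tpoly (tder s)) (derive1n k phi).
  apply: circle_by_parts.
  - exact: is_derive_tpoly.
  - exact: periodic_smooth_is_derive.
  - exact: tpoly_continuous.
  - exact: periodic_smooth_continuous.
  - exact: tpoly_periodic.
  - exact: periodic_smooth_periodic.
  - exact: tpoly_periodic.
  - exact: periodic_smooth_periodic.
by rewrite IH iterSr exprS mulN1r mulNr.
Qed.

Lemma ip_linear a (w w' : L2T R) (f : R -> R) : f \in Lf ->
  ip m (a *: w + w' : L2T R) f = a * ip m w f + ip m w' f.
Proof.
move=> hf; rewrite (@ip_ae _ _ _ m _ (fun x => a * w x + w' x) f f) ?L2_Lfun //.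
- by rewrite ipDl ?ipZl ?Lfun2Z ?L2_Lfun.
- by apply: Lfun2D; [apply: Lfun2Z|]; exact: L2_Lfun.
- by apply: (ae_imp2 (L2_addE (a *: w) w') (L2_scaleE a w)) => x -> ->.
- exact: aeW.
Qed.

Lemma ip_to_L2 (f g : R -> R) : f \in Lf -> g \in Lf -> ip m (to_L2 m f) g = ip m f g.
Proof.
move=> hf hg; rewrite (@ip_ae _ _ _ m (to_L2 m f) f g g) ?L2_Lfun //; first exact: to_L2E.
exact: aeW.
Qed.

Lemma tpoly_weak_derivative (s : seq (R * (nat * R))) k :
  is_weak_derivative k (to_L2 m (tpoly s)) (to_L2 m (tpoly (iter k tder s))).
Proof.
move=> phi hphi.
have hk := periodic_smooth_Lfun k hphi; have h0 := periodic_smooth_Lfun 0 hphi.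
have hs (s' : seq (R * (nat * R))) := tpoly_Lfun s'.
rewrite -/(ip m (to_L2 m (tpoly s)) (derive1n k phi)) -/(ip m (to_L2 m (tpoly (iter k tder s))) phi).
rewrite !ip_to_L2 //; exact: tpoly_by_parts.
Qed.

(** For f a trigonometric polynomial, |w|^2 = <w, w - f> <= |w| |w - f|, and density makes the last
    factor small. As these polynomials are themselves test functions, weak derivatives are
    unique. *)
Lemma ip_tpoly_eq0 (w : L2T R) : (forall s, ip m w (tpoly s) = 0) -> w = 0.
Proof.
move=> hw; apply/eqP; rewrite -normr_le0; apply/ler_addgt0Pl => e e0; rewrite addr0.
have [f [s fs] hf] := trig_dense w e0.
have {}fs : f = tpoly s by exact/funext.
have hs := tpoly_Lfun s.
have [->|w0] := eqVneq w 0; first by rewrite normr0 ltW.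
have nw : 0 < `|w| by rewrite normr_gt0.
rewrite -(ler_pM2l nw) -expr2 -ip_norm.
have -> : ip m w w = ip m w (w - to_L2 m f : L2T R).
  rewrite [RHS]ipC addrC -scaleN1r ip_linear; last exact: L2_Lfun.
  rewrite fs ip_to_L2; [|exact: hs|exact: L2_Lfun].
  by rewrite [X in -1 * X]ipC hw mulr0 add0r.
apply: (le_trans (ler_norm _)); apply: (le_trans (cauchy_schwarz _ _)).
by rewrite ler_wpM2l // ltW.
Qed.

Lemma weak_derivative_unique k (u v v' : L2T R) :
  is_weak_derivative k u v -> is_weak_derivative k u v' -> v = v'.
Proof.
move=> hv hv'; apply/eqP; rewrite -subr_eq0; apply/eqP; apply: ip_tpoly_eq0 => s.
have hs := tpoly_Lfun s.
have e : ip m v (tpoly s) = ip m v' (tpoly s).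
  have := hv _ (tpoly_smooth s); rewrite (hv' _ (tpoly_smooth s)).
  move=> e; apply: (@mulfI _ ((-1) ^+ k : R)); first by rewrite signr_eq0.
  by rewrite /ip -e.
by rewrite addrC -scaleN1r ip_linear // e mulN1r addNr.
Qed.

Lemma weak_derivativeE k (u v : L2T R) : is_weak_derivative k u v -> weak_derivative k u = v.
Proof.
move=> hv; rewrite /weak_derivative.
case: xgetP => [y _ hy|/(_ v) //]; exact: weak_derivative_unique hy hv.
Qed.

Lemma weak_derivativeD k a (u v u' v' : L2T R) :
  is_weak_derivative k u v -> is_weak_derivative k u' v' ->
  is_weak_derivative k (a *: u + u') (a *: v + v').
Proof.
move=> h h' phi hphi.
have hk := periodic_smooth_Lfun k hphi; have h0 := periodic_smooth_Lfun 0 hphi.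
have := h _ hphi; have := h' _ hphi.
rewrite -!/(ip m _ _) !ip_linear // => -> ->; ring.
Qed.

End circle_calculus.

(** * Fourier truncation and best approximation *)

Section fourier_projection.
Variable R : realType.
Notation m := (@circle_measure R).
Notation Lf := (Lfun m 2%:E).

Lemma wave_mean k (a : R) : \int[m]_x wave k a x = if k == 0%N then cos a else 0.
Proof.
case: eqP => [->|/eqP k0].
  have -> : wave 0 a = fun=> cos a by apply/funext => x; rewrite /wave !mulr0 mul0r add0r.
  by rewrite Rintegral_cst //= circle_measureT mulr1.
have kk : 2 * pi * k%:R != 0 :> R by rewrite gt_eqF // !mulr_gt0 ?pi_gt0 // ltr0n lt0n.
pose F := (2 * pi * k%:R)^-1 *: wave k (a - pi / 2).
have dF (x : R) : is_derive x (1 : R) F (wave k a x).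
  have := @is_deriveZ _ _ _ _ (2 * pi * k%:R)^-1 _ _ _ (is_derive_wave k (a - pi / 2) x).
  by rewrite /GRing.scale /= subrK mulrA mulVf // mul1r.
apply: (circle_integral_derivative dF).
- exact: is_derive_continuous (is_derive_wave k a).
- by move=> x; rewrite /F /= /GRing.scale /= wave_periodic.
Qed.

Lemma ip_wave k l (a b : R) : ip m (wave k a) (wave l b) =
  2^-1 * (if (k + l == 0)%N then cos (a + b) else 0) +
  2^-1 * (if k == l then cos (b - a) else 0).
Proof.
rewrite /ip; under eq_Rintegral do rewrite waveM.
have iw d j c : m.-integrable setT (EFin \o (fun x => d * wave j c x)).
  have h1 : (fun=> d) \in Lf by apply: (@bounded_Lfun2 _ _ `|d|).
  exact: Lfun2_mul h1 (wave_Lfun j c).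
have iw1 j c : m.-integrable setT (EFin \o wave j c).
  by rewrite (_ : wave j c = fun x => 1 * wave j c x) //; apply/funext => x; rewrite mul1r.
rewrite RintegralD // !RintegralZl //.
rewrite !wave_mean; congr (_ + _ * _).
have -> : (maxn k l - minn k l == 0)%N = (k == l).
  by rewrite subn_eq0 geq_max leq_min leqnn /= leq_min leqnn andbT eqn_leq andbC.
by case: eqP => // ->; rewrite leqnn.
Qed.

Lemma ip_wave_neq k l (a b : R) : k != l -> ip m (wave k a) (wave l b) = 0.
Proof.
move=> kl; rewrite ip_wave (negPf kl) ifF ?mulr0 ?addr0 //.
by apply/negbTE; apply: contraNN kl; rewrite addn_eq0 => /andP[/eqP-> /eqP->].
Qed.

Lemma ip_tpoly s (f : R -> R) : f \in Lf ->
  ip m (tpoly s) f = \sum_(t <- s) t.1 * ip m (wave t.2.1 t.2.2) f.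
Proof.
move=> hf; elim: s => [|t s IH].
  rewrite big_nil /ip; under eq_Rintegral do rewrite /tpoly big_nil mul0r.
  by rewrite Rintegral_cst // mul0r.
rewrite big_cons -IH -ipZl ?wave_Lfun // -ipDl ?tpoly_Lfun //; last first.
  by apply: Lfun2Z; exact: wave_Lfun.
by congr (ip m _ f); apply/funext => x; rewrite tpoly_cons.
Qed.

Definition freq_lt N (s : seq (R * (nat * R))) := all (fun t => t.2.1 < N)%N s.

Lemma ip_tpoly_wave_ge N s l (b : R) : freq_lt N s -> (N <= l)%N ->
  ip m (tpoly s) (wave l b) = 0.
Proof.
move=> /allP hs Nl; rewrite ip_tpoly ?wave_Lfun // big_seq big1 // => t ts.
by rewrite ip_wave_neq ?mulr0 // neq_ltn (leq_trans (hs _ ts)).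
Qed.

Lemma waveE k (a x : R) : wave k a x = cos a * wave k 0 x + sin a * wave k (pi / 2) x.
Proof.
rewrite /wave addr0 cosD cosDpihalf; ring.
Qed.

(** Frequencies are added one at a time: by orthogonality the new mode leaves the lower pairings
    intact, and the old part does not pair with frequency [N]. By [waveE], matching the phases 0 and
    pi / 2 matches every phase. *)
Lemma truncation_exists N (u : L2T R) : exists2 s, freq_lt N s &
  forall l b, (l < N)%N -> ip m (tpoly s) (wave l b) = ip m u (wave l b).
Proof.
elim: N => [|N [s hs IH]]; first by exists [::].
(* The inverse of the mean square of a mode of frequency [N]. *)
pose c : R := if N == 0%N then 1 else 2.
pose q : seq (R * (nat * R)) := [:: (c * ip m u (wave N 0), (N, 0));
   (c * ip m u (wave N (pi / 2)), (N, pi / 2))].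
have uE b : ip m u (wave N b) = cos b * ip m u (wave N 0) + sin b * ip m u (wave N (pi / 2)).
  rewrite ![ip m u _]ipC -!ipZl ?wave_Lfun ?L2_Lfun // -ipDl ?L2_Lfun //; last 2 first.
  - by apply: Lfun2Z; exact: wave_Lfun.
  - by apply: Lfun2Z; exact: wave_Lfun.
  by congr (ip m _ _); apply/funext => x; exact: waveE.
exists (s ++ q).
  rewrite /freq_lt all_cat /= ltnSn !andbT; apply: sub_all hs => t; exact: ltnW.
move=> l b lN.
have -> : tpoly (s ++ q) = fun x => tpoly s x + tpoly q x by apply/funext => x; rewrite tpoly_cat.
rewrite ipDl ?tpoly_Lfun ?wave_Lfun // [ip m (tpoly q) _]ip_tpoly ?wave_Lfun //.
rewrite !big_cons big_nil /= addr0.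
move: lN; rewrite ltnS leq_eqVlt => /predU1P[->|lN]; last first.
  by rewrite IH // !ip_wave_neq ?mulr0 ?addr0 // neq_ltn lN orbT.
rewrite (ip_tpoly_wave_ge _ hs) // add0r (uE b) !ip_wave eqxx addnn double_eq0 /c.
case: eqP => [N0|_].
  (* At frequency 0 the mode of phase pi / 2 is the zero function. *)
  have -> : ip m u (wave N (pi / 2)) = 0.
    rewrite /ip N0; under eq_Rintegral do rewrite /wave !mulr0 mul0r add0r cos_pihalf mulr0.
    by rewrite Rintegral_cst // mul0r.
  rewrite add0r subr0; lra.
rewrite subr0 cosB cos_pihalf sin_pihalf; lra.
Qed.

Definition truncation N (u : L2T R) : seq (R * (nat * R)) :=
  projT1 (cid2 (truncation_exists N u)).

Lemma truncation_freq N u : freq_lt N (truncation N u).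
Proof. by rewrite /truncation; case: cid2. Qed.

Lemma truncation_ip N u l b : (l < N)%N ->
  ip m (tpoly (truncation N u)) (wave l b) = ip m u (wave l b).
Proof. by rewrite /truncation; case: cid2 => s /= _; exact. Qed.

(** The residual [w] is orthogonal to all polynomials of frequency below [N], hence to w' - w. So
    |w|^2 = <w, w'>, and the Cauchy-Schwarz inequality concludes. *)
Lemma best_approximation N (v : L2T R) s s' : freq_lt N s -> freq_lt N s' ->
  (forall l b, (l < N)%N -> ip m (tpoly s) (wave l b) = ip m v (wave l b)) ->
  `|v - to_L2 m (tpoly s)| <= `|v - to_L2 m (tpoly s')|.
Proof.
move=> hs hs' orth; set w : L2T R := v - _; set w' : L2T R := v - _.
have hl r := @tpoly_Lfun R r; have hv := L2_Lfun v; have hw := L2_Lfun w; have hw' := L2_Lfun w'.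
have wE r : ip m w (tpoly r) = ip m v (tpoly r) - ip m (tpoly s) (tpoly r).
  by rewrite /w addrC -scaleN1r ip_linear // ip_to_L2 // mulN1r addrC.
have w0 r : freq_lt N r -> ip m w (tpoly r) = 0.
  move=> /allP hr; rewrite wE [ip m v _]ipC [ip m (tpoly s) _]ipC !ip_tpoly //.
  apply/eqP; rewrite subr_eq0; apply/eqP; rewrite !big_seq; apply: eq_bigr => t tr; congr (_ * _).
  by rewrite ipC -orth ?hr // ipC.
have [->|wn0] := eqVneq w 0; first by rewrite normr0.
have nw : 0 < `|w| by rewrite normr_gt0.
rewrite -(ler_pM2l nw) -expr2 -ip_norm.
have -> : ip m w w = ip m w w'.
  have -> : w' = (-1) *: to_L2 m (tpoly s') + (1 *: to_L2 m (tpoly s) + w).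
    by rewrite scale1r scaleN1r /w subrKC addrC.
  rewrite [RHS]ipC ip_linear ?L2_Lfun // ip_linear ?L2_Lfun // !ip_to_L2 ?L2_Lfun //.
  by rewrite ![ip m (tpoly _) _]ipC !w0 // !mulr0 !add0r.
by apply: (le_trans (ler_norm _)); exact: cauchy_schwarz.
Qed.

Lemma freq_lt_bound (s : seq (R * (nat * R))) : exists N, forall M, (N <= M)%N -> freq_lt M s.
Proof.
elim: s => [|t s [N IH]]; first by exists 0%N.
exists (maxn t.2.1.+1 N) => M; rewrite geq_max => /andP[h1 h2].
by rewrite /freq_lt /= h1; exact: IH.
Qed.

Lemma iter_tder_freq N j (s : seq (R * (nat * R))) : freq_lt N s -> freq_lt N (iter j (@tder R) s).
Proof.
move=> hs; elim: j => // j IH; rewrite iterS /freq_lt all_map.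
by apply: sub_all IH.
Qed.

Lemma wave_tpoly k (a : R) : wave k a = tpoly [:: (1, (k, a))].
Proof. by apply/funext => x; rewrite tpoly_cons /tpoly big_nil mul1r addr0. Qed.

(** On both sides the derivatives are moved onto the wave. They leave its frequency below [N], where
    [u] and its truncation have the same pairings. *)
Lemma truncation_derivative_ip N j (u v : L2T R) l b : is_weak_derivative j u v -> (l < N)%N ->
  ip m (tpoly (iter j (@tder R) (truncation N u))) (wave l b) = ip m v (wave l b).
Proof.
move=> uv lN; apply: (@mulfI _ ((-1) ^+ j : R)); first by rewrite signr_eq0.
have sm : periodic_smooth (wave l b) by rewrite wave_tpoly; exact: tpoly_smooth.
rewrite -tpoly_by_parts // -[RHS](uv _ sm) -/(ip m u (derive1n j (wave l b))) wave_tpoly derive1n_tpoly.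
have hu := L2_Lfun u; have hs r := @tpoly_Lfun R r.
rewrite ipC [RHS]ipC !ip_tpoly // !big_seq; apply: eq_bigr => t ht.
congr (_ * _); rewrite ipC truncation_ip 1?ipC //.
have : freq_lt N [:: (1 : R, (l, b))] by rewrite /freq_lt /= lN.
by move/(iter_tder_freq j)/allP; exact.
Qed.

(** The truncation depends on [u] and [M] but not on [j], and the bound persists for larger [M]: one
    truncation can therefore serve several derivatives. *)
Lemma truncation_derivative_cvg j (u v : L2T R) e : is_weak_derivative j u v -> 0 < e ->
  exists N, forall M, (N <= M)%N ->
    `|v - to_L2 m (tpoly (iter j (@tder R) (truncation M u)))| < e.
Proof.
move=> uv e0; have [f [s fs] hf] := trig_dense v e0.
have {}fs : f = tpoly s by exact/funext.
have [N hN] := freq_lt_bound s; exists N => M NM.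
apply: le_lt_trans hf; rewrite fs; apply: (@best_approximation M); last first.
- by move=> l b lM; exact: truncation_derivative_ip.
- exact: hN.
- by apply: iter_tder_freq; exact: truncation_freq.
Qed.

End fourier_projection.

(** * Fourier multipliers and comparison of their norms *)

Section fourier_multipliers.
Variable R : realType.
Notation m := (@circle_measure R).
Notation Lf := (Lfun m 2%:E).

Lemma tpoly_tscale (f : nat -> R) s x :
  tpoly (tscale f s) x = \sum_(t <- s) f t.2.1 * (t.1 * wave t.2.1 t.2.2 x).
Proof. by rewrite /tpoly big_map; apply: eq_bigr => t _; rewrite mulrA. Qed.

Lemma tscale_linear a (f g : nat -> R) s :
  to_L2 m (tpoly (tscale (fun k => a * f k + g k) s)) =
  a *: to_L2 m (tpoly (tscale f s)) + to_L2 m (tpoly (tscale g s)).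
Proof.
rewrite -to_L2Z ?tpoly_Lfun // -to_L2D ?tpoly_Lfun //; last by apply: Lfun2Z; exact: tpoly_Lfun.
congr to_L2; apply/funext => x; rewrite !tpoly_tscale mulr_sumr -big_split /=.
by apply: eq_bigr => t _; rewrite mulrDl -mulrA.
Qed.

Lemma tscale_freq N f (s : seq (R * (nat * R))) : freq_lt N s -> freq_lt N (tscale f s).
Proof. by move=> hs; rewrite /freq_lt all_map; apply: sub_all hs. Qed.

(** Pythagoras for the highest frequency: on the top entries, all of frequency [N], the multiplier
    is the scalar [f N], and they are orthogonal to the rest. Grouping entries by frequency takes
    the place of Parseval's identity, since a list may repeat a frequency. *)
Lemma ip_tscale_top N s (f : nat -> R) : freq_lt N.+1 s ->
  let low := [seq t <- s | t.2.1 < N]%N in let top := [seq t <- s | ~~ (t.2.1 < N)]%N in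
  ip m (tpoly (tscale f s)) (tpoly (tscale f s)) =
  ip m (tpoly (tscale f low)) (tpoly (tscale f low)) + f N ^+ 2 * ip m (tpoly top) (tpoly top).
Proof.
move=> /allP hs low top; set L := tpoly (tscale f low); set T := tpoly top.
have tE t : t \in top -> t.2.1 = N.
  rewrite mem_filter -leqNgt => /andP[h1 h2]; apply/eqP.
  by rewrite eqn_leq h1 andbT -ltnS; exact: hs.
have -> : tpoly (tscale f s) = fun x => f N * T x + L x.
  apply/funext => x; rewrite /T /L !tpoly_tscale (bigID (fun t => t.2.1 < N)%N) /= addrC.
  congr (_ + _); last by rewrite /low big_filter.
  by rewrite -big_filter -/top /tpoly mulr_sumr; apply: eq_big_seq => t /tE ->.
have hL : L \in Lf := tpoly_Lfun _; have hT : T \in Lf := tpoly_Lfun _.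
have hZ : (fun x => f N * T x) \in Lf by apply: Lfun2Z.
have hS : (fun x => f N * T x + L x) \in Lf by apply: Lfun2D.
have TL : ip m T L = 0.
  rewrite /T ip_tpoly // big_seq big1 // => t tt; rewrite ipC.
  rewrite (@ip_tpoly_wave_ge _ N) ?mulr0 ?tE // tscale_freq //.
  by apply/allP => q; rewrite mem_filter => /andP[].
rewrite ipDl // ipZl // [ip m T _]ipC [ip m L _]ipC !ipDl // !ipZl // TL [ip m L T]ipC TL.
by rewrite mulr0 add0r addr0 addrC mulrA expr2.
Qed.

Lemma ip_tscale_le N s (f g : nat -> R) B : freq_lt N s ->
  (forall k, `|f k| <= B * g k) ->
  ip m (tpoly (tscale f s)) (tpoly (tscale f s)) <=
  B ^+ 2 * ip m (tpoly (tscale g s)) (tpoly (tscale g s)).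
Proof.
move=> hs fg; elim: N s hs => [|N IH] s hs.
  case: s hs => // _; rewrite !ip_tpoly ?tpoly_Lfun // !big_nil mulr0 //.
rewrite !(ip_tscale_top _ hs) mulrDr lerD //.
  by apply: IH; apply/allP => q; rewrite mem_filter => /andP[].
rewrite mulrA -exprMn ler_wpM2r //.
  by rewrite /ip Rintegral_ge0 // => x _; rewrite -expr2 sqr_ge0.
rewrite -[f N ^+ 2]real_normK ?num_real // ler_sqr ?nnegrE //.
exact: le_trans (fg N).
Qed.

(** Meant for [f] the symbol of A_eps - A and [g] that of the fourth derivative. *)
Lemma multiplier_le s (f g : nat -> R) B : 0 <= B -> (forall k, `|f k| <= B * g k) ->
  `|to_L2 m (tpoly (tscale f s))| <= B * `|to_L2 m (tpoly (tscale g s))|.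
Proof.
move=> B0 fg; have [N /(_ N (leqnn N)) hN] := freq_lt_bound s.
rewrite -(@ler_pXn2r _ 2) ?nnegrE ?mulr_ge0 // exprMn !L2_sqr_norm_to_L2 ?tpoly_Lfun //.
exact: ip_tscale_le hN fg.
Qed.

(** One derivative shifts the phases by pi / 2, which [tscale] cannot express; two shift them by pi,
    which is a change of sign. *)
Lemma tpoly_tder2 (f : nat -> R) s :
  tpoly (tscale f (tder (tder s))) = tpoly (tscale (fun k => - ((2 * pi * k%:R) ^+ 2 * f k)) s).
Proof.
apply/funext => x; rewrite !tpoly_tscale !big_map; apply: eq_bigr => t _ /=.
have -> : wave t.2.1 (t.2.2 + pi / 2 + pi / 2) x = - wave t.2.1 t.2.2 x.
  by rewrite /wave -addrA -splitr addrA cosDpi.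
move: pi (wave _ _ _) => q w; ring.
Qed.

Lemma tscale1 s : tpoly (tscale (fun=> 1 : R) s) = tpoly s.
Proof. by apply/funext => x; rewrite tpoly_scale mul1r. Qed.

Lemma weak_derivative_tpoly k s :
  weak_derivative k (to_L2 m (tpoly s)) = to_L2 m (tpoly (iter k (@tder R) s)).
Proof. exact/weak_derivativeE/tpoly_weak_derivative. Qed.

Lemma weak_derivative2_tpoly s : weak_derivative 2 (to_L2 m (tpoly s)) =
  to_L2 m (tpoly (tscale (fun k => - (2 * pi * k%:R) ^+ 2) s)).
Proof.
rewrite weak_derivative_tpoly /= -tscale1 tpoly_tder2; congr (to_L2 m (tpoly (tscale _ _))).
by apply/funext => k; rewrite mulr1.
Qed.

Lemma weak_derivative4_tpoly s : weak_derivative 4 (to_L2 m (tpoly s)) =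
  to_L2 m (tpoly (tscale (fun k => (2 * pi * k%:R) ^+ 4) s)).
Proof.
rewrite weak_derivative_tpoly /= -tscale1 !tpoly_tder2; congr (to_L2 m (tpoly (tscale _ _))).
apply/funext => k; move: pi => q; ring.
Qed.

Lemma conv_op_tpoly (h : R -> R) : measurable_fun setT h ->
  {ae @lebesgue_measure R, forall z, 0 <= h z} ->
  (\int[@lebesgue_measure R]_z (h z)%:E = 1)%E ->
  {ae @lebesgue_measure R, forall z, h (- z) = h z} ->
  forall s, conv_op h (to_L2 m (tpoly s)) = to_L2 m (tpoly (tscale (cosine_transform h) s)).
Proof.
move=> mh h0 h1 he; have lin := conv_op_linear mh h0 h1.
have tcons t (s : seq (R * (nat * R))) : to_L2 m (tpoly (t :: s)) =
    t.1 *: to_L2 m (wave t.2.1 t.2.2) + to_L2 m (tpoly s).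
  rewrite -to_L2Z ?wave_Lfun // -to_L2D ?tpoly_Lfun //; last by apply: Lfun2Z; exact: wave_Lfun.
  by congr to_L2; apply/funext => x; rewrite tpoly_cons.
elim=> [|t s IH].
  have -> : tpoly [::] = fun=> 0 :> R by apply/funext => x; rewrite /tpoly big_nil.
  rewrite to_L20; have := lin (-1) 0 0; rewrite scaler0 addr0 scaleN1r addNr; exact.
rewrite tcons lin IH /= tcons /=; congr (_ + _).
rewrite conv_op_to_L2 ?wave_Lfun // mulrC -scalerA -[in RHS]to_L2Z ?wave_Lfun //.
by congr (_ *: to_L2 _ _); apply/funext => x; rewrite conv_wave.
Qed.

End fourier_multipliers.

(** * Moments of the density and the rescaled kernel *)

Section rescaled_kernel.
Variable R : realType.
Notation mu := (@lebesgue_measure R).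
Notation m := (@circle_measure R).

Lemma ae_scale (a : R) (P : R -> Prop) : a != 0 -> {ae mu, forall z, P z} ->
  {ae mu, forall z, P (a * z)}.
Proof.
move=> a0 [A [mA A0 PA]]; have mA' : measurable (( *%R a) @^-1` A).
  have ma : measurable_fun [set: measurableTypeR R] (( *%R a) : measurableTypeR R -> measurableTypeR R).
    exact: measurable_funM.
  by rewrite -[X in measurable X]setTI; exact: ma.
exists (( *%R a) @^-1` A); split => //; last by move=> z /= nP; apply: PA.
have := lebesgue_measure_affine 0 a0 mA; rewrite [RHS]A0.
under eq_fun do rewrite addr0.
move=> /eqP; rewrite mule_eq0 eqe normr_eq0 (negPf a0) /= => /eqP; exact.
Qed.

Lemma integrable_affine (a b : R) (f : R -> R) : a != 0 ->
  mu.-integrable setT (EFin \o f) -> mu.-integrable setT (EFin \o (fun x => f (a * x + b))).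
Proof.
move=> a0 /integrableP[mf fi]; apply/integrableP; split.
  by apply: (measurableT_comp mf); apply: measurable_funD => //; exact: measurable_funM.
have ma : measurable_fun setT (fun x => `|(EFin \o f) x|)%E by exact: measurableT_comp.
have h := ge0_integral_affine b a0 ma (fun x => abse_ge0 _).
rewrite ltey; apply/negP => /eqP e; move: fi; rewrite -h /= e gt0_muley ?ltxx //.
by rewrite lte_fin normr_gt0.
Qed.

Variable rho : R -> R.
Hypothesis rho_integrable : mu.-integrable setT (EFin \o rho).
Hypothesis rho_even : {ae mu, forall z, rho (- z) = rho z}.
Hypothesis rho_ge0 : {ae mu, forall z, 0 <= rho z}.
Hypothesis rho_mass : \int[mu]_z rho z = 1.
Hypothesis rho_m4 : (\int[mu]_z (z ^+ 4 * rho z)%:E < +oo)%E.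

Let mrho : measurable_fun setT rho.
Proof. by apply/measurable_EFinP; case/integrableP: rho_integrable. Qed.

Let mpow n : measurable_fun setT (fun z : R => z ^+ n * rho z).
Proof. by apply: measurable_funM => //; exact: measurable_funX. Qed.

Lemma fourth_moment_integrable : mu.-integrable setT (EFin \o (fun z => z ^+ 4 * rho z)).
Proof.
apply/integrableP; split; first by apply/measurable_EFinP; exact: mpow.
rewrite (@ae_eq_integral _ _ _ mu setT (EFin \o (fun z => z ^+ 4 * rho z))) //.
- by apply: measurableT_comp => //; apply/measurable_EFinP; exact: mpow.
- by apply/measurable_EFinP; exact: mpow.
apply: (ae_imp rho_ge0) => z hz _; rewrite /= ger0_norm // mulr_ge0 //.
by rewrite (exprM z 2 2) sqr_ge0.
Qed.

(** As (z^2 - 1)^2 >= 0, z^2 <= 1 + z^4, and both terms on the right are integrable against the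
    density. *)
Lemma second_moment_integrable : mu.-integrable setT (EFin \o (fun z => z ^+ 2 * rho z)).
Proof.
have H (z : R) : `|z ^+ 2 * rho z| <= `|rho z| + `|z ^+ 4 * rho z|.
  have z2 : 0 <= z ^+ 2 by exact: sqr_ge0.
  have z4 : 0 <= z ^+ 4 by rewrite (exprM z 2 2) sqr_ge0.
  rewrite (normrM (z ^+ 2)) (normrM (z ^+ 4)) (ger0_norm z2) (ger0_norm z4).
  rewrite -[X in X + _]mul1r -mulrDl ler_wpM2r // (exprM z 2 2).
  have : 0 <= (z ^+ 2 - 1) ^+ 2 by exact: sqr_ge0.
  have : 0 <= z ^+ 2 by exact: sqr_ge0.
  by move: (z ^+ 2) => y; nra.
have := integrableD measurableT (integrable_abse rho_integrable) (integrable_abse fourth_moment_integrable).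
apply: le_integrable => //; first by apply/measurable_EFinP; exact: mpow.
by move=> z _; exact: le_trans (H z) (ler_norm _).
Qed.

(** If it were zero, z^2 rho(z) would vanish almost everywhere, hence so would rho, since the origin
    is a null set; this contradicts the mass 1. *)
Lemma second_moment_gt0 : 0 < second_moment rho.
Proof.
have h0 : 0 <= second_moment rho.
  rewrite /second_moment /Rintegral fine_ge0 //.
  rewrite (@ae_eq_integral _ _ _ mu setT (EFin \o (fun z => `|z ^+ 2 * rho z|))) //.
  - by apply: integral_ge0 => z _; rewrite lee_fin.
  - by apply/measurable_EFinP; exact: mpow.
  - by apply/measurable_EFinP; apply: measurableT_comp => //; exact: mpow.
  by apply: (ae_imp rho_ge0) => z hz _; rewrite /= ger0_norm // mulr_ge0 // sqr_ge0.
rewrite lt_neqAle h0 andbT; apply/negP => /eqP/esym m0.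
have : (\int[mu]_z `|(EFin \o (fun z => z ^+ 2 * rho z)%R) z|)%E = 0%E.
  rewrite (@ae_eq_integral _ _ _ mu setT (EFin \o (fun z => z ^+ 2 * rho z))) //; last 3 first.
  - by apply: measurableT_comp => //; apply/measurable_EFinP; exact: mpow.
  - by apply/measurable_EFinP; exact: mpow.
  - by apply: (ae_imp rho_ge0) => z hz _; rewrite /= ger0_norm // mulr_ge0 // sqr_ge0.
  rewrite -[LHS]fineK; last exact: integrable_fin_num second_moment_integrable.
  by rewrite -[fine _]/(second_moment rho) m0.
have mE : measurable_fun setT (EFin \o (fun z => z ^+ 2 * rho z)) by apply/measurable_EFinP; exact: mpow.
move=> /(ae_eq_integral_abs mu measurableT mE) z0.
have n0 : {ae mu, forall z : R, z != 0}.
  exists [set 0]; split => //; first exact: lebesgue_measure_set1.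
  by move=> z /= /negP; rewrite negbK => /eqP.
have r0 : \int[mu]_z rho z = \int[mu]_z (0 : R).
  rewrite /Rintegral; congr fine; apply: ae_eq_integral => //.
    exact/measurable_EFinP.
  apply: (ae_imp2 z0 n0) => z /(_ I) [] /eqP; rewrite mulf_eq0 sqrf_eq0 => /orP[/eqP->|/eqP-> //].
  by rewrite eqxx.
by have := rho_mass; rewrite r0 Rintegral_cst // mul0r => /esym/eqP; rewrite oner_eq0.
Qed.

Variable eps : R.
Hypothesis eps_gt0 : 0 < eps.
Notation h := (scaled_kernel rho eps).

Let eps0 : eps^-1 != 0. Proof. by rewrite invr_eq0 gt_eqF. Qed.

Let hE : h = fun z => eps^-1 * rho (eps^-1 * z + 0).
Proof. by apply/funext => z; rewrite /scaled_kernel addr0 [z / eps]mulrC. Qed.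

Lemma scaled_kernel_integrable : mu.-integrable setT (EFin \o h).
Proof.
rewrite hE; exact: (integrableZl measurableT eps^-1 (integrable_affine 0 eps0 rho_integrable)).
Qed.

Lemma measurable_scaled_kernel : measurable_fun setT h.
Proof. by apply/measurable_EFinP; case/integrableP: scaled_kernel_integrable. Qed.

Lemma scaled_kernel_ge0 : {ae mu, forall z, 0 <= h z}.
Proof.
apply: (ae_imp (ae_scale eps0 rho_ge0)) => z hz.
by rewrite hE addr0 mulr_ge0 // invr_ge0 ltW.
Qed.

Lemma scaled_kernel_even : {ae mu, forall z, h (- z) = h z}.
Proof.
apply: (ae_imp (ae_scale eps0 rho_even)) => z hz.
by rewrite hE !addr0 mulrN hz.
Qed.

Lemma scaled_kernel_mass : (\int[mu]_z (h z)%:E = 1)%E.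
Proof.
rewrite -[LHS]fineK; last exact: integrable_fin_num scaled_kernel_integrable.
rewrite -[fine _]/(\int[mu]_z h z) hE RintegralZl //; last exact: integrable_affine.
have := integral_affine 0 eps0 rho_integrable; rewrite rho_mass.
by rewrite ger0_norm ?invr_ge0 ?ltW // => ->.
Qed.

Lemma cosine_transform_scaled k :
  cosine_transform h k = \int[mu]_z (rho z * cos (2 * pi * k%:R * eps * z)).
Proof.
set f := fun z => rho z * cos _.
have fi : mu.-integrable setT (EFin \o f).
  apply: le_integrable rho_integrable => //.
    apply/measurable_EFinP; apply: measurable_funM => //.
    apply: (measurableT_comp (continuous_measurable_fun (@continuous_cos R))).
    exact: measurable_funM.
  by move=> z _; rewrite /= lee_fin normrM ler_piMr // ler_norml cos_geN1 cos_le1.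
rewrite -(integral_affine 0 eps0 fi) ger0_norm ?invr_ge0 ?ltW //.
rewrite -RintegralZl //; last exact: integrable_affine.
apply: eq_Rintegral => z _; rewrite hE /f mulrA addr0; congr (_ * cos _).
by rewrite -[in RHS]mulrA [eps * _]mulrA mulfV ?mul1r // gt_eqF.
Qed.

(** As rho has mass 1, the quantity on the left is the integral of rho(z) times cos(t z) - 1 + (t
    z)^2 / 2, and the cosine bounds apply under the integral. *)
Lemma cosine_transform_expansion k (t := 2 * pi * k%:R * eps) :
  `|cosine_transform h k - 1 + t ^+ 2 / 2 * second_moment rho| <=
  t ^+ 4 / 24 * \int[mu]_z (z ^+ 4 * rho z).
Proof.
rewrite cosine_transform_scaled -/t.
have ci : mu.-integrable setT (EFin \o (fun z => rho z * cos (t * z))).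
  apply: le_integrable rho_integrable => //.
    apply/measurable_EFinP; apply: measurable_funM => //.
    apply: (measurableT_comp (continuous_measurable_fun (@continuous_cos R))).
    exact: measurable_funM.
  by move=> z _; rewrite /= lee_fin normrM ler_piMr // ler_norml cos_geN1 cos_le1.
have qi := integrableZl measurableT (t ^+ 2 / 2) second_moment_integrable.
have Qi := integrableZl measurableT (t ^+ 4 / 24) fourth_moment_integrable.
have di := integrableB measurableT ci rho_integrable.
have fi := integrableD measurableT di qi.
have -> : \int[mu]_z (rho z * cos (t * z)) - 1 + t ^+ 2 / 2 * second_moment rho =
    \int[mu]_z (rho z * cos (t * z) - rho z + t ^+ 2 / 2 * (z ^+ 2 * rho z)).
  rewrite RintegralD // RintegralB // RintegralZl // ?rho_mass //.
  exact: second_moment_integrable.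
rewrite -RintegralZl //; last exact: fourth_moment_integrable.
set F := fun z => rho z * _ - _ + _; set G := fun z => _ * (_ * _).
have FG : {ae mu, forall z, 0 <= F z <= G z}.
  apply: (ae_imp rho_ge0) => z hz; have /andP[c1 c2] := cos_taylor_bounds (t * z).
  have -> : F z = rho z * (cos (t * z) - 1 + (t * z) ^+ 2 / 2).
    by rewrite /F; move: (cos _) => c; field.
  have -> : G z = rho z * ((t * z) ^+ 4 / 24) by rewrite /G; field.
  by rewrite mulr_ge0 //= ler_wpM2l.
have mF : measurable_fun setT (EFin \o F) by case/integrableP: fi.
have mG : measurable_fun setT (EFin \o G) by case/integrableP: Qi.
apply: (le_trans (le_normr_Rintegral _ _)) => //.
rewrite /Rintegral fine_le //.
- by apply: (integrable_fin_num measurableT (integrable_abse fi)).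
- exact: (integrable_fin_num measurableT Qi).
have -> : (\int[mu]_z (G z)%:E = \int[mu]_z `|(G z)%:E|)%E.
  apply: ae_eq_integral => //; first exact: measurableT_comp.
  by apply: (ae_imp FG) => z /andP[a b] _; rewrite gee0_abs // lee_fin (le_trans a b).
apply: ae_ge0_le_integral => //.
- by apply/measurable_EFinP; apply: measurableT_comp => //; exact/measurable_EFinP.
- by apply: measurableT_comp.
by apply: (ae_imp FG) => z /andP[a b] _; rewrite lee_fin !ger0_norm // (le_trans a b).
Qed.

End rescaled_kernel.

(** * Generation and consistency of the nonlocal operator *)

Section nonlocal_operator.
Variable R : realType.
Notation mu := (@lebesgue_measure R).
Notation m := (@circle_measure R).
Notation Lf := (Lfun m 2%:E).
Variables (kappa : R) (rho : R -> R).
Hypothesis kappa_gt0 : 0 < kappa.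
Hypothesis rho_integrable : mu.-integrable setT (EFin \o rho).
Hypothesis rho_even : {ae mu, forall z, rho (- z) = rho z}.
Hypothesis rho_ge0 : {ae mu, forall z, 0 <= rho z}.
Hypothesis rho_mass : \int[mu]_z rho z = 1.
Hypothesis rho_m4 : (\int[mu]_z (z ^+ 4 * rho z)%:E < +oo)%E.

Let m2 := second_moment rho.
Let m4 := \int[mu]_z (z ^+ 4 * rho z).
Let m2_gt0 : 0 < m2. Proof. exact: second_moment_gt0. Qed.

(** The prefactor times the quartic remainder at frequency w: (2 kappa / (m2 eps^2)) (w eps)^4 / 24
    m4 is this rate times w^4. *)
Definition consistency_rate (eps : R) : R := kappa * m4 / (12 * m2) * eps ^+ 2.

(** Read off from the expansion with eps = 1 and k = 1, which bounds an absolute value by a positive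
    multiple of m4. *)
Lemma fourth_moment_ge0 : 0 <= m4.
Proof.
have := cosine_transform_expansion rho_integrable rho_ge0 rho_mass rho_m4 ltr01 1.
move/(le_trans (normr_ge0 _)); rewrite pmulr_rge0 //.
by rewrite divr_gt0 // exprn_gt0 // !mulr_gt0 // pi_gt0.
Qed.

Variable eps : R.
Hypothesis eps_gt0 : 0 < eps.
Notation h := (scaled_kernel rho eps).
Let c := 2 * kappa / (m2 * eps ^+ 2).

Let c_gt0 : 0 < c.
Proof. by rewrite divr_gt0 // mulr_gt0 // exprn_gt0. Qed.

Let mh := measurable_scaled_kernel rho_integrable eps_gt0.
Let h0 := scaled_kernel_ge0 rho_ge0 eps_gt0.
Let h1 := scaled_kernel_mass rho_integrable rho_mass eps_gt0.
Let he := scaled_kernel_even rho_even eps_gt0.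

Lemma nonlocal_ae (u : L2T R) :
  {ae m, forall x, nonlocal_fun kappa rho eps u x = c * (conv h u x - u x)}.
Proof.
by apply: (ae_imp (conv_increment mh h0 h1 (L2_Lfun u))) => x <-.
Qed.

Lemma nonlocal_Lfun (u : L2T R) : nonlocal_fun kappa rho eps u \in Lf.
Proof.
have hu := L2_Lfun u; have hc := conv_Lfun mh h0 h1 hu.
apply: (@Lfun2_ae _ _ _ m _ (fun x => c * (conv h u x - u x))).
- by apply: measurable_funM => //; exact: measurable_increment.
- by apply: Lfun2Z; exact: Lfun2B.
- exact: nonlocal_ae.
Qed.

Lemma nonlocal_domain : domain (nonlocal kappa rho eps) = setT.
Proof. by apply/seteqP; split => // u _; exact: nonlocal_Lfun. Qed.

Lemma nonlocalE (u : L2T R) : nonlocal kappa rho eps u = c *: (conv_op h u - u).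
Proof.
have hu := L2_Lfun u; have hc := conv_Lfun mh h0 h1 hu.
rewrite -{3}(to_L2K u) -to_L2B // -to_L2Z; last exact: Lfun2B.
apply: to_L2_ae; [exact: nonlocal_Lfun|by apply: Lfun2Z; exact: Lfun2B|exact: nonlocal_ae].
Qed.

Lemma nonlocal_semigroup : exists S : R -> L2T R -> L2T R,
  [/\ C0_semigroup S, generates (nonlocal kappa rho eps) S & semigroup_bound S 1 0].
Proof.
have lin := conv_op_linear mh h0 h1.
have con := conv_op_contraction mh h0 h1.
have rf := @riesz_fischer _ _ R m.
exists (exp_semigroup (conv_op h) c); split.
- exact: (exp_semigroup_C0 rf lin con (ltW c_gt0)).
- exact: (exp_semigroup_generates rf con (ltW c_gt0) nonlocal_domain nonlocalE).
- exact: (exp_semigroup_bound rf con (ltW c_gt0)).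
Qed.

(** The symbol of A_eps - A, bracketed in the shape a f + g that [tscale_linear] takes apart. *)
Lemma multiplier_expansion k :
  `|c * cosine_transform h k + (- c + kappa * (2 * pi * k%:R) ^+ 2)| <=
  consistency_rate eps * (2 * pi * k%:R) ^+ 4.
Proof.
have := cosine_transform_expansion rho_integrable rho_ge0 rho_mass rho_m4 eps_gt0 k.
rewrite -/m2 -/m4 /consistency_rate; move: (2 * pi * k%:R) (cosine_transform h k) => w g H.
(* The choice of [c] gives c (w eps)^2 / 2 m2 = kappa w^2, so the symbol of the diffusion absorbs
   the quadratic term. *)
have -> : c * g + (- c + kappa * w ^+ 2) = c * (g - 1 + (w * eps) ^+ 2 / 2 * m2).
  by rewrite /c; field; rewrite !gt_eqF.
rewrite normrM gtr0_norm //; apply: (le_trans (ler_wpM2l (ltW c_gt0) H)).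
rewrite le_eqVlt; apply/orP; left; apply/eqP.
by rewrite /c; field; rewrite !gt_eqF.
Qed.

Lemma consistency_estimate s :
  `|nonlocal kappa rho eps (to_L2 m (tpoly s)) - diffusion kappa (to_L2 m (tpoly s))|
    <= consistency_rate eps * Sobolev_norm 4 (to_L2 m (tpoly s)).
Proof.
set u := to_L2 m (tpoly s).
have r0 : 0 <= consistency_rate eps.
  by rewrite mulr_ge0 ?sqr_ge0 // divr_ge0 ?mulr_ge0 ?fourth_moment_ge0 // ltW.
have -> : nonlocal kappa rho eps u - diffusion kappa u = to_L2 m (tpoly
    (tscale (fun k => c * cosine_transform h k + (- c + kappa * (2 * pi * k%:R) ^+ 2)) s)).
  rewrite nonlocalE /= /u weak_derivative2_tpoly conv_op_tpoly //.
  (* The symbol is separated into those of the convolution, the identity and the second derivative;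
     the factor 1 and the summand 0 inserted below complete the pattern a f + g. *)
  rewrite (tscale_linear c (cosine_transform h)).
  have -> : (fun k : nat => - c + kappa * (2 * pi * k%:R) ^+ 2) =
      fun k => - c * 1 + kappa * (2 * pi * k%:R) ^+ 2 by apply/funext => k; rewrite mulr1.
  rewrite (tscale_linear (- c) (fun=> 1)) tscale1 scalerBr scaleNr addrA; congr (_ + _).
  have -> : (fun k : nat => kappa * (2 * pi * k%:R) ^+ 2) =
      fun k => - kappa * - (2 * pi * k%:R) ^+ 2 + 0 by apply/funext => k; rewrite mulrNN addr0.
  rewrite (tscale_linear (- kappa) _ (fun=> 0)) scaleNr.
  rewrite [X in _ + X](_ : _ = 0) ?addr0 // -to_L20; congr to_L2.
  by apply/funext => x; rewrite tpoly_scale mul0r.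
apply: (le_trans (multiplier_le s r0 multiplier_expansion)).
rewrite -weak_derivative4_tpoly -/u ler_wpM2l //.
(* Of the sum in the Sobolev norm only the term of order 4 is kept. *)
rewrite -[leLHS]normr_id -sqrtr_sqr ler_sqrt.
  by rewrite (bigD1 (@ord_max 4)) //= lerDl sumr_ge0.
by rewrite sumr_ge0.
Qed.

End nonlocal_operator.

(** * Trigonometric polynomials in Sobolev spaces and as a core *)

Section sobolev_density.
Variable R : realType.
Notation m := (@circle_measure R).

Definition trig_classes : set (L2T R) := [set u | exists s, u = to_L2 m (tpoly s)].

Lemma trig_classes_subspace : is_subspace trig_classes.
Proof.
split; first by exists [::]; rewrite -to_L20; congr to_L2; apply/funext => x; rewrite /tpoly big_nil.
move=> a _ _ [s ->] [s' ->]; exists (tscale (fun=> a) s ++ s').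
rewrite -to_L2Z ?tpoly_Lfun // -to_L2D ?tpoly_Lfun //; last by apply: Lfun2Z; exact: tpoly_Lfun.
by congr to_L2; apply/funext => x; rewrite tpoly_cat tpoly_scale.
Qed.

Lemma trig_classes_Sobolev k : trig_classes `<=` Sobolev k.
Proof.
by move=> _ [s ->] j _; exists (to_L2 m (tpoly (iter j (@tder R) s))); exact: tpoly_weak_derivative.
Qed.

(** Each derivative of order at most k is well approximated from some frequency on, and the largest
    of these finitely many frequencies serves all of them. *)
Lemma truncation_Sobolev k (u : L2T R) e : Sobolev k u -> 0 < e ->
  exists2 phi, trig_classes phi & forall j, (j <= k)%N -> `|weak_derivative j (u - phi)| < e.
Proof.
move=> hu e0.
have step j v s : is_weak_derivative j u v ->
    weak_derivative j (u - to_L2 m (tpoly s)) = v - to_L2 m (tpoly (iter j (@tder R) s)).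
  move=> uv; apply: weak_derivativeE.
  rewrite addrC -scaleN1r [X in is_weak_derivative _ _ X]addrC -[X in _ (X + v)]scaleN1r.
  apply: weak_derivativeD => //; exact: tpoly_weak_derivative.
suff [N hN] : exists N, forall M, (N <= M)%N -> forall j, (j <= k)%N ->
    `|weak_derivative j (u - to_L2 m (tpoly (truncation M u)))| < e.
  by exists (to_L2 m (tpoly (truncation N u))); [exists (truncation N u)|exact: hN].
have single j : (j <= k)%N -> exists N, forall M, (N <= M)%N ->
    `|weak_derivative j (u - to_L2 m (tpoly (truncation M u)))| < e.
  move=> jk; have [v uv] := hu j jk.
  have [N hN] := truncation_derivative_cvg uv e0.
  by exists N => M NM; rewrite (step _ _ _ uv); exact: hN.
move: single; elim: k {hu} => [|k IH] single.
  by have [N hN] := single 0%N (leqnn _); exists N => M NM [] // _; exact: hN.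
have [N1 h1] := IH (fun j jk => single j (leqW jk)).
have [N2 h2] := single k.+1 (leqnn _).
exists (maxn N1 N2) => M; rewrite geq_max => /andP[n1 n2] j.
by rewrite leq_eqVlt => /predU1P[->|]; [exact: h2|exact: h1].
Qed.

Lemma dense_Sobolev k : dense_for (Sobolev_norm k) trig_classes (Sobolev k).
Proof.
split=> [|u hu e e0]; first exact: trig_classes_Sobolev.
have k0 : 0 < k.+2%:R :> R by rewrite ltr0n.
(* With this tolerance the k + 1 squares add up to at most (k + 1) / (k + 2)^2 e^2, which is less
   than e^2. *)
have [phi hphi hj] := truncation_Sobolev hu (divr_gt0 e0 k0).
exists phi => //; rewrite /Sobolev_norm -[ltRHS](ger0_norm (ltW e0)) -sqrtr_sqr ltr_sqrt ?exprn_gt0 //.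
apply: (@le_lt_trans _ _ (\sum_(j < k.+1) (e / k.+2%:R) ^+ 2)).
  apply: ler_sum => j _; rewrite ler_sqr ?nnegrE //; last by rewrite divr_ge0 // ltW.
  by apply/ltW/hj; rewrite -ltnS.
rewrite sumr_const card_ord expr_div_n -[ltLHS]mulr_natl mulrA ltr_pdivrMr ?exprn_gt0 //.
rewrite mulrC ltr_pM2l ?exprn_gt0 // -natrX ltr_nat.
by rewrite (leq_trans (ltnSn _)) // -[leqLHS]expn1 leq_exp2l.
Qed.

Lemma weak_derivative0 (u : L2T R) : weak_derivative 0 u = u.
Proof. by apply: weak_derivativeE => phi hphi; rewrite expr0 mul1r. Qed.

Lemma core_diffusion (kappa : R) : 0 < kappa -> is_core (diffusion kappa) trig_classes.
Proof.
move=> k0; split; first exact: trig_classes_subspace.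
split=> [|u hu e e0]; first exact: trig_classes_Sobolev.
have k1 : 0 < 1 + kappa by rewrite addr_gt0.
have [phi hphi hj] := truncation_Sobolev hu (divr_gt0 e0 k1).
exists phi => //; rewrite /graph_norm /= normrZ gtr0_norm //.
have := hj 0%N isT; rewrite weak_derivative0 => d0.
have d2 := hj 2%N isT.
have -> : e = e / (1 + kappa) + kappa * (e / (1 + kappa)) by field; rewrite gt_eqF.
by rewrite ltrD // ltr_pM2l.
Qed.

End sobolev_density.

Lemma consistency_rate_bigO (R : realType) (kappa : R) (rho : R -> R) :
  consistency_rate kappa rho =O_ (0^'+) (fun eps : R => eps ^+ 2).
Proof.
apply/eqOP; near=> C; near=> x.
rewrite /consistency_rate normrM ler_wpM2r //.
Unshelve. all: by end_near. Qed.

Theorem lemma6p3 (R : realType) (kappa : R) (rho : R -> R)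
    (kappa_gt0 : 0 < kappa)
    (rho_integrable : (@lebesgue_measure R).-integrable setT (EFin \o rho))
    (rho_even : {ae @lebesgue_measure R, forall z, rho (- z) = rho z})
    (rho_ge0 : {ae @lebesgue_measure R, forall z, 0 <= rho z})
    (rho_mass : \int[@lebesgue_measure R]_z rho z = 1)
    (rho_m4 : (\int[@lebesgue_measure R]_z (z ^+ 4 * rho z)%:E < +oo)%E) :
  exists (D0 : set (L2T R)) (r : R -> R),
    [/\ is_subspace D0 /\ dense_for (Sobolev_norm 4) D0 (Sobolev 4),
        is_core (diffusion kappa) D0,
        r =O_ (0^'+) (fun eps : R => eps ^+ 2),
        forall eps : R, 0 < eps ->
          domain (nonlocal kappa rho eps) = setT /\
          exists S : R -> L2T R -> L2T R,
            [/\ C0_semigroup S,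
                generates (nonlocal kappa rho eps) S &
                semigroup_bound S 1 0] &
        forall eps : R, 0 < eps -> forall phi, D0 phi ->
          `|nonlocal kappa rho eps phi - diffusion kappa phi|
            <= r eps * Sobolev_norm 4 phi].
Proof.
exists (@trig_classes R), (consistency_rate kappa rho); split.
- by split; [exact: trig_classes_subspace|exact: dense_Sobolev].
- exact: core_diffusion.
- exact: consistency_rate_bigO.
- move=> eps eps_gt0; split; first exact: nonlocal_domain.
  exact: nonlocal_semigroup.
- by move=> eps eps_gt0 _ [s ->]; exact: consistency_estimate.
Qed.
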